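(* Let $d\ge 3$, let $V\in L_{1,loc}(\mathbf{R}^d)$ with $V\ge 0$, and let $\mathcal{G}\subset\mathbf{R}^d$ be a domain as in the context. Suppose that for some $r_0>0$ there is a function $\tilde\gamma$ on $(0,r_0)$ with $$\forall\, r\in(0,r_0):\ \tilde\gamma(r)\in(0,1),\qquad \limsup_{r\downarrow 0}\, r^{-2(d-2)/d}\,\tilde\gamma(r)=\infty,$$ such that for every $r\in(0,r_0)$ $$\lim_{|\mathbf{y}|\to\infty}\ \inf_{F\in\mathcal{M}_{\tilde\gamma(r)}(\mathbf{y},r)}\int_{\mathcal{G}_r(\mathbf{y})\setminus F}V(\mathbf{x})\,\mathrm{d}\mathbf{x}=\infty .$$ Then the spectrum of the operator $H=-\Delta+V(\mathbf{x})$ is discrete.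
   Context: $H=-\Delta+V$ is the Schrödinger operator in $L_2(\mathbf{R}^d)$, understood as usual as the self-adjoint operator associated with the closed quadratic form $\int(|\nabla u|^2+V|u|^2)\,\mathrm{d}\mathbf{x}$. Its spectrum is discrete if it consists only of isolated eigenvalues of finite multiplicity. $\mathcal{G}\subset\mathbf{R}^d$ is a fixed open domain such that (a) $\mathcal{G}$ is bounded and star-shaped with respect to every point of some open ball $B_\rho(0)$, $\rho>0$, contained in $\mathcal{G}$; (b) $\mathrm{diam}(\mathcal{G})=2$. For $r>0$ and $\mathbf{y}\in\mathbf{R}^d$, $\mathcal{G}_r(\mathbf{y})=\{\mathbf{x}\in\mathbf{R}^d: r^{-1}\mathbf{x}\in\mathcal{G}\}+\mathbf{y}$. $\mathrm{mes}_d$ is Lebesgue measure on $\mathbf{R}^d$. For $\gamma\in(0,1)$, $\mathcal{M}_\gamma(\mathbf{y},r)$ is the collection of all Borel sets $F\subseteq\mathcal{G}_r(\mathbf{y})$ with $\mathrm{mes}_d(F)\le\gamma\,\mathrm{mes}_d(\mathcal{G}_r(\mathbf{y}))$. *)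

(* Defs.v *)
From HB Require Import structures.
From mathcomp Require Import all_boot all_order all_algebra complex.
From mathcomp Require Import all_classical all_reals all_analysis.
Set Implicit Arguments.
Unset Strict Implicit.
Unset Printing Implicit Defensive.
Import Order.TTheory GRing.Theory Num.Theory.
Import numFieldNormedType.Exports.
Import ComplexField.Normc.
Local Open Scope classical_set_scope.
Local Open Scope ring_scope.
Local Open Scope complex_scope.

(* 'rV[R]_d carries the Borel sigma-algebra: the one generated by its open sets
   (the topology of the sup norm, which is the Euclidean one). *)
Section borel.
Context {R : realType} {d : nat}.
Local Notation E := 'rV[R]_d.
Local Notation B := (@open E).
HB.instance Definition _ := @isMeasurable.Build (sigma_display B) E
  <<s B >> (@sigma_algebra0 _ setT B) (@sigma_algebraC _ B)
  (@sigma_algebra_bigcup _ setT B).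
End borel.

Section lebesgue.
Context {R : realType}.
Local Notation RR := (measurableTypeR R).

Definition tcons n (p : RR * n.-tuple RR) : n.+1.-tuple RR :=
  [tuple of p.1 :: p.2].

Lemma measurable_tcons n : measurable_fun setT (@tcons n).
Proof. exact: measurable_cons. Qed.

Section step.
Variables (n : nat) (mu : {sigma_finite_measure set (n.-tuple RR) -> \bar R}).

Definition lebesgue_tupleS : set (n.+1.-tuple RR) -> \bar R :=
  pushforward (@lebesgue_measure R \x mu)%E (@tcons n).

HB.instance Definition _ := Measure.copy lebesgue_tupleS
  (measure_function_pushforward__canonical__measure_function_Measure
    (@lebesgue_measure R \x mu)%E (@measurable_tcons n)).

Let sigma_finite_lebesgue_tupleS : sigma_finite setT lebesgue_tupleS.
Proof.
have /sigma_finiteP[F [FT ndF Foo]] := sigma_finiteT (@lebesgue_measure R).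
have /sigma_finiteP[G [GT ndG Goo]] := sigma_finiteT mu.
exists (fun k => [set t | F k (thead t) /\ G k [tuple of behead t]]).
  apply/seteqP; split => // t _.
  have [i _ Fi] : (\bigcup_i F i) (thead t) by rewrite -FT.
  have [j _ Gj] : (\bigcup_j G j) [tuple of behead t] by rewrite -GT.
  exists (maxn i j) => //; split.
    by move: Fi; exact/subsetPset/ndF/leq_maxl.
  by move: Gj; exact/subsetPset/ndG/leq_maxr.
move=> k; have [mF Fk] := Foo k; have [mG Gk] := Goo k; split.
  apply: measurableI; rewrite -[X in measurable X]setTI.
    exact: measurable_tnth.
  exact: measurable_behead.
rewrite /lebesgue_tupleS /pushforward.
rewrite (_ : _ @^-1` _ = F k `*` G k).
  by rewrite product_measure1E// lte_mul_pinfty// ge0_fin_numE.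
apply/seteqP; split => -[x t]; rewrite /= theadE;
  by rewrite (_ : [tuple of _] = t)//; exact: val_inj.
Qed.

HB.instance Definition _ := Measure_isSigmaFinite.Build _ _ _ lebesgue_tupleS
  sigma_finite_lebesgue_tupleS.
End step.

Fixpoint lebesgue_tuple n : {sigma_finite_measure set (n.-tuple RR) -> \bar R} :=
  match n with
  | 0 => dirac [tuple of [::]]
  | m.+1 => lebesgue_tupleS (lebesgue_tuple m)
  end.

Definition row_of_tuple n (t : n.-tuple RR) : 'rV[R]_n := \row_i tnth t i.

Lemma measurable_row_of_tuple n : measurable_fun setT (@row_of_tuple n).
Proof.
apply: (@measurability _ _ _ _ _ _ (@open 'rV[R]_n)) => //.
move=> _ [U oU <-]; rewrite setTI.
pose box (q : 'rV[rat]_n * nat) : set (n.-tuple RR) :=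
  \bigcap_(i in [set: 'I_n]) ((fun t => tnth t i) @^-1`
    ball (ratr (q.1 0 i) : R) (q.2.+1%:R^-1)).
pose Q := [set q : 'rV[rat]_n * nat | box q `<=` @row_of_tuple n @^-1` U].
rewrite (_ : _ @^-1` _ = \bigcup_(q in Q) box q).
  rewrite bigcup_mkcond; apply: countable_bigcupT_measurable => [|q].
    exact: countableP.
  case: ifPn => // _; apply: fin_bigcap_measurable => // i _.
  rewrite -[X in measurable X]setTI; apply: measurable_tnth => //.
  exact: measurable_realfun.measurable_ball.
apply/seteqP; split => [t /= Ut|t [q Qq]]; last exact: Qq.
have /nbhs_ballP[e /= e0 eU] : nbhs (row_of_tuple t) U by exact: open_nbhs_nbhs.
pose k := Num.truncn (2 / e).
have ke : 2 * k.+1%:R^-1 < e.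
  rewrite ltr_pdivrMr// mulrC -ltr_pdivrMr//.
  exact: truncnS_gt.
have qP i : {q : rat | `|ratr q - tnth t i| < k.+1%:R^-1}.
  apply: cid; have [|q] := @rat_in_itvoo R (tnth t i - k.+1%:R^-1) (tnth t i + k.+1%:R^-1).
    by rewrite ltrD2l gt0_cp// invr_gt0.
  rewrite in_itv/= => /andP[q1 q2]; exists q.
  by rewrite ltr_norml ltrBrDr ltrBlDr addrC q1 addrC.
have E : 2 * k.+1%:R^-1 = k.+1%:R^-1 + k.+1%:R^-1 :> R by rewrite mulr_natl.
exists (\row_i sval (qP i), k) => [s bs|i _]; last first.
  by rewrite /ball/= mxE; exact: (svalP (qP i)).
apply: eU; split => // a i; rewrite !mxE.
have := bs i I; have := svalP (qP i); rewrite /ball/= mxE => h1 h2.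
apply: lt_trans ke; rewrite E.
apply: le_lt_trans (ler_distD (ratr (sval (qP i))) _ _) _.
by apply: ltrD; rewrite // distrC.
Qed.


(* Lebesgue measure on R^n: the n-fold product of the one-dimensional one,
   transported from tuples to row vectors. *)
Definition lebesgue_rV n : set 'rV[R]_n -> \bar R :=
  pushforward (lebesgue_tuple n) (@row_of_tuple n).

HB.instance Definition _ n := Measure.copy (@lebesgue_rV n)
  (measure_function_pushforward__canonical__measure_function_Measure
    (lebesgue_tuple n) (@measurable_row_of_tuple n)).

Lemma lebesgue_rV_box n (a b : 'rV[R]_n) : (forall i, a 0 i <= b 0 i) ->
  lebesgue_rV [set x | forall i, a 0 i <= x 0 i <= b 0 i] =
  (\prod_i (b 0 i - a 0 i))%:E.
Proof.
rewrite /lebesgue_rV /pushforward.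
rewrite (_ : _ @^-1` _ = [set t | forall i, a 0 i <= tnth t i <= b 0 i]); last first.
  by apply/seteqP; split => t /= h i; have := h i; rewrite mxE.
elim: n a b => [|n IH] a b ab.
  rewrite big_ord0 /= diracE (_ : _ \in _ = true)//.
  by apply/mem_set => -[].
rewrite /= /lebesgue_tupleS /pushforward.
pose a' : 'rV[R]_n := \row_i a 0 (lift ord0 i).
pose b' : 'rV[R]_n := \row_i b 0 (lift ord0 i).
rewrite (_ : _ @^-1` _ = `[a 0 ord0, b 0 ord0]%classic `*`
  [set t | forall i, a' 0 i <= tnth t i <= b' 0 i]); last first.
  apply/seteqP; split => -[x t] /=.
    move=> h; split; first by have := h ord0; rewrite in_itv.
    by move=> i; have := h (lift ord0 i); rewrite !mxE tnthS.
  rewrite in_itv/= => -[hx h] i; case: (unliftP ord0 i) => [j ->|->//].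
  by have := h j; rewrite !mxE tnthS.
rewrite product_measure1E//; last first.
  rewrite (_ : mkset _ = \bigcap_(i in [set: 'I_n])
     ((fun t => tnth t i) @^-1` `[a' 0 i, b' 0 i])).
    apply: fin_bigcap_measurable => // i _.
    by rewrite -[X in measurable X]setTI; exact: measurable_tnth.
  apply/seteqP; split => t /= h i; first by rewrite /= in_itv/=.
  by have := h i I; rewrite /= in_itv.
rewrite IH => [|i]; last by rewrite !mxE.
rewrite big_ord_recl EFinM; congr (_ * _)%E; last by congr EFin; apply: eq_bigr => i _; rewrite !mxE.
apply: etrans (lebesgue_measure_itv `[a 0 ord0, b 0 ord0]) _.
rewrite /= lte_fin; case: ltP => // h; apply/esym/eqP; rewrite eqe subr_eq0 eq_le ab andbT//.
Qed.
End lebesgue.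

Section euclidean.
Context {R : realType} {d : nat}.
Local Notation E := 'rV[R]_d.
Local Notation mu := (@lebesgue_rV R d).

(* The norm `|x| of the library on 'rV[R]_d is the sup norm. *)
Definition enorm (x : E) : R := Num.sqrt (\sum_i x 0 i ^+ 2).

Definition eball (r : R) : set E := [set x | enorm x < r].

Definition ediam (A : set E) : R := sup [set enorm (x - y) | x in A & y in A].

Definition at_infinity : set_system E :=
  [set P | exists M : R, forall y, M < enorm y -> P y].

Global Instance at_infinity_filter : Filter at_infinity.
Proof.
split; first by exists 0.
- move=> P Q [M MP] [N NQ]; exists (Num.max M N) => y.
  by rewrite gt_max => /andP[/MP Py /NQ Qy].
- by move=> P Q PQ [M MP]; exists M => y /MP/PQ.
Qed.

Definition star_shaped_wrt (G : set E) (z : E) : Prop :=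
  forall x (t : R), G x -> 0 <= t <= 1 -> G (z + t *: (x - z)).

Definition admissible_domain (G : set E) : Prop :=
  [/\ open G, connected G, bounded_set G,
      exists2 rho : R, 0 < rho &
        eball rho `<=` G /\ (forall z, eball rho z -> star_shaped_wrt G z)
    & ediam G = 2].

Definition dilate (G : set E) (r : R) (y : E) : set E :=
  (fun x => x + y) @` [set x | G (r^-1 *: x)].

Definition small_subsets (G : set E) (gamma : R) (y : E) (r : R) :
    set (set E) :=
  [set F | [/\ measurable F, F `<=` dilate G r y &
    (mu F <= gamma%:E * mu (dilate G r y))%E]].

Definition loc_integrable (V : E -> R) : Prop :=
  measurable_fun setT V /\
  forall K : set E, compact K -> mu.-integrable K (EFin \o V).

End euclidean.

(* Elements of L_2(R^d) are represented by complex-valued functions; the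
   notions below that concern L_2(R^d) are compatible with equality a.e. *)
Section L2.
Context {R : realType} {d : nat}.
Local Notation E := 'rV[R]_d.
Local Notation mu := (@lebesgue_rV R d).
Implicit Types u v f g : E -> R[i].

Definition cintegral f : R[i] :=
  (\int[mu]_x complex.Re (f x)) +i* (\int[mu]_x complex.Im (f x)).

Definition L2 u : Prop :=
  ((fun x => complex.Re (u x)) : E -> R) \in Lfun mu 2%:E /\
  ((fun x => complex.Im (u x)) : E -> R) \in Lfun mu 2%:E.

Definition L2norm u : \bar R := Lnorm mu 2%:E (fun x => (normc (u x))%:E).

Definition inner u v : R[i] := cintegral (fun x => u x * (v x)^*).

Definition eq_ae u v : Prop := {ae mu, forall x, u x = v x}.

Definition evec (i : 'I_d) : E := delta_mx 0 i.

Fixpoint Ck (k : nat) (phi : E -> R) : Prop :=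
  continuous phi /\
  match k with
  | 0 => True
  | k'.+1 => forall i, (forall x, derivable phi x (evec i)) /\
                       Ck k' (fun x => 'D_(evec i) phi x)
  end.

Definition test_function (phi : E -> R) : Prop :=
  (forall k, Ck k phi) /\ compact (closure [set x | phi x != 0]).

(* Real test functions suffice: the identity is linear in phi. *)
Definition weak_partial (i : 'I_d) u g : Prop :=
  forall phi, test_function phi ->
    cintegral (fun x => ('D_(evec i) phi x)%:C * u x) =
    - cintegral (fun x => (phi x)%:C * g x).

Definition weak_gradient u (Du : 'I_d -> E -> R[i]) : Prop :=
  forall i, L2 (Du i) /\ weak_partial i u (Du i).

Definition H1 u : Prop := L2 u /\ exists Du, weak_gradient u Du.

(* The weak gradient of u in H1, unique up to equality a.e. *)
Definition grad u : 'I_d -> E -> R[i] := xget (fun _ _ => 0) (weak_gradient u).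

End L2.

(* Unbounded operators in L_2(R^d), given by their graph: A u f means that u is
   in the domain of A and A u = f; graphs are contained in L2 x L2 and closed
   under equality a.e. *)
Section spectrum.
Context {R : realType} {d : nat}.
Local Notation E := 'rV[R]_d.
Local Notation operator := ((E -> R[i]) -> (E -> R[i]) -> Prop).
Implicit Types (A : operator) (z : R[i]).

(* (A - z) u = f *)
Definition shifted A z : operator := fun u f => A u (fun x => f x + z * u x).

(* A - z is a bijection from the domain of A onto L2 with bounded inverse *)
Definition resolvent_set A : set R[i] := [set z |
  [/\ forall f, L2 f -> exists u, shifted A z u f,
      forall u, shifted A z u (fun=> 0) -> eq_ae u (fun=> 0)
    & exists M : R, forall u f, shifted A z u f ->
        (L2norm u <= M%:E * L2norm f)%E]].

Definition spectrum A : set R[i] := ~` resolvent_set A.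

Definition isolated_in (S : set R[i]) z : Prop :=
  exists2 e : R, 0 < e & forall w, S w -> normc (w - z) < e -> w = z.

Definition eigenspace A z : set (E -> R[i]) :=
  [set u | A u (fun x => z * u x)].

Definition is_eigenvalue A z : Prop :=
  exists2 u, eigenspace A z u & ~ eq_ae u (fun=> 0).

Definition finite_multiplicity A z : Prop :=
  exists n (w : 'I_n -> E -> R[i]), (forall i, eigenspace A z (w i)) /\
    forall u, eigenspace A z u -> exists c : 'I_n -> R[i],
      eq_ae u (fun x => \sum_(i < n) c i * w i x).

Definition discrete_spectrum A : Prop := forall z, spectrum A z ->
  [/\ isolated_in (spectrum A) z, is_eigenvalue A z & finite_multiplicity A z].

End spectrum.

Section schrodinger.
Context {R : realType} {d : nat}.
Local Notation E := 'rV[R]_d.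
Local Notation mu := (@lebesgue_rV R d).
Variable V : E -> R.
Implicit Types u v f : E -> R[i].

Definition form_domain u : Prop :=
  H1 u /\ mu.-integrable setT (fun x => (V x * normc (u x) ^+ 2)%:E).

(* The sesquilinear form whose diagonal is the quadratic form
   \int (|grad u|^2 + V |u|^2). *)
Definition schrodinger_form u v : R[i] :=
  \sum_(i < d) inner (grad u i) (grad v i) +
  cintegral (fun x => (V x)%:C * u x * (v x)^*).

(* The operator associated with the form by the representation theorem. *)
Definition schrodinger u f : Prop :=
  [/\ form_domain u, L2 f &
    forall v, form_domain v -> schrodinger_form u v = inner f v].

End schrodinger.

(* Main.v *)
(** Only the unboundedness of [gamma r / r ^ 2] along some [r -> 0] matters,
    and it follows from the limsup since [0 < 2 (d - 2) / d <= 2].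

    Fix such an [r] and cut space into cubes [Q] of side comparable to [r],
    each containing a translate of [G_r].  Let [N] be the integral of [p ^ 2]
    over [Q] and [F] the part of [G_r] where [p ^ 2 < N / (4 |Q|)].  If [F] is
    large, the oscillation of [p] on [Q] controls [N], with a constant of order
    [r ^ 2 / gamma r] after summing over the cubes by means of
    [||p (x + h) - p|| <= |h| ||grad p||].  If [F] is small, it belongs to the
    family in the hypothesis, so that [N] is at most a small multiple of the
    integral of [V p ^ 2], provided that [Q] is far away.  On each of the finitely
    many remaining cubes the Poincare inequality holds up to the mean value of
    [p].  Hence for every [e > 0] there are finitely many bounded linear
    functionals [L_j] with [||u|| ^ 2 <= e h(u, u) + \sum_j L_j(u) ^ 2], [h] being
    the energy form plus the [L_2] product.

    This replaces compactness of the embedding.  Adding a multiple of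
    [\sum_j L_j ^ 2] to [h] makes [H - z] solvable by a contraction argument, the
    correction has finite rank, and so a non-eigenvalue is in the resolvent set.
    Eigenvectors are [L_2]-orthogonal, and [n + 1] orthogonal vectors have a
    nonzero combination killed by [n] functionals: there are finitely many
    eigenvalues below any bound, each of finite multiplicity. *)

Require Import Defs.
From HB Require Import structures.
From mathcomp Require Import all_boot all_order all_algebra complex ring lra zify.
From mathcomp Require Import all_classical all_reals all_analysis measurable_realfun.
Set Implicit Arguments.
Unset Strict Implicit.
Unset Printing Implicit Defensive.
Import Order.TTheory GRing.Theory Num.Theory.
Import numFieldNormedType.Exports.
Local Open Scope classical_set_scope.
Local Open Scope ring_scope.

(** * Forms on real vector spaces and the Fredholm alternative *)

(** All abstract arguments are over the reals: an element of the form domain is stored by real and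
    imaginary components, and a complex number acts as the bounded real-linear map [Z] of
    [lax_milgram] and [fredholm]. A real equation that holds for all test vectors, hence for [v] and
    [i v], is the complex one. Functions are not identified a.e., so the forms are only
    semidefinite, and limits and solutions are unique up to null vectors of a seminorm.

    The translation estimate compares a function with its gradient on the whole space and not cell
    by cell, since it is obtained by duality against test functions. Oscillation is therefore
    measured by increments over a fixed box of shifts: this dominates the oscillation inside every
    cell and can be integrated over all cells at once by Tonelli's theorem.

    Keeping [sqrt V * p] as a component of its own makes the form a sum of squared [L_2] norms.
    Completeness then reduces to that of [L_2], with convergence a.e. in addition, which carries the
    pointwise relation to [p] over to the limit. *)

Lemma discriminant_le (R : realFieldType) (a b c : R) : 0 <= c ->
  (forall t, 0 <= a + 2 * t * b + t ^+ 2 * c) -> b ^+ 2 <= a * c.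
Proof.
rewrite le_eqVlt => /predU1P[<- H|c0 H]; last first.
  have := H (- b / c); rewrite exprMn exprVn.
  rewrite (_ : _ + _ = (a * c - b ^+ 2) / c); last by field; rewrite gt_eqF.
  by rewrite pmulr_lge0 ?invr_gt0// subr_ge0.
rewrite mulr0; have [->|b0] := eqVneq b 0; first by rewrite expr0n.
(* With [c = 0] the expression is affine in [t], and this [t] sends it to [-1]. *)
have := H (- (a + 1) / (2 * b)).
rewrite (_ : _ + _ = -1); last by field.
by rewrite ler0N1.
Qed.

(** Only semidefinite: functions equal a.e. stay distinct vectors, so the [L_2] product may have
    nonzero null vectors. *)
Record psdForm (R : realType) (X : lmodType R) := PsdForm {
  form :> X -> X -> R;
  form_scalar : forall u, scalar (form u);
  formC : forall u v, form u v = form v u;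
  form_ge0 : forall u, 0 <= form u u }.

HB.instance Definition _ (R : realType) (X : lmodType R) (h : psdForm X) u :=
  GRing.isLinear.Build R X R *%R (form h u) (form_scalar h u).

Section psd_form.
Context {R : realType} {X : lmodType R}.
Implicit Types (h m g : psdForm X) (u v w : X).

Lemma formDl h u v w : h (u + v) w = h u w + h v w.
Proof. by rewrite formC linearD/= !(formC h w). Qed.

Lemma formBl h u v w : h (u - v) w = h u w - h v w.
Proof. by rewrite formC linearB/= !(formC h w). Qed.

Lemma formZl h a u w : h (a *: u) w = a * h u w.
Proof. by rewrite formC linearZ/= !(formC h w). Qed.

Lemma formDr h u v w : h w (u + v) = h w u + h w v.
Proof. exact: linearD. Qed.

Lemma formBr h u v w : h w (u - v) = h w u - h w v.
Proof. exact: linearB. Qed.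

Lemma formZr h a u w : h w (a *: u) = a * h w u.
Proof. exact: linearZ. Qed.

Definition formE := (formBl, formDl, formZl, formBr, formDr, formZr).

Lemma form_CS h u v : h u v ^+ 2 <= h u u * h v v.
Proof.
apply: discriminant_le => [|t]; first exact: form_ge0.
suff -> : h u u + 2 * t * h u v + t ^+ 2 * h v v = h (u + t *: v) (u + t *: v).
  exact: form_ge0.
rewrite !formE (formC h v u); ring.
Qed.

Definition seminorm h u := Num.sqrt (h u u).

Lemma seminorm_ge0 h u : 0 <= seminorm h u. Proof. exact: sqrtr_ge0. Qed.

Lemma sqr_seminorm h u : seminorm h u ^+ 2 = h u u.
Proof. by rewrite sqr_sqrtr// form_ge0. Qed.

Lemma form_le_seminorm h u v : h u v <= seminorm h u * seminorm h v.
Proof.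
apply: le_trans (ler_norm _) _.
rewrite -sqrtrM ?form_ge0// -sqrtr_sqr ler_wsqrtr//.
exact: form_CS.
Qed.

Lemma seminormD h u v : seminorm h (u + v) <= seminorm h u + seminorm h v.
Proof.
rewrite -(@ler_pXn2r _ 2) ?nnegrE ?addr_ge0 ?seminorm_ge0//.
rewrite sqrrD !sqr_seminorm !formE (formC h v u).
have := form_le_seminorm h u v; lra.
Qed.

Lemma seminormZ h a u : seminorm h (a *: u) = `|a| * seminorm h u.
Proof.
rewrite /seminorm !formE mulrA -expr2 sqrtrM ?sqr_ge0//.
by rewrite sqrtr_sqr.
Qed.

Lemma seminorm_sum h (I : Type) (r : seq I) (F : I -> X) :
  seminorm h (\sum_(i <- r) F i) <= \sum_(i <- r) seminorm h (F i).
Proof.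
elim/big_ind2: _ => //; first by rewrite /seminorm linear0 sqrtr0.
by move=> a b c d ab cd; apply: le_trans (seminormD _ _ _) _; exact: lerD.
Qed.

(* Only rapidly Cauchy sequences have to converge; [h] may be degenerate, so the
   limit need not be unique. *)
Definition complete_form h := forall (u : nat -> X) (C : R),
  (forall n, h (u n.+1 - u n) (u n.+1 - u n) <= C * 4^-1 ^+ n) ->
  exists v, h (u n - v) (u n - v) @[n --> \oo] --> (0 : R).

Lemma form_cvg0 h (u : nat -> X) v w :
  h (u n - v) (u n - v) @[n --> \oo] --> (0 : R) ->
  h (u n) w @[n --> \oo] --> h v w.
Proof.
move=> uv; apply/cvgrPdist_le => e e0.
have k0 : 0 < e ^+ 2 / (h w w + 1).
  by rewrite divr_gt0 ?exprn_gt0// ltr_wpDl ?form_ge0.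
move/cvgrPdist_le : uv => /(_ _ k0); apply: filterS => n.
rewrite distrC subr0 ger0_norm ?form_ge0// => H.
rewrite distrC -formBl -(@ler_pXn2r _ 2) ?nnegrE ?normr_ge0 ?(ltW e0)// -normrX ger0_norm ?sqr_ge0//.
apply: le_trans (form_CS _ _ _) _.
apply: le_trans (ler_wpM2r (form_ge0 _ _) H) _.
rewrite mulrAC ler_pdivrMr ?ltr_wpDl ?form_ge0//.
by rewrite ler_pM2l ?exprn_gt0// lerDl.
Qed.

(** The functional [J v = h v v - 2 * l v] is bounded below, and a minimising sequence in [S] is
    rapidly Cauchy by the parallelogram law. The limit need not lie in [S], so the sequence is
    returned along with it. *)
Lemma form_riesz_subspace h (S : X -> Prop) (l : {scalar X}) C :
  complete_form h -> S 0 -> (forall a u v, S u -> S v -> S (a *: u + v)) ->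
  0 <= C -> (forall v, l v ^+ 2 <= C * h v v) ->
  exists u (w : nat -> X), [/\ forall n, S (w n),
    h (w n - u) (w n - u) @[n --> \oo] --> (0 : R) & forall v, S v -> h u v = l v].
Proof.
move=> hc S0 SD C0 lC; pose J v := h v v - 2 * l v.
have Jb v : - C <= J v.
  rewrite /J; have := lC v; have := form_ge0 h v; set a := h v v; set b := l v.
  move=> a0 b2; suff : 2 * b <= a + C by lra.
  have [b0|b0] := leP b 0; first by lra.
  rewrite -(@ler_pXn2r _ 2) ?nnegrE ?addr_ge0 ?mulr_ge0 ?(ltW b0)//.
  have := sqr_ge0 (a - C); nra.
have Jinf : has_inf (J @` S).
  split; first by exists (J 0), 0.
  by exists (- C) => _ [v _ <-].
have /choice[u /all_and2[Su uP]] : forall n, exists u,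
    S u /\ J u < inf (J @` S) + 4^-1 ^+ n.
  move=> n; have e0 : 0 < (4^-1 : R) ^+ n by rewrite exprn_gt0.
  by have [_ [w Sw <-] H] := inf_adherent e0 Jinf; exists w.
have Jge v : S v -> inf (J @` S) <= J v.
  by move=> Sv; apply: ge_inf; [case: Jinf|exists v].
(* [J] at the midpoint is at least the infimum, so [h] of the difference is at most
   [2 * (4^-1 ^+ n + 4^-1 ^+ n.+1)], which is below [4 * 4^-1 ^+ n]. *)
have [n|w uw] := hc u 4.
  have Sh : S (2^-1 *: (u n + u n.+1)).
    rewrite -[_ *: _]addr0; apply: (SD) => //; rewrite -[u n]scale1r; exact: SD.
  have := uP n; have := uP n.+1; have := Jge _ Sh.
  rewrite /J !formE !scalarZ !(linearD l)/= (formC h (u n.+1)).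
  have : 4^-1 ^+ n.+1 <= 4^-1 ^+ n :> R.
    by rewrite exprS ler_piMl ?exprn_ge0// invf_le1// ler1n.
  lra.
exists w, u; split => // v Sv.
have : (h (u n) v - l v) ^+ 2 @[n --> \oo] --> (h w v - l v) ^+ 2.
  rewrite expr2; under eq_fun do rewrite expr2.
  by apply: cvgM; (apply: cvgB; [exact: form_cvg0|exact: cvg_cst]).
(* [J (u n + t *: v)] cannot drop more than [4^-1 ^+ n] below [J (u n)]; the discriminant of the
   resulting nonnegative quadratic in [t] bounds the defect [h (u n) v - l v]. *)
have : (h (u n) v - l v) ^+ 2 @[n --> \oo] --> (0 : R).
  have b0 : (4^-1 : R) ^+ n * h v v @[n --> \oo] --> (0 : R).
    rewrite -[X in _ --> X](mul0r (h v v)); apply: cvgMl.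
    by apply: cvg_expr; rewrite ger0_norm// invf_lt1 ?ltr1n.
  apply: squeeze_cvgr (@cvg_cst _ 0 _ _ _) b0; apply: nearW => n.
  rewrite sqr_ge0/=; apply: discriminant_le => [|t]; first exact: form_ge0.
  have Sv' : S (u n + t *: v) by rewrite addrC; exact: SD.
  have := Jge _ Sv'; have := uP n.
  rewrite /J !formE (linearD l) scalarZ/= (formC h v).
  lra.
move=> /(@cvg_unique _ (@norm_hausdorff _ _)) H /H /eqP.
by rewrite eq_sym expf_eq0/= subr_eq0 => /eqP.
Qed.

Lemma form_riesz h (l : {scalar X}) C : complete_form h -> 0 <= C ->
  (forall v, l v ^+ 2 <= C * h v v) -> exists u, forall v, h u v = l v.
Proof.
move=> hc C0 lC.
have [u [_ [_ _ uP]]] := @form_riesz_subspace h (fun=> True) l C hc I (fun _ _ _ _ _ => I) C0 lC.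
by exists u => v; exact: uP.
Qed.

(** A norm computed by duality against [S]. Density is expressed as triviality of the orthogonal
    complement, the form in which the fundamental lemma supplies it for test functions. Riesz
    representation on [S] makes [w], up to a null vector, a limit of elements of [S]. *)
Lemma form_dense_bound h (S : X -> Prop) w C : complete_form h ->
  S 0 -> (forall a u v, S u -> S v -> S (a *: u + v)) ->
  (forall u, (forall v, S v -> h u v = 0) -> seminorm h u = 0) ->
  (forall v, S v -> h w v <= C * seminorm h v) -> 0 <= C -> seminorm h w <= C.
Proof.
move=> hc S0 SD dense wC C0.
have [u [u_ [Su uu uP]]] :=
  @form_riesz_subspace h S (form h w) (h w w) hc S0 SD (form_ge0 h w) (form_CS h w).
have wu0 : seminorm h (w - u) = 0.
  by apply: dense => v Sv; rewrite formBl -[h w v]uP// subrr.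
have wu v : h w v = h u v.
  apply/eqP; rewrite -subr_eq0 -formBl -sqrf_eq0.
  rewrite eq_le sqr_ge0 andbT; apply: le_trans (form_CS _ _ _) _.
  by rewrite -sqr_seminorm wu0 expr0n mul0r.
have uC : h u u <= C * seminorm h u.
  apply/ler_addgt0Pr => e e0.
  have D0 : 0 < (seminorm h u + C + 1) by rewrite ltr_wpDl// addr_ge0// seminorm_ge0.
  (* Replacing [u] by [u_ N] costs [seminorm h u * e'] in one term and [C * e'] in the other,
     together at most [e]. *)
  pose e' := e / (seminorm h u + C + 1).
  have e'0 : 0 < e' by rewrite divr_gt0.
  have e'2 : 0 < e' ^+ 2 by rewrite exprn_gt0.
  move/cvgrPdist_lt : uu => /(_ _ e'2)[N _ /(_ N (leqnn N))].
  rewrite /= sub0r normrN ger0_norm ?form_ge0// -sqr_seminorm.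
  rewrite ltr_pXn2r ?nnegrE ?seminorm_ge0 ?(ltW e'0)// => uN.
  set v := u_ N in uN.
  have -> : h u u = h w v + h u (u - v) by rewrite wu formBr addrC subrK.
  have h1 : h u (u - v) <= seminorm h u * e'.
    apply: le_trans (form_le_seminorm _ _ _) _; rewrite ler_wpM2l ?seminorm_ge0//.
    by rewrite -opprB -scaleN1r seminormZ normrN1 mul1r ltW.
  have h2 : h w v <= C * (seminorm h u + e').
    apply: le_trans (wC _ (Su N)) _; rewrite ler_wpM2l//.
    rewrite -[u_ N](subrK u) addrC; apply: le_trans (seminormD _ _ _) _.
    by rewrite lerD2l ltW.
  have : e' * (seminorm h u + C + 1) = e by rewrite mulfVK// gt_eqF.
  move: h1 h2; nra.
have uC' : seminorm h u <= C.
  have [->//|u0] := eqVneq (seminorm h u) 0.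
  have up : 0 < seminorm h u by rewrite lt_neqAle eq_sym u0 seminorm_ge0.
  by move: uC; rewrite -sqr_seminorm expr2 ler_pM2r.
rewrite -[w](subrK u); apply: le_trans (seminormD _ _ _) _.
by rewrite wu0 add0r.
Qed.

End psd_form.

Section solve.
Context {R : realType} {X : lmodType R}.
Implicit Types (h m g : psdForm X) (u v w : X) (l : {scalar X}).

(* The iteration [g u_(n+1) = m (Z u_n) + l] contracts by the factor [1 / 2]. *)
Lemma lax_milgram g m (Z : {linear X -> X}) (k e c : R) l :
  complete_form g -> 0 <= k -> 0 <= e -> k * e <= 2^-1 ->
  (forall u, m u u <= e * g u u) ->
  (forall u, seminorm m (Z u) <= k * seminorm m u) ->
  0 <= c -> (forall v, `|l v| <= c * seminorm m v) ->
  exists u, (forall v, g u v = m (Z u) v + l v) /\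
            seminorm m u <= 2 * e * c.
Proof.
move=> gc k0 e0 ke mg Zk c0 lc.
have mg' u : seminorm m u <= Num.sqrt e * seminorm g u.
  by rewrite /seminorm -sqrtrM// ler_wsqrtr.
have step (l' : {scalar X}) c' : 0 <= c' -> (forall v, `|l' v| <= c' * seminorm m v) ->
    exists u, forall v, g u v = l' v.
  move=> c'0 H; apply: (@form_riesz _ _ g l' (c' ^+ 2 * e)) => //.
    by rewrite mulr_ge0 ?sqr_ge0.
  move=> v; rewrite -mulrA; apply: (@le_trans _ _ (c' ^+ 2 * m v v)).
    rewrite -sqr_seminorm -exprMn -real_normK ?num_real//.
    by rewrite ler_pXn2r ?nnegrE ?mulr_ge0 ?seminorm_ge0.
  by rewrite ler_wpM2l ?sqr_ge0.
have /choice[T TP] : forall w, exists u, forall v, g u v = m (Z w) v + l v.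
  move=> w.
  have sc : scalar (fun v => m (Z w) v + l v).
    move=> a x y; rewrite !formE (linearD l) scalarZ; ring.
  pose l' : {scalar X} := HB.pack (fun v => m (Z w) v + l v)
    (GRing.isLinear.Build R X R *%R _ sc).
  apply: (step l' (seminorm m (Z w) + c)); first by rewrite addr_ge0 ?seminorm_ge0.
  move=> v; rewrite /l'/= mulrDl; apply: le_trans (ler_normD _ _) _; apply: lerD => //.
  rewrite -(@ler_pXn2r _ 2) ?nnegrE ?mulr_ge0 ?seminorm_ge0//.
  by rewrite exprMn !sqr_seminorm real_normK ?num_real// form_CS.
pose u n := iter n T 0.
have uS n v : g (u n.+1) v = m (Z (u n)) v + l v by rewrite TP.
have dS n : seminorm g (u n.+2 - u n.+1) <= 2^-1 * seminorm g (u n.+1 - u n).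
  set d := u n.+2 - u n.+1; set d' := u n.+1 - u n.
  have E : g d d = m (Z d') d.
    transitivity (g (u n.+2) d - g (u n.+1) d); first exact: formBl.
    rewrite !uS /d' (linearB Z) formBl; ring.
  have [d0|d0] := eqVneq (seminorm g d) 0.
    by rewrite d0 mulr_ge0 ?seminorm_ge0.
  have dp : 0 < seminorm g d by rewrite lt_neqAle eq_sym d0 seminorm_ge0.
  rewrite -(ler_pM2r dp) -expr2 sqr_seminorm E.
  apply: le_trans (form_le_seminorm _ _ _) _.
  (* Each passage from [m] to [g] costs [sqrt e], so the contraction factor is [k * e]. *)
  apply: (@le_trans _ _ (k * (Num.sqrt e * seminorm g d') * (Num.sqrt e * seminorm g d))).
    apply: ler_pM; rewrite ?seminorm_ge0//.
    by apply: le_trans (Zk _) _; rewrite ler_wpM2l.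
  rewrite (_ : _ * _ = k * Num.sqrt e ^+ 2 * (seminorm g d' * seminorm g d)); last by ring.
  by rewrite sqr_sqrtr// -[leRHS]mulrA ler_wpM2r// mulr_ge0 ?seminorm_ge0.
have dn n : seminorm g (u n.+1 - u n) <= seminorm g (u 1%N - u 0%N) * 2^-1 ^+ n.
  elim: n => [|n IH]; first by rewrite expr0 mulr1.
  apply: le_trans (dS _) _; rewrite exprS mulrCA ler_wpM2l//.
have [n|w uw] := gc u (seminorm g (u 1%N - u 0%N) ^+ 2).
  rewrite (_ : (4^-1 : R) = 2^-1 ^+ 2); last by field.
  rewrite -exprM mulnC exprM -exprMn -sqr_seminorm.
  by rewrite ler_pXn2r ?nnegrE ?mulr_ge0 ?seminorm_ge0 ?exprn_ge0.
have wP v : g w v = m (Z w) v + l v.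
  have H1 : g (u n.+1) v @[n --> \oo] --> g w v.
    have := form_cvg0 (w := v) uw.
    by rewrite -(@cvg_shiftS _ (fun n => g (u n) v)).
  have H2 : g (u n.+1) v @[n --> \oo] --> m (Z w) v + l v.
    under eq_fun do rewrite uS.
    apply: cvgD; last exact: cvg_cst.
    apply: form_cvg0.
    have b0 : k ^+ 2 * e * g (u n - w) (u n - w) @[n --> \oo] --> (0 : R).
      by rewrite -[X in _ --> X](mulr0 (k ^+ 2 * e)); apply: cvgMr.
    apply: squeeze_cvgr (@cvg_cst _ 0 _ _ _) b0; apply: nearW => n.
    rewrite form_ge0/= -(linearB Z) -sqr_seminorm -mulrA.
    apply: (@le_trans _ _ (k ^+ 2 * m (u n - w) (u n - w))).
      rewrite -sqr_seminorm -exprMn ler_pXn2r ?nnegrE ?mulr_ge0 ?seminorm_ge0//.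
    by rewrite ler_wpM2l ?sqr_ge0.
  by move/(@cvg_unique _ (@norm_hausdorff _ _)) : H1 => /(_ _ H2).
exists w; split => //.
have [d0|d0] := eqVneq (seminorm m w) 0.
  by rewrite d0 !mulr_ge0.
have dp : 0 < seminorm m w by rewrite lt_neqAle eq_sym d0 seminorm_ge0.
(* The equation is tested with [w] itself; the term with [k] is absorbed because [k * e <= 2^-1],
   whence the factor [2 * e] in the bound. *)
have : g w w <= k * seminorm m w ^+ 2 + c * seminorm m w.
  rewrite wP; apply: lerD; last by apply: le_trans (ler_norm _) (lc _).
  apply: le_trans (form_le_seminorm _ _ _) _.
  by rewrite expr2 mulrA ler_wpM2r ?seminorm_ge0.
have := mg w; rewrite -[m w w]sqr_seminorm => h1 h2.
have h3 : seminorm m w ^+ 2 <= e * (k * seminorm m w ^+ 2 + c * seminorm m w).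
  by apply: le_trans h1 _; rewrite ler_wpM2l.
have : seminorm m w ^+ 2 <= 2 * e * c * seminorm m w.
  have : k * e * seminorm m w ^+ 2 <= 2^-1 * seminorm m w ^+ 2.
    by rewrite ler_wpM2r ?sqr_ge0.
  move: h3; lra.
by rewrite expr2 ler_pM2r.
Qed.

Definition form_bounded m l := exists C, forall v, `|l v| <= C * seminorm m v.

(** Boundedness in the weaker seminorm [m] makes the functionals vanish on [m]-null vectors and
    gives the Fredholm solution an estimate in [m]. *)
Definition finite_compactness h m := forall e : R, 0 < e ->
  exists n (L : 'I_n -> {scalar X}), (forall j, form_bounded m (L j)) /\
    forall u, m u u <= e * h u u + \sum_j L j u ^+ 2.

End solve.

(** * The Fredholm alternative, eigenspaces and eigenvalues *)

Section fredholm.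
Context {R : realType} {X : lmodType R}.
Implicit Types (h m g : psdForm X) (u v w : X) (l : {scalar X}).

Lemma form_bounded_sqr m l C : (forall v, `|l v| <= C * seminorm m v) ->
  forall v, l v ^+ 2 <= C ^+ 2 * m v v.
Proof.
move=> H v; rewrite -sqr_seminorm -exprMn -real_normK ?num_real//.
by rewrite ler_pXn2r ?nnegrE ?(le_trans _ (H v)).
Qed.

Fact psd_penalty_scalar h n (L : 'I_n -> {scalar X}) (K : R) u :
  scalar (fun v => h u v + K ^+ 2 * \sum_j L j u * L j v).
Proof.
move=> a x y; rewrite !formE.
have -> : \sum_j L j u * L j (a *: x + y) =
    a * (\sum_j L j u * L j x) + \sum_j L j u * L j y.
  rewrite mulr_sumr -big_split; apply: eq_bigr => j _ /=.
  rewrite (linearD (L j)) scalarZ; ring.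
ring.
Qed.

Fact psd_penaltyC h n (L : 'I_n -> {scalar X}) (K : R) u v :
  h u v + K ^+ 2 * (\sum_j L j u * L j v) = h v u + K ^+ 2 * (\sum_j L j v * L j u).
Proof. by rewrite formC; under eq_bigr do rewrite mulrC. Qed.

Fact psd_penalty_ge0 h n (L : 'I_n -> {scalar X}) (K : R) u :
  0 <= h u u + K ^+ 2 * \sum_j L j u * L j u.
Proof.
rewrite addr_ge0 ?form_ge0// mulr_ge0 ?sqr_ge0//.
by apply: sumr_ge0 => j _; rewrite -expr2 sqr_ge0.
Qed.

(** The coefficient is a square, so that positivity carries no side condition. *)
Definition psd_penalty h n (L : 'I_n -> {scalar X}) (K : R) : psdForm X :=
  PsdForm (psd_penalty_scalar h L K) (psd_penaltyC h L K) (psd_penalty_ge0 h L K).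

Lemma psd_penalty_complete h m n (L : 'I_n -> {scalar X}) (K : R) :
  (forall u, m u u <= h u u) -> (forall j, form_bounded m (L j)) ->
  complete_form h -> complete_form (psd_penalty h L K).
Proof.
move=> mh /choice[C LC] hc u B uB.
have [|v uv] := hc u B.
  move=> n'; apply: le_trans (uB n') => /=.
  rewrite lerDl mulr_ge0 ?sqr_ge0//.
  by apply: sumr_ge0 => j _; rewrite -expr2 sqr_ge0.
exists v; pose A := 1 + K ^+ 2 * \sum_j C j ^+ 2.
have b0 : A * h (u n - v) (u n - v) @[n --> \oo] --> (0 : R).
  by rewrite -[X in _ --> X](mulr0 A); apply: cvgMr.
apply: squeeze_cvgr (@cvg_cst _ 0 _ _ _) b0; apply: nearW => k.
rewrite form_ge0/= /A mulrDl mul1r lerD2l -mulrA ler_wpM2l ?sqr_ge0//.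
rewrite mulr_suml; apply: ler_sum => j _.
apply: le_trans (form_bounded_sqr (LC j) _) _.
by rewrite ler_wpM2l ?sqr_ge0.
Qed.

(* Penalising the functionals [L j] makes [h] dominate [m] strongly enough for
   [lax_milgram]; the penalty is undone by solving an [n x n] linear system. *)
Lemma fredholm h m (Z : {linear X -> X}) (k : R) :
  complete_form h -> (forall u, m u u <= h u u) -> finite_compactness h m ->
  0 <= k -> (forall u, seminorm m (Z u) <= k * seminorm m u) ->
  (forall u, (forall v, h u v = m (Z u) v) -> seminorm m u = 0) ->
  exists2 M : R, 0 <= M & forall l c, 0 <= c ->
    (forall v, `|l v| <= c * seminorm m v) ->
    exists u, (forall v, h u v = m (Z u) v + l v) /\ seminorm m u <= M * c.
Proof.
move=> hc mh cpt k0 Zk uniq.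
have kp : 0 < k + 1 by rewrite ltr_wpDl.
(* Gives the contraction condition [k * e <= 2^-1], also when [k = 0]. *)
pose e := (2 * (k + 1))^-1.
have e0 : 0 < e by rewrite invr_gt0 mulr_gt0.
have [n [L [LC me]]] := cpt _ e0.
have Lb := LC; move/choice : LC => [C LC].
have L0 u j : seminorm m u = 0 -> L j u = 0.
  by move=> u0; have := LC j u; rewrite u0 mulr0 normr_le0 => /eqP.
pose K := Num.sqrt (e^-1).
have K2 : K ^+ 2 = e^-1 by rewrite sqr_sqrtr// invr_ge0 ltW.
have [g gE gc] : exists2 g : psdForm X,
    (forall u v, g u v = h u v + e^-1 * \sum_j L j u * L j v) & complete_form g.
  exists (psd_penalty h L K); last exact: psd_penalty_complete Lb hc.
  by move=> u v; rewrite -K2.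
have mg u : m u u <= e * g u u.
  rewrite gE mulrDr mulrA divff ?gt_eqF// mul1r.
  by under [X in _ <= _ + X]eq_bigr do rewrite -expr2; exact: me.
have ke : k * e <= 2^-1.
  rewrite /e invfM mulrCA ler_piMr ?invr_ge0// ler_pdivrMr// mul1r; lra.
have LM := @lax_milgram R X g m Z k e _ _ gc k0 (ltW e0) ke mg Zk.
(* [B j] is the response of the penalised equation to the load [e^-1 * L j]; multiples of the [B j]
   will cancel the penalty. *)
have /choice[B /all_and2[BP Bb]] : forall j, exists u,
    (forall v, g u v = m (Z u) v + e^-1 * L j v) /\
    seminorm m u <= 2 * e * (e^-1 * `|C j|).
  move=> j.
  have sc : scalar (fun v => e^-1 * L j v).
    move=> a x y; rewrite linearD scalarZ/=; ring.
  pose l : {scalar X} := HB.pack (fun v => e^-1 * L j v)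
    (GRing.isLinear.Build R X R *%R _ sc).
  apply: (LM _ l).
    by apply: mulr_ge0 => //; rewrite invr_ge0 (ltW e0).
  have e1 : 0 <= e^-1 by rewrite invr_ge0 (ltW e0).
  move=> v; rewrite /l/= normrM (ger0_norm e1) -mulrA ler_wpM2l//.
  apply: le_trans (LC j v) _.
  by rewrite ler_wpM2r ?seminorm_ge0 ?ler_norm.
(* [u0 + \sum_j c j *: B j] solves the original equation once its values under the [L j] are the
   coefficients [c j]; this is the system [c *m N = b], with [b] the values of [u0]. *)
pose N : 'M[R]_n := 1%:M - \matrix_(j, i) L i (B j).
have comb (c : 'rV[R]_n) i :
    L i (\sum_j c 0 j *: B j) = c 0 i - (c *m N) 0 i.
  rewrite mulmxBr mulmx1 !mxE opprB addrC subrK linear_sum/=.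
  by apply: eq_bigr => j _; rewrite scalarZ mxE.
have gcomb (c : 'rV[R]_n) v :
    g (\sum_j c 0 j *: B j) v = m (Z (\sum_j c 0 j *: B j)) v +
    e^-1 * \sum_j c 0 j * L j v.
  rewrite !(linear_sum Z) formC (formC m) !linear_sum/= mulr_sumr -big_split.
  apply: eq_bigr => j _ /=.
  rewrite formZr (formC g) BP linearZ/= formZr (formC m); ring.
have Nu : N \in unitmx.
  (* A kernel vector [c] gives [u] with [L j u = c j], so the penalty cancels and [u] solves the
     homogeneous equation. Uniqueness makes it [m]-null, and then [c j = L j u = 0]. *)
  rewrite unitmxE unitfE; apply/negP => /det0P[c /negP c0 cN]; apply: c0.
  pose u := \sum_j c 0 j *: B j.
  have Lu i : L i u = c 0 i by rewrite comb cN mxE subr0.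
  have /uniq u0 : forall v, h u v = m (Z u) v.
    move=> v; have := gcomb c v; rewrite gE.
    rewrite (eq_bigr (fun j => c 0 j * L j v)); first by move/addIr.
    by move=> j _; rewrite -/u Lu.
  apply/eqP/rowP => i; rewrite mxE -Lu; exact: L0.
(* [2 * e * c] bounds [u0], and the inner sums bound the coefficients [b *m invmx N] in terms of
   [u0]. *)
pose M := (1 + \sum_j (\sum_i `|C i| * `|invmx N i j|) * seminorm m (B j)) * (2 * e).
exists M.
  rewrite mulr_ge0 ?mulr_ge0 ?(ltW e0)// addr_ge0// sumr_ge0// => j _.
  by rewrite mulr_ge0 ?seminorm_ge0// sumr_ge0// => i _; rewrite mulr_ge0.
move=> l c c0 lc; have [u0 [u0P u0b]] := LM c l c0 lc.
pose b : 'rV[R]_n := \row_i L i u0.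
pose cc := b *m invmx N.
exists (u0 + \sum_j cc 0 j *: B j); split.
  move=> v; set u := \sum_j _.
  have Lu i : L i (u0 + u) = cc 0 i.
    rewrite linearD/= comb /cc -mulmxA mulVmx// mulmx1 [X in _ - X]mxE.
    by rewrite addrC subrK.
  have : g (u0 + u) v = m (Z (u0 + u)) v + l v + e^-1 * \sum_j cc 0 j * L j v.
    rewrite formDl u0P gcomb linearD/= formDl; ring.
  rewrite gE (eq_bigr (fun j => cc 0 j * L j v)); first by move/addIr.
  by move=> j _; rewrite Lu.
apply: le_trans (seminormD _ _ _) _; rewrite /M -mulrA.
apply: (@le_trans _ _ ((1 + \sum_j (\sum_i `|C i| * `|invmx N i j|) * seminorm m (B j)) *
  seminorm m u0)); last first.
  rewrite ler_wpM2l// addr_ge0// sumr_ge0// => j _.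
  by rewrite mulr_ge0 ?seminorm_ge0// sumr_ge0// => i _; rewrite mulr_ge0.
rewrite mulrDl mul1r lerD2l; apply: le_trans (seminorm_sum _ _ _) _.
rewrite mulr_suml; apply: ler_sum => j _.
rewrite seminormZ mulrAC ler_wpM2r ?seminorm_ge0// !mxE.
apply: le_trans (ler_norm_sum _ _ _) _; rewrite mulr_suml.
apply: ler_sum => i _; rewrite normrM mulrAC ler_wpM2r// mxE.
apply: le_trans (LC i u0) _.
by rewrite ler_wpM2r ?seminorm_ge0 ?ler_norm.
Qed.

(** On [S] the estimate with a small [e] absorbs [h], so a vector of [S] killed by all [L j] is
    [m]-null. Modulo null vectors [S] thus embeds into [R^n], and a family whose matrix of values
    has maximal rank spans it. *)
Lemma finite_compactness_dim h m (S : X -> Prop) (a : R) :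
  finite_compactness h m ->
  S 0 -> (forall c u v, S u -> S v -> S (c *: u + v)) ->
  (forall u, S u -> h u u <= a * m u u) ->
  exists n (w : 'I_n -> X), (forall i, S (w i)) /\
    forall u, S u -> exists c : 'I_n -> R,
      m (u - \sum_i c i *: w i) (u - \sum_i c i *: w i) = 0.
Proof.
move=> cpt S0 SD Sa.
have e0 : 0 < (2 * (`|a| + 1))^-1 by rewrite invr_gt0 mulr_gt0// ltr_wpDl.
have [n [L [_ me]]] := cpt _ e0.
have zero u : S u -> (forall j, L j u = 0) -> m u u = 0.
  move=> Su Lu; have := me u; rewrite big1 ?addr0 => [|j _]; last by rewrite Lu expr0n.
  move=> H; apply/eqP; rewrite eq_le form_ge0 andbT.
  have : (2 * (`|a| + 1))^-1 * h u u <= 2^-1 * m u u.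
    apply: (@le_trans _ _ ((2 * (`|a| + 1))^-1 * ((`|a| + 1) * m u u))).
      rewrite ler_wpM2l ?(ltW e0)//; apply: le_trans (Sa _ Su) _.
      rewrite ler_wpM2r ?form_ge0//; have := ler_norm a; lra.
    rewrite invfM mulrA -[_ * _ * (_ + _)]mulrA mulVf ?mulr1// gt_eqF// ltr_wpDl//.
  lra.
pose A k (w : 'I_k -> X) : 'M[R]_(k, n) := \matrix_(i, j) L j (w i).
pose P (r : nat) := `[< exists k (w : 'I_k -> X), (forall i, S (w i)) /\ \rank (A k w) = r >].
have P0 : exists r, P r.
  by exists (\rank (A 0%N (fun=> (0 : X)))); apply/asboolP; exists 0%N, (fun=> (0 : X)).
have Pb r : P r -> (r <= n)%N.
  by move=> /asboolP[k [w [_ <-]]]; exact: rank_leq_col.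
case: (ex_maxnP P0 Pb) => r /asboolP[k [w [Sw rw]]] rmax.
exists k, w; split => // u Su.
(* Adjoining [u] cannot raise the maximal rank, so the row of values of [u] lies in the row space of
   [A k w]. *)
pose w' (i : 'I_(1 + k)) := match fintype.split i with inl _ => u | inr j => w j end.
have Aw' : A _ w' = col_mx (\row_j L j u) (A k w).
  apply/matrixP => i j; rewrite !mxE /w'; case: fintype.splitP => i' _; by rewrite !mxE.
have sub : ((\row_j L j u) <= A k w)%MS.
  have : (\rank (A _ w') <= \rank (A k w))%N.
    rewrite rw; apply: rmax; apply/asboolP; exists (1 + k)%N, w'; split => // i.
    by rewrite /w'; case: fintype.split.
  rewrite Aw' -addsmxE => H.
  have : (A k w <= (\row_j L j u) + A k w)%MS by exact: addsmxSr.
  move=> /mxrank_leqif_sup/geq_leqif; rewrite H => /esym.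
  by rewrite addsmx_sub => /andP[].
have /submxP[c cE] := sub.
exists (fun i => c 0 i).
have SN x : S x -> S (- x) by move=> Sx; rewrite -scaleN1r -[_ *: _]addr0; exact: SD.
have Ssum : S (\sum_i c 0 i *: w i).
  by elim/big_ind: _ => // [x y Sx Sy|i _]; [rewrite -[x]scale1r; exact: SD|
    rewrite -[_ *: _]addr0; exact: SD].
apply: zero.
  by rewrite -[u]scale1r; apply: SD => //; exact: SN.
move=> j; rewrite linearB linear_sum/=.
move/rowP : cE => /(_ j); rewrite !mxE => ->.
by rewrite -sumrB big1// => i _; rewrite mxE scalarZ subrr.
Qed.

(* Eigenvectors for distinct [mu i] are orthogonal for [m]; a combination killed
   by all the functionals of the compactness estimate has zero norm. *)
Lemma finite_compactness_eigen h m (a : R) : finite_compactness h m ->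
  exists n, forall (w : 'I_n.+1 -> X) (mu : 'I_n.+1 -> R),
    (forall i v, h (w i) v = mu i * m (w i) v) -> (forall i, mu i <= a) ->
    injective mu -> exists i, m (w i) (w i) = 0.
Proof.
move=> cpt.
have e0 : 0 < (2 * (`|a| + 1))^-1 by rewrite invr_gt0 mulr_gt0// ltr_wpDl.
have [n [L [_ me]]] := cpt _ e0.
exists n => w mu wP mua muI; apply: contrapT => /forallNP w0.
have orth i j : i != j -> m (w i) (w j) = 0.
  move=> ij; have := wP i (w j); rewrite formC wP (formC m (w j)) => /eqP.
  rewrite -subr_eq0 -mulrBl mulf_eq0 => /orP[|/eqP//].
  by rewrite subr_eq0 => /eqP/muI/esym/eqP; rewrite (negbTE ij).
pose A : 'M[R]_(n.+1, n) := \matrix_(i, j) L j (w i).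
have : kermx A != 0.
  by rewrite kermx_eq0 -row_leq_rank -ltnNge ltnS rank_leq_col.
case/rowV0Pn => c /sub_kermxP cA c0.
pose u := \sum_i c 0 i *: w i.
have Lu j : L j u = 0.
  rewrite linear_sum/=; move/rowP : cA => /(_ j); rewrite [X in X = _]mxE mxE.
  by apply: etrans; apply: eq_bigr => i _; rewrite mxE scalarZ.
have mwu i : m (w i) u = c 0 i * m (w i) (w i).
  rewrite linear_sum/= (bigD1 i)//= big1 ?addr0 ?formZr// => j ji.
  by rewrite formZr orth ?mulr0// eq_sym.
have muE : m u u = \sum_i c 0 i ^+ 2 * m (w i) (w i).
  rewrite {2}/u linear_sum/=; apply: eq_bigr => i _.
  by rewrite formZr formC mwu expr2 mulrA.
have hu : h u u <= a * m u u.
  rewrite muE {2}/u linear_sum/= mulr_sumr; apply: ler_sum => i _.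
  rewrite formZr (formC h) wP mwu.
  rewrite (_ : _ * (_ * _) = mu i * (c 0 i ^+ 2 * m (w i) (w i))); last by ring.

  by rewrite ler_wpM2r// mulr_ge0 ?sqr_ge0 ?form_ge0.
have mu0 : 0 < m u u.
  have [i ci] : exists i, c 0 i != 0.
    apply: contrapT => /forallNP H; case/negP : c0; apply/eqP/rowP => i.
    by rewrite mxE; apply/eqP; move: (H i) => /negP; rewrite negbK.
  rewrite muE (bigD1 i)//= ltr_wpDr//.
    by rewrite sumr_ge0// => j _; rewrite mulr_ge0 ?sqr_ge0 ?form_ge0.
  rewrite mulr_gt0 ?lt_neqAle ?sqr_ge0 ?form_ge0 ?andbT//.
    by rewrite eq_sym expf_eq0.
  by rewrite eq_sym; apply/eqP/w0.
have := me u; rewrite big1 ?addr0 => [|j _]; last by rewrite Lu expr0n.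
have : (2 * (`|a| + 1))^-1 * h u u <= 2^-1 * m u u.
  apply: (@le_trans _ _ ((2 * (`|a| + 1))^-1 * ((`|a| + 1) * m u u))).
    rewrite ler_wpM2l ?(ltW e0)//; apply: le_trans hu _.
    rewrite ler_wpM2r ?form_ge0//; have := ler_norm a; lra.
  rewrite invfM mulrA -[_ * _ * (_ + _)]mulrA mulVf ?mulr1// gt_eqF// ltr_wpDl//.
lra.
Qed.

End fredholm.

(** * Lebesgue measure and square-integrable functions *)

Section boxes.
Context {R : realType} {d : nat}.
Local Notation E := 'rV[R]_d.
Local Notation mu := (@lebesgue_rV R d).

Lemma rV_norm_leP (x : E) (c : R) : 0 <= c ->
  `|x| <= c <-> forall i, `|x 0 i| <= c.
Proof.
move=> c0; rewrite [`|x|]mx_normrE; split => [/bigmax_leP[_ H] i|H].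
  exact: (H (0, i)).
by apply/bigmax_leP; split => // -[i j] _ /=; rewrite ord1.
Qed.

Lemma coord_le_norm (x : E) i : `|x 0 i| <= `|x|.
Proof. by have [] := rV_norm_leP x (normr_ge0 x) => /(_ (lexx _)). Qed.

Lemma continuous_rV_measurable (f : E -> R) : continuous f -> measurable_fun setT f.
Proof.
move=> cf; apply: (measurability _ (measurable_realfun.RGenOInfty.measurableE R)) => //.
move=> _ [_ [x ->] <-]; rewrite setTI; apply: sub_sigma_algebra.
by apply: open_comp => //; exact: interval_open.
Qed.

Lemma measurable_coord (i : 'I_d) : measurable_fun setT (fun x : E => x 0 i).
Proof. by apply: continuous_rV_measurable => x; exact: coord_continuous. Qed.

Lemma measurable_rV d' (T : measurableType d') (f : T -> E) :
  (forall i, measurable_fun setT (fun x => f x 0 i)) -> measurable_fun setT f.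
Proof.
move=> mf; rewrite (_ : f = @row_of_tuple R d \o (fun x => [tuple f x 0 i | i < d])); last first.
  by apply/funext => x; apply/rowP => i; rewrite /= mxE tnth_mktuple.
apply: measurableT_comp; first exact: measurable_row_of_tuple.
apply/measurable_fun_tnthP => i.
rewrite (_ : _ \o _ = (fun x => f x 0 i)); first exact: mf.
by apply/funext => x /=; rewrite tnth_mktuple.
Qed.

Definition cbox (a b : E) : set E := [set x | forall i, a 0 i <= x 0 i <= b 0 i].

Lemma cboxE a b : cbox a b =
  \bigcap_(i in [set: 'I_d]) ((fun x : E => x 0 i) @^-1` `[a 0 i, b 0 i]).
Proof.
apply/seteqP; split => [x h i _|x h i]; first by rewrite /= in_itv/=.
by have := h i I; rewrite /= in_itv.
Qed.

Lemma measurable_cbox a b : measurable (cbox a b).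
Proof.
rewrite cboxE; apply: fin_bigcap_measurable => // i _.
by rewrite -[X in measurable X]setTI; apply: measurable_coord.
Qed.

Lemma lebesgue_cbox (a b : E) : (forall i, a 0 i <= b 0 i) ->
  mu (cbox a b) = (\prod_i (b 0 i - a 0 i))%:E.
Proof. exact: lebesgue_rV_box. Qed.

Lemma cbox0 (a b : E) i : b 0 i < a 0 i -> cbox a b = set0.
Proof.
move=> ba; apply/seteqP; split => // x /(_ i) /andP[ax xb].
by have := le_lt_trans (le_trans ax xb) ba; rewrite ltxx.
Qed.

Lemma lebesgue_cbox_lty a b : (mu (cbox a b) < +oo)%E.
Proof.
have [ab|] := pselect (forall i, a 0 i <= b 0 i).
  by rewrite lebesgue_cbox// ltry.
by move=> /existsNP[i /negP]; rewrite -ltNge => /cbox0 ->; rewrite measure0.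
Qed.

Lemma cboxI a b a' b' : exists a'' b'', cbox a b `&` cbox a' b' = cbox a'' b''.
Proof.
exists (\row_i Num.max (a 0 i) (a' 0 i)), (\row_i Num.min (b 0 i) (b' 0 i)).
apply/seteqP; split => [x [h h'] i|x h].
  by rewrite !mxE ge_max le_min; move: (h i) (h' i) => /andP[-> ->] /andP[-> ->].
by split => i; have := h i; rewrite !mxE ge_max le_min => /andP[/andP[? ?] /andP[? ?]];
  apply/andP.
Qed.

Definition cube (k : nat) : set E := cbox (const_mx (- k%:R)) (const_mx k%:R).

Lemma bigcup_cube : \bigcup_k cube k = setT.
Proof.
apply/seteqP; split => // x _; exists (Num.truncn `|x|).+1 => // i.
rewrite !mxE -ler_norml; apply: le_trans (ltW (truncnS_gt _)).
exact: coord_le_norm.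
Qed.

Definition cboxes : set (set E) := [set A | exists a b, A = cbox a b].

(** Measurability of the identity from the sigma-algebra of boxes can be checked on coordinates, and
    open half-spaces are countable unions of boxes. *)
Lemma measurable_cboxes : @measurable _ E = <<s cboxes >>.
Proof.
apply/seteqP; split; last first.
  apply: smallest_sub; first exact: sigma_algebra_measurable.
  by move=> _ [a [b ->]]; exact: measurable_cbox.
move=> A mA.
suff : measurable_fun setT (id : g_sigma_algebraType cboxes -> E).
  by move=> /(_ measurableT _ mA); rewrite setTI preimage_id.
apply: measurable_rV => i.
apply: (measurability _ (measurable_realfun.RGenOInfty.measurableE R)) => //.
move=> _ [_ [c ->] <-]; rewrite setTI.
(* The [i]-th lower bound tends to [c] from above, which turns the strict inequality into closed
   ones; all other sides grow without bound. *)
pose a (k : nat) : E := \row_j if j == i then c + k.+1%:R^-1 else - k%:R.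
rewrite (_ : _ @^-1` _ = \bigcup_k cbox (a k) (const_mx k%:R)).
  apply: bigcupT_measurable => k; apply: sub_sigma_algebra.
  by exists (a k), (const_mx k%:R).
apply/seteqP; split => [x|x [k _ /(_ i)]]; last first.
  rewrite !mxE eqxx /= in_itv/= andbT => /andP[+ _].
  by apply: lt_le_trans; rewrite ltrDl.
rewrite /= in_itv/= andbT => cx.
pose k1 := Num.truncn `|x|; pose k2 := Num.truncn (x 0 i - c)^-1.
exists (maxn k1.+1 k2) => // j; rewrite !mxE.
have xk l : `|x 0 l| <= (maxn k1.+1 k2)%:R.
  apply: le_trans (_ : `|x| <= _); first exact: coord_le_norm.
  apply: le_trans (ltW (truncnS_gt _)) _.
  by rewrite ler_nat leq_maxl.
have := xk j; rewrite ler_norml => /andP[h1 ->]; rewrite andbT.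
case: eqP => [->|//]; rewrite -lerBrDl.
rewrite -[leRHS]invrK lef_pV2 ?posrE ?invr_gt0 ?subr_gt0//.
apply: le_trans (ltW (truncnS_gt _)) _.
by rewrite ler_nat ltnS leq_maxr.
Qed.

Lemma measure_eq_cbox (m1 m2 : {measure set E -> \bar R}) :
  (forall a b, m1 (cbox a b) = m2 (cbox a b)) ->
  (forall k, (m1 (cube k) < +oo)%E) ->
  forall A, measurable A -> m1 A = m2 A.
Proof.
move=> m12 m1oo A mA.
apply: (@measure_unique _ R E cboxes cube) => //.
- exact: measurable_cboxes.
- by move=> _ _ [a [b ->]] [a' [b' ->]]; have [a'' [b'' ->]] := cboxI a b a' b'; exists a'', b''.
- by move=> k; exists (const_mx (- k%:R)), (const_mx k%:R).
- exact: bigcup_cube.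
- by move=> _ [a [b ->]].
Qed.

Lemma lebesgue_rV_sigma_finite : sigma_finite setT mu.
Proof.
exists cube; first by rewrite bigcup_cube.
by move=> k; split; [exact: measurable_cbox|exact: lebesgue_cbox_lty].
Qed.

HB.instance Definition _ := @Measure_isSigmaFinite.Build _ E R mu
  lebesgue_rV_sigma_finite.

Lemma measurable_shift (h : E) : measurable_fun setT (fun x : E => x + h).
Proof.
apply: measurable_rV => i; under eq_fun do rewrite mxE.
by apply: measurable_funD => //; exact: measurable_coord.
Qed.

Lemma lebesgue_shift (h : E) A : measurable A -> mu ((fun x => x + h) @^-1` A) = mu A.
Proof.
move=> mA.
apply: (@measure_eq_cbox (measure_function_pushforward__canonical__measure_function_Measure
  mu (measurable_shift h)) mu) => //=.
  move=> a b; rewrite /pushforward.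
  rewrite (_ : _ @^-1` _ = cbox (a - h) (b - h)); last first.
    apply/seteqP; split => x /= H i; have := H i; rewrite !mxE;
    by rewrite lerBlDr lerBrDr.
  have [ab|] := pselect (forall i, a 0 i <= b 0 i).
    rewrite !lebesgue_cbox//; last by move=> i; rewrite !mxE lerD2r.
    by congr EFin; apply: eq_bigr => i _; rewrite !mxE opprB addrA addrNK.
  move=> /existsNP[i /negP]; rewrite -ltNge => ba; rewrite (cbox0 ba) (@cbox0 _ _ i)//.
  by rewrite !mxE ltrD2r.
move=> k; rewrite /pushforward.
rewrite (_ : _ @^-1` _ = cbox (const_mx (- k%:R) - h) (const_mx k%:R - h)).
  exact: lebesgue_cbox_lty.
apply/seteqP; split => x /= H i; have := H i; rewrite !mxE;
  by rewrite lerBlDr lerBrDr.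
Qed.

Lemma ge0_integral_shift (h : E) (f : E -> \bar R) : measurable_fun setT f ->
  (forall x : E, 0 <= f x)%E ->
  (\int[mu]_x f ((x : E) + h)%R = \int[mu]_x f x)%E.
Proof.
move=> mf f0.
have := @ge0_integral_pushforward _ _ _ _ R _ (measurable_shift h) mu setT f measurableT mf
  (fun x _ => f0 x).
rewrite preimage_setT => /esym; rewrite /comp => ->.
rewrite (@eq_measure_integral _ _ _ _ mu
  (measure_function_pushforward__canonical__measure_function_Measure mu (measurable_shift h)))//.
by move=> A mA _; exact: lebesgue_shift.
Qed.

End boxes.

(** * The space of square-integrable functions and its completeness *)

Section L2space.
Context d {T : measurableType d} {R : realType} {mu : {measure set T -> \bar R}}.
Local Notation L := (LfunType mu (lee1n 2)).

Lemma Lfun2P (f : T -> R) : f \in Lfun mu 2%:E <->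
  measurable_fun setT f /\ mu.-integrable setT (fun x => (f x ^+ 2)%:E).
Proof.
split=> [fL|[mf fi]].
  split; last exact: Lfun2_integrable_sqr.
  by move: fL; rewrite inE => /andP[+ _]; rewrite inE.
rewrite inE; apply/andP; split; rewrite inE//= /finite_norm unlock /Lnorm.
apply: poweR_lty.
have /integrableP[_] := fi; apply: le_lt_trans.
by rewrite le_eqVlt; apply/orP; left; apply/eqP; apply: eq_integral => x _;
  rewrite /= powR_mulrn// normrX.
Qed.

Lemma L2_measurable (f : L) : measurable_fun setT (f : T -> R).
Proof. by have /Lfun2P[] := LfunP f. Qed.

Lemma L2_sqr_integrable (f : L) : mu.-integrable setT (fun x => (f x ^+ 2)%:E).
Proof. by have /Lfun2P[] := LfunP f. Qed.

Lemma L2_mul_integrable (f g : L) : mu.-integrable setT (fun x => (f x * g x)%:E).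
Proof. by have /Lfun1_integrable := Lfun2_mul_Lfun1 (LfunP f) (LfunP g). Qed.

Definition ip_def (f g : L) : R := \int[mu]_x (f x * g x).

Fact ip_scalar f : scalar (ip_def f).
Proof.
move=> a g h; rewrite /ip_def -RintegralZl//; last exact: L2_mul_integrable.
rewrite -RintegralD//; last 2 first.
- apply: eq_integrable (integrableZl _ a (L2_mul_integrable f g)) => //.
- exact: L2_mul_integrable.
by apply: eq_Rintegral => x _ /=; rewrite mulrDr mulrCA.
Qed.

Fact ipC f g : ip_def f g = ip_def g f.
Proof. by apply: eq_Rintegral => x _; rewrite mulrC. Qed.

Fact ip_ge0 f : 0 <= ip_def f f.
Proof. by apply: Rintegral_ge0 => x _; rewrite -expr2 sqr_ge0. Qed.

Definition ip : psdForm L := PsdForm ip_scalar ipC ip_ge0.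

Lemma ipE (f g : L) : ip f g = \int[mu]_x (f x * g x). Proof. by []. Qed.

Lemma EFin_ip (f : L) : (ip f f)%:E = (\int[mu]_x (f x ^+ 2)%:E)%E.
Proof.
rewrite ipE /Rintegral fineK.
  by apply: eq_integral => x _; rewrite expr2.
exact: integrable_fin_num (L2_mul_integrable f f).
Qed.

Lemma ip_eq0 (f : L) : ip f f = 0 -> {ae mu, forall x, f x = 0}.
Proof.
move=> f0; have := EFin_ip f; rewrite f0 => /esym.
rewrite (eq_integral (fun x => `|(f x ^+ 2)%:E|%E)) => [|x _]; last first.
  by rewrite gee0_abs// lee_fin sqr_ge0.
move/(ae_eq_integral_abs mu measurableT) => H.
have /H : measurable_fun setT (fun x => (f x ^+ 2)%:E).
  by apply/measurable_EFinP/measurable_funX; exact: L2_measurable.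
by apply: filterS => x /(_ I) [] /eqP; rewrite sqrf_eq0 => /eqP.
Qed.

Lemma ip_ae (f g h : L) : {ae mu, forall x, f x = g x} -> ip f h = ip g h.
Proof.
move=> fg; rewrite !ipE /Rintegral; congr fine.
apply: ae_eq_integral => //.
- by apply: measurable_int; exact: L2_mul_integrable.
- by apply: measurable_int; exact: L2_mul_integrable.
by apply: filterS fg => x -> _.
Qed.

(** Cauchy-Schwarz with weights [2 ^+ i], whose reciprocals from [n] on sum to [2 * 2^-1 ^+ n]. The
    weights are mild enough for the series of squares to stay integrable when the squared norms
    decay like [4^-1 ^+ n]. *)
Lemma geometric_telescope (u : nat -> R) n k :
  (u (n + k)%N - u n) ^+ 2 <=
  2 * 2^-1 ^+ n * \sum_(n <= i < n + k) 2 ^+ i * (u i.+1 - u i) ^+ 2.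
Proof.
elim: k n => [|k IH] n; first by rewrite addn0 subrr expr0n/= big_geq// mulr0.
rewrite addnS big_ltn ?ltnS ?leq_addr// -addSn.
have := IH n.+1; set S := \sum_(_ <= _ < _) _.
rewrite (_ : u (n.+1 + k)%N - u n = (u (n.+1 + k)%N - u n.+1) + (u n.+1 - u n)); last by ring.
set a := u (n.+1 + k)%N - _; set b := u n.+1 - u n => H.
have E1 : 2^-1 ^+ n * 2 ^+ n = 1 :> R by rewrite -exprMn mulVf// expr1n.
have -> : 2 * 2^-1 ^+ n * (2 ^+ n * b ^+ 2 + S) =
    2 * b ^+ 2 * (2^-1 ^+ n * 2 ^+ n) + 2 * 2^-1 ^+ n * S by ring.
rewrite E1; move: H; rewrite (exprS _ n).
have := sqr_ge0 (a - b); lra.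
Qed.

Lemma sum_geometric_half k : \sum_(0 <= i < k) (2^-1 : R) ^+ i = 2 * (1 - 2^-1 ^+ k).
Proof.
elim: k => [|k IH]; first by rewrite big_geq// expr0 subrr mulr0.
rewrite big_nat_recr//= IH exprS; lra.
Qed.

(** The weighted series [S] of squared increments has finite integral and dominates every
    [(f (n + k) x - f n x) ^+ 2] with a factor tending to zero. This one function yields both modes
    of convergence, in [L_2] and a.e., for the whole sequence. *)
Lemma L2_fast_cauchy (f : nat -> L) (C : R) :
  (forall n, ip (f n.+1 - f n) (f n.+1 - f n) <= C * 4^-1 ^+ n) ->
  exists g : L, ip (f n - g) (f n - g) @[n --> \oo] --> (0 : R) /\
    {ae mu, forall x, f n x @[n --> \oo] --> g x}.
Proof.
move=> fC; have C0 : 0 <= C.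
  by have := le_trans (form_ge0 _ _) (fC 0%N); rewrite expr0 mulr1.
pose a n x := 2 ^+ n * (f n.+1 x - f n x) ^+ 2.
have a0 n x : 0 <= a n x by rewrite mulr_ge0 ?sqr_ge0 ?exprn_ge0.
have ma n : measurable_fun setT (fun x => (a n x)%:E).
  apply/measurable_EFinP; apply: measurable_funM => //; apply: measurable_funX.
  by apply: measurable_funB; exact: L2_measurable.
pose S x := (\sum_(n <oo) (a n x)%:E)%E.
have S0 x : (0 <= S x)%E by apply: nneseries_ge0 => n _ _; rewrite lee_fin.
have mS : measurable_fun setT S.
  by apply: ge0_emeasurable_sum => // n x _ _; rewrite lee_fin.
have intS : (\int[mu]_x S x <= (2 * C)%:E)%E.
  rewrite integral_nneseries//; last by move=> n x _; rewrite lee_fin.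
  apply: lime_le.
    by apply: is_cvg_nneseries => n _ _; apply: integral_ge0 => x _; rewrite lee_fin.
  apply: nearW => k.
  apply: (@le_trans _ _ (\sum_(0 <= i < k) (C * 2^-1 ^+ i)%:E)%E).
    apply: lee_sum => i _.
    under eq_integral do rewrite /a EFinM.
    rewrite ge0_integralZl//; last 2 first.
    - apply/measurable_EFinP; apply: measurable_funX.
      by apply: measurable_funB; exact: L2_measurable.
    - by move=> x _; rewrite lee_fin sqr_ge0.
    rewrite -(EFin_ip (f i.+1 - f i)) -EFinM lee_fin.
    apply: (@le_trans _ _ (2 ^+ i * (C * 4^-1 ^+ i))).
      by rewrite ler_wpM2l ?exprn_ge0.
    rewrite mulrCA -exprMn (_ : 2 * 4^-1 = 2^-1 :> R)//; by field.
  rewrite sumEFin lee_fin -mulr_sumr sum_geometric_half mulrCA mulrA.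
  by rewrite ler_piMr ?mulr_ge0// gerBl exprn_ge0.
have key x n k : (((f (n + k)%N x - f n x) ^+ 2)%:E <= (2 * 2^-1 ^+ n)%:E * S x)%E.
  apply: (@le_trans _ _ ((2 * 2^-1 ^+ n)%:E *
      (\sum_(n <= i < n + k) a i x)%:E)%E).
    by rewrite -EFinM lee_fin; exact: geometric_telescope.
  apply: lee_pmul => //; rewrite ?lee_fin ?mulr_ge0 ?exprn_ge0//.
    by apply: sumr_ge0 => i _.
  apply: (@le_trans _ _ (\sum_(0 <= i < n + k) a i x)%:E).
    rewrite lee_fin (@big_cat_nat _ _ _ n 0 (n + k))//= ?leq_addr// lerDr.
    by apply: sumr_ge0 => i _.
  by rewrite -sumEFin; apply: nneseries_lim_ge => i _ _; rewrite lee_fin.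
pose A := [set x | (S x < +oo)%E].
have mA : measurable A by rewrite -[A]setTI; exact: emeasurable_fun_infty_o.
have cvgA x : A x -> cvgn (fun n => f n x).
  move=> Ax; have Sf : S x \is a fin_num by rewrite ge0_fin_numE.
  apply/cauchy_cvgP/cauchy_exP => e e0.
  have b0 : 2 * fine (S x) * 2^-1 ^+ n @[n --> \oo] --> (0 : R).
    rewrite -[X in _ --> X](mulr0 (2 * fine (S x))); apply: cvgMr.
    by apply: cvg_expr; rewrite ger0_norm// invf_lt1 ?ltr1n.
  have e20 : 0 < e ^+ 2 by rewrite exprn_gt0.
  move/cvgrPdist_lt : b0 => /(_ _ e20)[N _ /(_ N (leqnn N))].
  rewrite /= sub0r normrN ger0_norm; last by rewrite !mulr_ge0 ?exprn_ge0 ?fine_ge0.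
  move=> bN; exists (f N x); exists N => // m /= Nm.
  rewrite /ball/= -(@ltr_pXn2r _ 2) ?nnegrE ?(ltW e0)//.
  rewrite real_normK ?num_real//; apply: le_lt_trans bN.
  rewrite -lee_fin -(subnKC Nm) -sqrrN opprB.
  apply: le_trans (key _ _ _) _.
  by rewrite -{1}(fineK Sf) -EFinM lee_fin mulrAC.
(* Cutting by the indicator of [A] makes the sequence converge at every point, so that the limit is
   measurable. *)
pose g x := limn (fun n => f n x * \1_A x).
have gcvg x : f n x * \1_A x @[n --> \oo] --> g x.
  apply/cvg_ex; have [Ax|Ax] := pselect (A x).
    have /cvg_ex[l fl] := cvgA _ Ax; exists l.
    by under eq_fun do rewrite indicE mem_set// mulr1.
  exists 0; under eq_fun do rewrite indicE memNset// mulr0.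
  exact: cvg_cst.
have mg : measurable_fun setT g.
  apply: (@measurable_fun_cvg _ _ _ _ (fun n x => f n x * \1_A x)) => // n.
  by apply: measurable_funM; [exact: L2_measurable|exact: measurable_indic].
have gA x : A x -> f n x @[n --> \oo] --> g x.
  by move=> Ax; have := gcvg x; under eq_fun do rewrite indicE mem_set// mulr1.
have keyg x n : (((f n x - g x) ^+ 2)%:E <= (2 * 2^-1 ^+ n)%:E * S x)%E.
  have [Ax|/negP] := pselect (A x); last first.
    rewrite -leNgt leye_eq => /eqP ->.
    by rewrite gt0_muley ?leey// lte_fin mulr_gt0 ?exprn_gt0.
  have Sf : S x \is a fin_num by rewrite ge0_fin_numE.
  rewrite -(fineK Sf) -EFinM lee_fin.
  have H : (f (m + n)%N x - f n x) ^+ 2 @[m --> \oo] --> (g x - f n x) ^+ 2.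
    rewrite expr2; under eq_fun do rewrite expr2.
    have H : f (m + n)%N x - f n x @[m --> \oo] --> g x - f n x.
      apply: cvgB; last exact: cvg_cst.
      by have := gA _ Ax; rewrite -(cvg_shiftn n).
    exact: cvgM.
  rewrite -sqrrN opprB.
  apply: (closed_cvg (fun y => y <= 2 * 2^-1 ^+ n * fine (S x)) _ _ _ H).
    exact: closed_le.
  apply: nearW => m; have := key x n m.
  by rewrite addnC -(fineK Sf) -EFinM lee_fin.
have intg n : (\int[mu]_x ((f n x - g x) ^+ 2)%:E <= (4 * C * 2^-1 ^+ n)%:E)%E.
  apply: (@le_trans _ _ (\int[mu]_x ((2 * 2^-1 ^+ n)%:E * S x))%E).
    apply: ge0_le_integral => //.
    - by move=> x _; rewrite lee_fin sqr_ge0.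
    - apply/measurable_EFinP; apply: measurable_funX.
      by apply: measurable_funB => //; exact: L2_measurable.
    - exact: measurable_funeM.
  rewrite ge0_integralZl//.
  apply: (@le_trans _ _ ((2 * 2^-1 ^+ n)%:E * (2 * C)%:E)%E).
    by rewrite lee_pmul2l// lte_fin mulr_gt0 ?exprn_gt0.
  by rewrite -EFinM lee_fin le_eqVlt; apply/orP; left; apply/eqP; ring.
have gL : g \in Lfun mu 2%:E.
  have -> : g = (f 0%N : T -> R) - (fun x => f 0%N x - g x).
    by apply/funext => x; rewrite !fctE opprB addrC subrK.
  apply: (@rpredB _ (hoelder_Lfun__canonical__Algebra_ZmodClosed mu (lee1n 2))).
    exact: LfunP.
  have mfg : measurable_fun setT (fun x => f 0%N x - g x).
    by apply: measurable_funB => //; exact: L2_measurable.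
  apply/Lfun2P; split => //; apply/integrableP; split.
    by apply/measurable_EFinP; exact: measurable_funX.
  under eq_integral do rewrite gee0_abs ?lee_fin ?sqr_ge0//.
  exact: le_lt_trans (intg 0%N) (ltry _).
exists (Lfun_Sub (lee1n 2) gL); split.
  have b0 : 4 * C * 2^-1 ^+ n @[n --> \oo] --> (0 : R).
    rewrite -[X in _ --> X](mulr0 (4 * C)); apply: cvgMr.
    by apply: cvg_expr; rewrite ger0_norm// invf_lt1 ?ltr1n.
  apply: squeeze_cvgr (@cvg_cst _ 0 _ _ _) b0; apply: nearW => n.
  by rewrite form_ge0/= -lee_fin EFin_ip; exact: intg.
have SI : mu.-integrable setT S.
  apply/integrableP; split => //.
  under eq_integral do rewrite gee0_abs//.
  exact: le_lt_trans intS (ltry _).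
have := integrable_ae measurableT SI.
by apply: filterS => x /(_ I) Sx; apply: gA; rewrite /A/= -ge0_fin_numE.
Qed.

End L2space.
Arguments ip {d T R} mu.

(** * Test functions and weak derivatives *)

Section flat_function.
Context {R : realType}.
Implicit Types (p : {poly R}) (t : R).

(** The polynomial factor in [1 / t] closes the family under differentiation, so smoothness of every
    order is a single induction in [Ck_flat]. *)
Definition flat p t : R := if 0 < t then p.[t^-1] * expR (- t^-1) else 0.

(* With [s = 1 / t], the derivative of [p(s) exp (- s)] in [t] is
   [s ^ 2 (p(s) - p'(s)) exp (- s)]. *)
Definition flat_deriv p := 'X^2 * (p - p^`()).

Lemma expr_le_fact_expR n t : 0 <= t -> t ^+ n <= n`!%:R * expR t.
Proof.
case: n => [|n] t0.
  by rewrite expr0 mul1r; apply: le_trans (expR_ge1Dx _); rewrite lerDl.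
rewrite mulrC -ler_pdivrMr ?ltr0n ?fact_gt0//.
by apply: le_trans (expR_ge1Dxn n t0); rewrite lerDr.
Qed.

Lemma poly_expR_bounded p : exists2 C, 0 <= C &
  forall s, 0 < s -> `|p.[s] * expR (- s)| <= C.
Proof.
exists (\sum_(i < size p) `|p`_i| * i`!%:R).
  by apply: sumr_ge0 => i _; rewrite mulr_ge0.
move=> s s0; rewrite normrM [`|expR _|]ger0_norm ?expR_ge0//.
rewrite expRN ler_pdivrMr ?expR_gt0// horner_coef mulr_suml.
apply: le_trans (ler_norm_sum _ _ _) _; apply: ler_sum => i _.
rewrite normrM -mulrA ler_wpM2l// ger0_norm ?exprn_ge0 ?(ltW s0)//.
by apply: expr_le_fact_expR; exact: ltW.
Qed.

(** Two powers of [t], gained by bounding ['X^2 * p] instead of [p], make the difference quotient at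
    the origin tend to zero. *)
Lemma flat_bound p : exists2 C, 0 <= C & forall t, `|flat p t| <= C * t ^+ 2.
Proof.
have [C C0 H] := poly_expR_bounded ('X^2 * p).
exists C => // t; rewrite /flat; case: ltP => [t0|]; last by rewrite normr0 mulr_ge0 ?sqr_ge0.
have := H t^-1; rewrite invr_gt0 => /(_ t0); rewrite hornerM hornerXn -mulrA normrM.
rewrite ger0_norm ?sqr_ge0// exprVn => h.
by rewrite -ler_pdivrMr ?exprn_gt0// mulrC.
Qed.

Lemma is_derive_flat p t : is_derive t 1 (flat p) (flat (flat_deriv p) t).
Proof.
case: (ltrgtP t 0) => [t0|t0|->].
- rewrite {2}/flat ltNge (ltW t0)/=.
  apply: (@near_eq_is_derive _ _ _ (cst 0)).
  near=> x; rewrite /flat ltNge (_ : x <= 0)//=.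
  by near: x; exact: lt_le_nbhsl.
- have t00 : t != 0 by rewrite gt_eqF.
  have nE : \forall x \near t, p.[x^-1] * expR (- x^-1) = flat p x.
    near=> x; rewrite /flat ifT//.
    by near: x; exact: lt_nbhsr.
  have dV : is_derive t 1 (fun x : R => x^-1) (- t ^- 2).
    have := @is_deriveV _ id t 1 1 t00 (is_derive_id _ _).
    by rewrite /= scaler1.
  have dp : is_derive t 1 (fun x => p.[x^-1]) (p^`().[t^-1] * - t ^- 2).
    have := @is_derive1_comp _ (fun x => p.[x]) (fun x => x^-1) t _ _ (is_derive_poly p (t^-1)) dV.
    by [].
  have de : is_derive t 1 (fun x => expR (- x^-1)) (expR (- t^-1) * t ^- 2).
    have dN : is_derive t 1 (fun x : R => - x^-1) (t ^- 2).
      by have := is_deriveN dV; rewrite opprK.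
    by have := @is_derive1_comp _ expR (fun x => - x^-1) t _ _ (is_derive_expR _) dN.
  have dpe := is_deriveM dp de.
  apply: (near_eq_is_derive nE); apply: is_derive_eq dpe _.
  rewrite /flat t0 /flat_deriv !hornerE /GRing.scale/=; field.
  done.
- rewrite {2}/flat ltxx.
  have [C C0 H] := flat_bound p.
  have C1 : 0 < C + 1 by rewrite ltr_wpDl.
  have F0 : flat p 0 = 0 by rewrite /flat ltxx.
  have cv : h^-1 *: ((flat p \o shift 0) (h *: 1) - flat p 0) @[h --> 0^'] --> (0 : R).
    apply/cvgrPdist_le => e e0; near=> h.
    rewrite /= addr0 /GRing.scale/= mulr1 F0 subr0 sub0r normrN normrM normfV.
    have [->|h0] := eqVneq h 0; first by rewrite normr0 invr0 mul0r ltW.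
    rewrite mulrC ler_pdivrMr ?normr_gt0//; apply: le_trans (H h) _.
    rewrite -real_normK ?num_real// expr2 mulrA ler_wpM2r//.
    apply: (@le_trans _ _ ((C + 1) * `|h|)); first by rewrite ler_wpM2r// lerDl.
    rewrite mulrC -ler_pdivlMr//; near: h; apply: dnbhs0_le.
    by rewrite divr_gt0.
  apply: DeriveDef; first by apply/cvg_ex; exists 0.
  exact: cvg_lim cv.
Unshelve. all: by end_near.
Qed.

End flat_function.

Section Ck_closure.
Context {R : realType} {d : nat}.
Local Notation E := 'rV[R]_d.
Implicit Types (f g phi : E -> R) (v x : E).

Lemma continuous_is_derive (f f' : R -> R) :
  (forall t : R, is_derive t (1 : R) f (f' t)) -> continuous f.
Proof.
move=> df t; apply: differentiable_continuous.
by apply/derivable1_diffP; have [] := df t.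
Qed.

Lemma continuous_coord_affine (c : R) (i : 'I_d) (b : R) :
  continuous (fun x : E => c * x 0 i + b).
Proof.
move=> x; apply: (@continuous_comp _ _ _ (fun x : E => x 0 i) (fun t => c * t + b)).
  exact: coord_continuous.
by apply: cvgD; [apply: cvgMr; exact: cvg_id|exact: cvg_cst].
Qed.

Lemma derive_coord_affine (f f' : R -> R) (c : R) (i : 'I_d) (b : R) v x :
  (forall t : R, is_derive t (1 : R) f (f' t)) ->
  is_derive x v (fun x : E => f (c * x 0 i + b)) (c * v 0 i * f' (c * x 0 i + b)).
Proof.
move=> df; set t := c * x 0 i + b; set w := c * v 0 i.
have [df1 df2] := df t.
have dfw : differentiable f t by exact/derivable1_diffP.
have E : (fun h => h^-1 *: (((fun x : E => f (c * x 0 i + b)) \o shift x) (h *: v)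
      - f (c * x 0 i + b))) = (fun h => h^-1 *: ((f \o shift t) (h *: w) - f t)).
  apply/funext => h /=; congr (_ *: (f _ - _)).
  rewrite !mxE /t /w /GRing.scale/=; ring.
have D : 'D_w f t = w * f' t.
  transitivity ('d f t (w *: (1 : R))); first by rewrite deriveE// /GRing.scale/= mulr1.
  by rewrite linearZ/= -deriveE// df2.
apply: DeriveDef.
  rewrite /derivable E; exact: diff_derivable.
by rewrite /derive E.
Qed.

Lemma Ck_continuous k f : Ck k f -> continuous f.
Proof. by case: k => [|k] []. Qed.

Lemma Ck_derivable k f : Ck k.+1 f -> forall i x, derivable f x (evec i).
Proof. by move=> [_ H] i x; have [] := H i. Qed.

Arguments Ck_continuous {k f} _ x.
Arguments Ck_derivable {k f} _ i x.

Lemma Ck_derive k f i : Ck k.+1 f -> Ck k (fun x => 'D_(evec i) f x).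
Proof. by move=> [_ H]; have [] := H i. Qed.

Lemma CkS k f : Ck k.+1 f -> Ck k f.
Proof.
elim: k f => [|k IH] f; first by case.
move=> [cf H]; split => // i; split; first by have [] := H i.
by apply: IH; have [] := H i.
Qed.

Lemma CkD k f g : Ck k f -> Ck k g -> Ck k (fun x => f x + g x).
Proof.
elim: k f g => [|k IH] f g Cf Cg; split => //.
- by move=> x; exact: (@continuousD R R E f g x (Ck_continuous Cf x) (Ck_continuous Cg x)).
- by move=> x; exact: (@continuousD R R E f g x (Ck_continuous Cf x) (Ck_continuous Cg x)).
move=> i; have df := Ck_derivable Cf i; have dg := Ck_derivable Cg i.
split=> [x|]; first exact: derivableD.
rewrite (_ : (fun x => _) = (fun x => 'D_(evec i) f x + 'D_(evec i) g x)).
  by apply: IH; apply: Ck_derive.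
by apply/funext => x; rewrite -deriveD.
Qed.

Lemma CkM k f g : Ck k f -> Ck k g -> Ck k (fun x => f x * g x).
Proof.
elim: k f g => [|k IH] f g Cf Cg; split => //.
- by move=> x; exact: (@continuousM R E f g x (Ck_continuous Cf x) (Ck_continuous Cg x)).
- by move=> x; exact: (@continuousM R E f g x (Ck_continuous Cf x) (Ck_continuous Cg x)).
move=> i; have df := Ck_derivable Cf i; have dg := Ck_derivable Cg i.
split=> [x|]; first exact: derivableM.
rewrite (_ : (fun x => _) =
    (fun x => f x * 'D_(evec i) g x + g x * 'D_(evec i) f x)).
  by apply: CkD; apply: IH; by [exact: CkS|exact: Ck_derive].
by apply/funext => x; rewrite -[LHS]/('D_(evec i) (f * g) x) deriveM.
Qed.

Lemma Ck_cst k (c : R) : Ck k (fun _ : E => c).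
Proof.
elim: k c => [|k IH] c; split => //; try exact: cst_continuous.
move=> i; split => [x|]; first exact: derivable_cst.
have -> : 'D_(evec i) (fun _ : E => c) = (fun=> 0) :> (E -> R); last exact: IH.
by apply/funext => x; rewrite derive_cst.
Qed.

Lemma Ck_prod k (I : Type) (r : seq I) (F : I -> E -> R) :
  (forall i, Ck k (F i)) -> Ck k (fun x => \prod_(i <- r) F i x).
Proof.
move=> CF; elim: r => [|i r IH].
  by under eq_fun do rewrite big_nil; exact: Ck_cst.
by under eq_fun do rewrite big_cons; exact: CkM.
Qed.

Lemma Ck_flat k (p : {poly R}) (c : R) (i : 'I_d) (b : R) :
  Ck k (fun x : E => flat p (c * x 0 i + b)).
Proof.
have cF q : continuous (fun x : E => flat q (c * x 0 i + b)).
  move=> x; apply: (@continuous_comp _ _ _ (fun x : E => c * x 0 i + b) (flat q)).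
    exact: continuous_coord_affine.
  by apply: continuous_is_derive => t; exact: is_derive_flat.
elim: k p => [|k IH] p; split => // j.
have D x := derive_coord_affine c i b (evec j) x (is_derive_flat p).
split=> [x|]; first by have [] := D x.
have -> : 'D_(evec j) (fun x : E => flat p (c * x 0 i + b)) =
    (fun x : E => c * (evec j : E) 0 i * flat (flat_deriv p) (c * x 0 i + b)).
  by apply/funext => x; have [_] := D x.
by apply: CkM; [exact: Ck_cst|exact: IH].
Qed.

Lemma shift_quotient f (h : E) v x :
  (fun t : R => t^-1 *: (((fun y : E => f (y + h)) \o shift x) (t *: v) - f (x + h))) =
  (fun t : R => t^-1 *: ((f \o shift (x + h)) (t *: v) - f (x + h))).
Proof. by apply/funext => t; rewrite /= addrA. Qed.

Lemma derive_shift f (h : E) v x : 'D_v (fun y => f (y + h)) x = 'D_v f (x + h).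
Proof. by rewrite /derive shift_quotient. Qed.

Lemma Ck_shift k f (h : E) : Ck k f -> Ck k (fun x => f (x + h)).
Proof.
have cF g : continuous g -> continuous (fun x : E => g (x + h)).
  move=> cg x; apply: (@continuous_comp _ _ _ (fun x : E => x + h) g); last exact: cg.
  by apply: (@continuousD R E E id (fun=> h)); [exact: cvg_id|exact: cst_continuous].
elim: k f => [|k IH] f Cf; split => //; try exact: cF (Ck_continuous Cf).
move=> i; split=> [x|].
  by rewrite /derivable shift_quotient; exact: Ck_derivable Cf i _.
have -> : 'D_(evec i) (fun x => f (x + h)) = (fun x => 'D_(evec i) f (x + h)).
  by apply/funext => x; rewrite derive_shift.
by apply: (IH (fun y => 'D_(evec i) f y)); exact: Ck_derive.
Qed.

End Ck_closure.
Arguments Ck_continuous {R d k f} _ x.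
Arguments Ck_derivable {R d k f} _ i x.

(** * Test functions and smooth approximation of indicators *)

Section test_functions.
Context {R : realType} {d : nat}.
Local Notation E := 'rV[R]_d.
Local Notation mu := (@lebesgue_rV R d).
Implicit Types (phi psi f : E -> R) (x : E).

Lemma cubeP k x : cube k x <-> `|x| <= k%:R.
Proof.
split=> [H|H i].
  apply/rV_norm_leP => // i; have := H i.
  by rewrite !mxE ler_norml.
by rewrite !mxE -ler_norml; move/rV_norm_leP : H; exact.
Qed.

Lemma measurable_cube k : measurable (cube k : set E).
Proof. exact: measurable_cbox. Qed.

Lemma lebesgue_cube_lty k : (mu (cube k) < +oo)%E.
Proof. exact: lebesgue_cbox_lty. Qed.

Lemma closed_norm_le (M : R) : closed [set x : E | `|x| <= M].
Proof.
rewrite (_ : [set _ | _] = (fun x : E => `|x|) @^-1` [set y | y <= M])//.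
by apply: preimage_closed; [move=> x _; exact: norm_continuous|exact: closed_le].
Qed.

Lemma test_functionP phi : test_function phi <->
  (forall k, Ck k phi) /\ exists M : R, forall x, phi x != 0 -> `|x| <= M.
Proof.
split=> -[C H]; split => //.
  have [M [Mr HM]] := compact_bounded H.
  exists (M + 1) => x px; apply: (HM (M + 1)); first by rewrite ltrDl.
  exact: subset_closure.
have [M HM] := H.
apply: bounded_closed_compact; last exact: closed_closure.
exists M; split; first exact: num_real.
move=> y My x; have : closure [set x | phi x != 0] `<=` [set x | `|x| <= M].
  by rewrite closureE => z /(_ [set x | `|x| <= M]); apply; split;
    [exact: closed_norm_le|move=> u /= /HM].
by move=> /[apply] /= xM; apply: le_trans xM (ltW My).
Qed.

Lemma test_continuous phi : test_function phi -> continuous phi.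
Proof. by move=> /test_functionP[/(_ 0%N) []]. Qed.

Lemma test_derive phi i : test_function phi ->
  test_function (fun x => 'D_(evec i) phi x).
Proof.
move=> /test_functionP[C [M HM]]; apply/test_functionP; split.
  by move=> k; exact: Ck_derive (C k.+1).
exists M => x; apply: contraNT; rewrite -ltNge => Mx.
have nx : {near x, (cst 0 : E -> R) =1 phi}.
  have : open (~` [set x : E | `|x| <= M]) by apply: closed_openC; exact: closed_norm_le.
  rewrite openE => /(_ x)[]; first by apply/negP; rewrite -ltNge.
  move=> e /= e0 H; exists e => // y /H /= yM.
  by apply/esym/eqP; apply/negPn/negP => /HM.
have := @near_eq_is_derive _ _ _ _ _ _ _ _ nx (is_derive_cst (0 : R) x (evec i)).
by move=> [_ ->].
Qed.

Lemma test_shift phi (h : E) : test_function phi -> test_function (fun x => phi (x + h)).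
Proof.
move=> /test_functionP[C [M HM]]; apply/test_functionP; split.
  by move=> k; exact: Ck_shift.
exists (M + `|h|) => x /HM xM.
by rewrite -[x](addrK h); apply: le_trans (ler_normB _ _) _; rewrite lerD2r.
Qed.

Lemma testD phi psi (a : R) : test_function phi -> test_function psi ->
  test_function (fun x => a * phi x + psi x).
Proof.
move=> /test_functionP[C [M HM]] /test_functionP[D [N HN]]; apply/test_functionP; split.
  by move=> k; apply: CkD => //; apply: CkM => //; exact: Ck_cst.
exists (Num.max M N) => x; rewrite le_max; have [->|/HM ->//] := eqVneq (phi x) 0.
by rewrite mulr0 add0r => /HN ->; rewrite orbT.
Qed.

Lemma test_bounded phi : test_function phi ->
  exists B : R, 0 <= B /\ forall x, `|phi x| <= B.
Proof.
move=> tphi; have /test_functionP[C [M HM]] := tphi.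
have K : compact [set x : E | `|x| <= M].
  apply: bounded_closed_compact; last exact: closed_norm_le.
  by exists M; split; [exact: num_real|move=> y My x /= xM; exact: le_trans xM (ltW My)].
have cK : compact (phi @` [set x : E | `|x| <= M]).
  apply: continuous_compact => //; apply: continuous_subspaceT.
  exact: test_continuous.
have [B [Br HB]] := compact_bounded cK.
exists (`|B| + 1); split; first by rewrite addr_ge0.
move=> x; have [->|/HM xM] := eqVneq (phi x) 0; first by rewrite normr0 addr_ge0.
apply: (HB (`|B| + 1)); last by exists x.
by apply: (le_lt_trans (ler_norm _)); rewrite ltrDl.
Qed.

Lemma integrable_indic_cube k : mu.-integrable setT (fun x : E => (\1_(cube k) x)%:E).
Proof.
have mk := measurable_cube k.
apply/integrableP; split; first exact/measurable_EFinP.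
under eq_integral do rewrite gee0_abs ?lee_fin//.
by rewrite integral_indic// setIT; exact: lebesgue_cube_lty.
Qed.

Lemma bounded_support_Lfun f (B : R) k : measurable_fun setT f ->
  (forall x, `|f x| <= B * \1_(cube k) x) -> f \in Lfun mu 2%:E.
Proof.
move=> mf fB; apply/Lfun2P; split => //.
apply: (@le_integrable _ _ _ _ _ _ _ (fun x => (B ^+ 2 * \1_(cube k : set E) x)%:E)) => //.
- by apply/measurable_EFinP; exact: measurable_funX.
- move=> x _; rewrite lee_fin ger0_norm ?sqr_ge0//.
  apply: le_trans (ler_norm _); have := fB x; rewrite indicE.
  case: (x \in _) => /=; rewrite ?mulr1 ?mulr0; last first.
    by rewrite normr_le0 => /eqP ->; rewrite expr0n.
  by move=> H; rewrite -real_normK ?num_real// ler_pXn2r ?nnegrE// (le_trans _ H).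
under eq_fun do rewrite EFinM.
by apply: integrableZl => //; exact: integrable_indic_cube.
Qed.

Lemma test_supportP phi : test_function phi ->
  exists (B : R) k, forall x, `|phi x| <= B * \1_(cube k) x.
Proof.
move=> tphi; have [B [B0 HB]] := test_bounded tphi.
have /test_functionP[_ [M HM]] := tphi.
exists B, (Num.truncn `|M|).+1 => x.
have [->|/HM xM] := eqVneq (phi x) 0.
  by rewrite normr0 mulr_ge0// indicE.
rewrite indicE mem_set ?mulr1//; apply/cubeP.
apply: le_trans xM _; apply: le_trans (ler_norm _) _.
by rewrite ltW// truncnS_gt.
Qed.

Lemma test_Lfun phi : test_function phi -> phi \in Lfun mu 2%:E.
Proof.
move=> tphi; have [B [k H]] := test_supportP tphi.
apply: bounded_support_Lfun H.
by apply: continuous_rV_measurable; exact: test_continuous.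
Qed.

Lemma flat1_ge0 (t : R) : 0 <= flat 1 t.
Proof. by rewrite /flat; case: ifP => // _; rewrite hornerC mul1r expR_ge0. Qed.

Lemma flat1_le1 (t : R) : flat 1 t <= 1.
Proof.
rewrite /flat; case: ltP => // t0; rewrite hornerC mul1r expRN.
by rewrite invf_le1 ?expR_gt0// -expR0 ler_expR invr_ge0 ltW.
Qed.

Lemma flat1_gt0 (t : R) : flat 1 t != 0 -> 0 < t.
Proof. by rewrite /flat; case: ltP => //; rewrite eqxx. Qed.

(* The argument of [flat 1] tends to [+oo] for [0 <= t] and to [-oo] for [t < 0]. *)
Definition ramp (n : nat) (t : R) := flat 1 (n.+1%:R ^+ 2 * t + n.+1%:R).

Lemma ramp_neq0 n t : ramp n t != 0 -> -1 < t.
Proof.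
move=> /flat1_gt0; set k : R := n.+1%:R.
have k1 : 1 <= k by rewrite ler1n.
move=> H; rewrite ltNge; apply/negP => t1.
have : k ^+ 2 * t <= k ^+ 2 * -1 by rewrite ler_wpM2l ?sqr_ge0.
have : k <= k ^+ 2 by rewrite expr2 ler_peMl// (le_trans ler01).
lra.
Qed.

Lemma ramp_cvg t : ramp n t @[n --> \oo] --> ((0 <= t)%R%:R : R).
Proof.
have [t0|t0] := leP 0 t.
  have b0 : 1 - harmonic n @[n --> \oo] --> (1 - 0 : R).
    by apply: cvgB; [exact: cvg_cst|exact: cvg_harmonic].
  rewrite subr0 in b0; rewrite -[true%:R]/(1 : R).
  apply: (squeeze_cvgr _ b0 (cvg_cst _)); apply: nearW => n.
  rewrite flat1_le1 andbT /ramp /flat.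
  set k : R := n.+1%:R; have k0 : 0 < k by rewrite ltr0n.
  have kt : k <= k ^+ 2 * t + k by rewrite lerDr mulr_ge0 ?sqr_ge0.
  rewrite ifT ?(lt_le_trans k0)// hornerC mul1r.
  apply: le_trans (expR_ge1Dx _); rewrite /harmonic/= lerD2l lerN2.
  by rewrite lef_pV2// posrE (lt_le_trans k0).
apply: cvg_near_cst; near=> n.
rewrite /ramp /flat ifF//; apply/negbTE; rewrite -leNgt.
set k : R := n.+1%:R; have k0 : 0 < k by rewrite ltr0n.
rewrite expr2 -mulrA -{3}[k]mulr1 -mulrDr pmulr_rle0//.
have : (- t)^-1 <= k.
  rewrite /k; near: n; exists (Num.truncn (- t)^-1) => // m /= Hm.
  by apply: le_trans (ltW (truncnS_gt _)) _; rewrite ler_nat ltnS.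
rewrite -lef_pV2 ?posrE ?invr_gt0 ?oppr_gt0// invrK => H.
have : k * k^-1 <= k * - t by rewrite ler_wpM2l ?(ltW k0).
rewrite mulfV ?gt_eqF//; lra.
Unshelve. all: by end_near. Qed.

(** Tends to the indicator of the closed box, stays between [0] and [1] and has support in a set
    independent of [n], as dominated convergence asks. *)
Definition bump (a b : E) n x : R :=
  \prod_(i < d) (ramp n (x 0 i - a 0 i) * ramp n (b 0 i - x 0 i)).

Lemma bump_ge0 a b n x : 0 <= bump a b n x.
Proof. by apply: prodr_ge0 => i _; rewrite mulr_ge0 ?flat1_ge0. Qed.

Lemma bump_le1 a b n x : bump a b n x <= 1.
Proof.
apply: prodr_ile1 => i _; rewrite mulr_ge0 ?flat1_ge0//=.
by rewrite mulr_ile1 ?flat1_ge0 ?flat1_le1.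
Qed.

Lemma bump_support a b n x : bump a b n x != 0 -> `|x| <= `|a| + `|b| + 1.
Proof.
move/prodf_neq0 => H; apply/rV_norm_leP; first by rewrite !addr_ge0.
move=> i; have := H i isT; rewrite mulf_eq0 negb_or => /andP[/ramp_neq0 h1 /ramp_neq0 h2].
have := coord_le_norm a i; have := coord_le_norm b i.
rewrite !ler_norml => /andP[? ?] /andP[? ?].
have := normr_ge0 a; have := normr_ge0 b.
move=> ? ?; apply/andP; split; lra.
Qed.

Lemma bump_test a b n : test_function (bump a b n).
Proof.
apply/test_functionP; split; last by exists (`|a| + `|b| + 1) => x; exact: bump_support.
move=> k; apply: Ck_prod => i; set c : R := n.+1%:R.
apply: CkM.
  rewrite (_ : (fun x => _) = fun x : E => flat 1 (c ^+ 2 * x 0 i + (c - c ^+ 2 * a 0 i))).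
    exact: Ck_flat.
  by apply/funext => x; rewrite /ramp; congr flat; rewrite -/c; ring.
rewrite (_ : (fun x => _) = fun x : E => flat 1 (- c ^+ 2 * x 0 i + (c + c ^+ 2 * b 0 i))).
  exact: Ck_flat.
by apply/funext => x; rewrite /ramp; congr flat; rewrite -/c; ring.
Qed.

Lemma cvg_bigprod (I : Type) (r : seq I) (F : I -> nat -> R) (l : I -> R) :
  (forall i, F i n @[n --> \oo] --> l i) ->
  \prod_(i <- r) F i n @[n --> \oo] --> \prod_(i <- r) l i.
Proof.
move=> H; elim: r => [|i r IH].
  by rewrite big_nil; under eq_fun do rewrite big_nil; exact: cvg_cst.
by rewrite big_cons; under eq_fun do rewrite big_cons; exact: cvgM.
Qed.

Lemma bump_cvg a b x : bump a b n x @[n --> \oo] --> (\1_(cbox a b) x : R).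
Proof.
suff -> : \1_(cbox a b) x = \prod_(i < d) ((0 <= x 0 i - a 0 i)%R%:R * (0 <= b 0 i - x 0 i)%R%:R) :> R.
  by apply: cvg_bigprod => i; apply: cvgM; exact: ramp_cvg.
rewrite indicE; have [|] := pselect (cbox a b x).
  move=> H; rewrite mem_set// big1// => i _.
  by have := H i; rewrite !subr_ge0 => /andP[-> ->]; rewrite mulr1.
move=> H; rewrite memNset//; move/existsNP : H => [i H].
rewrite (bigD1 i)//= !subr_ge0; move/negP : H; rewrite negb_and.
by case/orP => /negbTE ->; rewrite ?mul0r ?mulr0 ?mul0r.
Qed.

End test_functions.

(** * The fundamental lemma of the calculus of variations *)

Section fundamental_lemma.
Context {R : realType} {d : nat}.
Local Notation E := 'rV[R]_d.
Local Notation mu := (@lebesgue_rV R d).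
Implicit Types (w phi psi f : E -> R) (x : E).

Lemma indic_cube_Lfun k : (\1_(cube k) : E -> R) \in Lfun mu 2%:E.
Proof.
apply: (@bounded_support_Lfun _ _ _ 1 k).
  by apply: measurable_indic; exact: measurable_cube.
by move=> x; rewrite mul1r ger0_norm.
Qed.

Lemma Lfun_integrable_mul f w : f \in Lfun mu 2%:E -> w \in Lfun mu 2%:E ->
  mu.-integrable setT (fun x => (f x * w x)%:E).
Proof.
by move=> fL wL; have /Lfun1_integrable := Lfun2_mul_Lfun1 fL wL.
Qed.

Lemma integral_patch_indic (A : set E) w :
  (\int[mu]_(x in A) (w x)%:E = \int[mu]_x (\1_A x * w x)%:E)%E.
Proof.
rewrite integral_mkcond; apply: eq_integral => x _.
by rewrite patchE indicE; case: (x \in A); rewrite ?mul1r ?mul0r.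
Qed.

Lemma Lfun_integrable_cube k w : w \in Lfun mu 2%:E ->
  mu.-integrable (cube k) (fun x => (w x)%:E).
Proof.
move=> wL; apply/(integrable_mkcond _ (measurable_cube k)).
have := Lfun_integrable_mul (indic_cube_Lfun k) wL.
apply: eq_integrable => // x _.
by rewrite patchE indicE; case: (x \in _); rewrite ?mul1r ?mul0r.
Qed.

Lemma integral_cbox_eq0 w (a b : E) : w \in Lfun mu 2%:E ->
  (forall psi, test_function psi -> \int[mu]_x (psi x * w x) = 0) ->
  (\int[mu]_(x in cbox a b) (w x)%:E = 0)%E.
Proof.
move=> wL H; rewrite integral_patch_indic.
have mw : measurable_fun setT w by have /Lfun2P[] := wL.
pose k := (Num.truncn (`|a| + `|b| + 1)).+1.
have L n : mu.-integrable setT (fun x => (bump a b n x * w x)%:E).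
  by apply: Lfun_integrable_mul => //; apply: test_Lfun; exact: bump_test.
have Z n : (\int[mu]_x (bump a b n x * w x)%:E = 0)%E.
  have := H _ (bump_test a b n); rewrite /Rintegral => h.
  by rewrite -[LHS]fineK ?h//; exact: integrable_fin_num (L n).
have : (\int[mu]_x (bump a b n x * w x)%:E)%E @[n --> \oo] -->
    (\int[mu]_x (\1_(cbox a b) x * w x)%:E)%E.
  apply: (@dominated_cvg _ _ _ _ _ _ _ _ (fun x => `|(\1_(cube k) x * w x)%:E|%E)) => //.
  - by move=> n; have := measurable_int _ (L n).
  - move=> x _; apply: cvg_EFin; first exact: nearW.
    apply: cvgM; [exact: bump_cvg|exact: cvg_cst].
  - apply: integrable_abse; apply: Lfun_integrable_mul => //; exact: indic_cube_Lfun.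
  - move=> n x _; rewrite lee_fin !normrM ler_wpM2r//.
    rewrite ger0_norm ?bump_ge0// ger0_norm// indicE.
    have [xk|xk] := pselect (cube k x); first by rewrite mem_set// bump_le1.
    rewrite memNset//.
    have [->//|/bump_support xb] := eqVneq (bump a b n x) 0.
    case: xk; apply/cubeP; apply: le_trans xb _.
    by rewrite ltW// truncnS_gt.
under eq_fun do rewrite Z.
by move/(@cvg_unique _ (@ereal_hausdorff _)) => /(_ _ (cvg_cst _)) ->.
Qed.

(** Boxes are stable under intersection and generate the Borel sets, so vanishing integrals over
    boxes spread to every Borel set inside a cube. *)
Lemma fundamental_lemma w : w \in Lfun mu 2%:E ->
  (forall psi, test_function psi -> \int[mu]_x (psi x * w x) = 0) ->
  {ae mu, forall x, w x = 0}.
Proof.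
move=> wL H.
have mw : measurable_fun setT w by have /Lfun2P[] := wL.
(* Intersecting with cubes makes the integrals finite: a square-integrable [w] is integrable on
   bounded sets, but perhaps not on the whole space. *)
pose P (A : set E) := forall k, (\int[mu]_(x in A `&` cube k) (w x)%:E = 0)%E.
have mwA (A : set E) : measurable_fun A (fun x => (w x)%:E).
  by apply/measurable_EFinP; exact: measurable_funTS.
have PA : forall A, <<s cboxes >> A -> P A.
  apply: (@dynkin_induction _ E) => //.
  - exact: measurable_cboxes.
  - by move=> _ _ [a [b ->]] [a' [b' ->]]; have [a'' [b'' ->]] := cboxI a b a' b';
      exists a'', b''.
  - by move=> k; rewrite setTI; exact: integral_cbox_eq0.
  - move=> _ [a [b ->]] k; rewrite /cube.
    by have [a' [b' ->]] := cboxI a b (const_mx (- k%:R)) (const_mx k%:R);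
      exact: integral_cbox_eq0.
  - move=> S mS PS k.
    have mk := measurable_cube k : measurable (cube k : set E).
    have : (\int[mu]_(x in cube k) (w x)%:E = 0)%E by exact: integral_cbox_eq0.
    rewrite -{1}[cube k]setTI -(setUv S) setIUl integral_setU//.
    + by rewrite PS add0e.
    + exact: measurableI.
    + by apply: measurableI => //; exact: measurableC.
    + apply/disj_setPS => x [[Sx _] [nSx _]]; exact: nSx.
  - move=> F mF tF PF k.
    have mk := measurable_cube k : measurable (cube k : set E).
    rewrite setI_bigcupl integral_bigcup//.
    + by apply: eseries0 => i _ _; exact: PF.
    + by apply: trivIset_setIr.
    + by move=> i; exact: measurableI.
    + rewrite -setI_bigcupl; apply: integrableS (Lfun_integrable_cube k wL) => //.
      by apply: measurableI => //; exact: bigcupT_measurable.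
have ae k : ae_eq mu (cube k) (fun x => (w x)%:E) (cst 0%E).
  apply: integral_ae_eq => //; first exact: measurable_cube.
    exact: Lfun_integrable_cube.
  move=> A Ak mA; rewrite integral0 -[RHS](PA A _ k); last by rewrite -measurable_cboxes.
  by rewrite setIidl.
have := ae_foralln ae; apply: filterS => x Hx.
have : (\bigcup_k cube k) x by rewrite bigcup_cube.
by move=> [k _ xk]; have [] := Hx k xk.
Qed.

End fundamental_lemma.

(** * Translation estimates from weak derivatives *)

Section translation.
Context {R : realType} {d : nat}.
Local Notation E := 'rV[R]_d.
Local Notation mu := (@lebesgue_rV R d).
Local Notation L := (LfunType mu (lee1n 2)).
Local Notation toL := (Lfun_Sub (lee1n 2)).

Lemma ip_complete : complete_form (ip mu).
Proof.
by move=> f C fC; have [g [fg _]] := L2_fast_cauchy fC; exists g.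
Qed.

Definition real_weak_partial (i : 'I_d) (p g : E -> R) := forall phi : E -> R,
  test_function phi ->
  \int[mu]_x ('D_(evec i) phi x * p x) = - \int[mu]_x (phi x * g x).

Lemma shift_Lfun (h : E) (f : E -> R) : f \in Lfun mu 2%:E ->
  (fun x => f (x + h)) \in Lfun mu 2%:E.
Proof.
move=> /Lfun2P[mf /integrableP[mf2 fi]]; apply/Lfun2P.
have mfh : measurable_fun setT (fun x : E => f (x + h)).
  exact: measurableT_comp (measurable_shift h).
split => //; apply/integrableP; split.
  by apply/measurable_EFinP; exact: measurable_funX.
rewrite (ge0_integral_shift h (f := fun x : E => `|(f x ^+ 2)%:E|%E))//.
exact: measurableT_comp.
Qed.

Lemma Rintegral_shift (h : E) (f : E -> R) : mu.-integrable setT (fun x => (f x)%:E) ->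
  \int[mu]_x f (x + h) = \int[mu]_x f x.
Proof.
move=> /integrableP[mf fi].
rewrite /Rintegral; congr fine.
have mS : measurable_fun setT (fun x : E => x + h) by exact: measurable_shift.
rewrite [RHS](@eq_measure_integral _ _ _ _
  (measure_function_pushforward__canonical__measure_function_Measure mu mS)).
  rewrite [RHS](@integral_pushforward _ _ _ _ R _ mS mu setT)// ?preimage_setT//.
  apply/integrableP; split; first exact: measurableT_comp mS.
  have mfa : measurable_fun setT (fun x : E => `|(f x)%:E|%E) by exact: measurableT_comp.
  by rewrite (ge0_integral_shift h mfa).
move=> A mA _ /=; apply/esym; exact: (lebesgue_shift h mA).
Qed.

Definition shiftL (h : E) (f : L) : L := toL (shift_Lfun h (LfunP f)).

Lemma seminorm_shiftL h (f : L) : seminorm (ip mu) (shiftL h f) = seminorm (ip mu) f.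
Proof.
congr Num.sqrt; apply: EFin_inj; rewrite !EFin_ip.
apply: (ge0_integral_shift h (f := fun x : E => (f x ^+ 2)%:E)).
  by apply/measurable_EFinP/measurable_funX; exact: L2_measurable.
by move=> x; rewrite lee_fin sqr_ge0.
Qed.

Lemma norm_ip_le (f g : L) : `|ip mu f g| <= seminorm (ip mu) f * seminorm (ip mu) g.
Proof.
rewrite -(@ler_pXn2r _ 2) ?nnegrE ?mulr_ge0 ?seminorm_ge0//.
by rewrite exprMn !sqr_seminorm real_normK ?num_real// form_CS.
Qed.

Section test_orbit.
Variables (psi : E -> R) (tpsi : test_function psi) (i : 'I_d) (p : L).

Let f (s : R) (x : E) := psi (x + s *: (evec i : E)) * p x.

Let tshift s : test_function (fun x : E => psi (x + s *: (evec i : E))).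
Proof. exact: test_shift. Qed.

Let df s (x : E) :
  is_derive s (1 : R) (f ^~ x) ('D_(evec i) psi (x + s *: (evec i : E)) * p x).
Proof.
have /test_functionP[C _] := tpsi.
have D := Ck_derivable (C 1%N) i (x + s *: (evec i : E)).
have Q : (fun h : R => h^-1 *: (((fun s : R => psi (x + s *: (evec i : E))) \o shift s)
     (h *: (1 : R)) - psi (x + s *: (evec i : E)))) =
   (fun h : R => h^-1 *: ((psi \o shift (x + s *: (evec i : E))) (h *: (evec i : E)) -
     psi (x + s *: (evec i : E)))).
  apply/funext => h /=; congr (_ *: (psi _ - _)).
  by rewrite [h *: (1 : R)]mulr1 scalerDl addrCA.
have D1 : is_derive s (1 : R) (fun s : R => psi (x + s *: (evec i : E)))
    ('D_(evec i) psi (x + s *: (evec i : E))).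
  by apply: DeriveDef; rewrite /derivable /derive Q.
have D2 : is_derive s (1 : R) (cst (p x) : R -> R) 0 by exact: is_derive_cst.
apply: is_derive_eq (is_deriveM D1 D2) _.
by rewrite scaler0 add0r /GRing.scale/= mulrC.
Qed.

Let F (s : R) := \int[mu]_x f s x.

Lemma test_orbit_derive s : is_derive s (1 : R) F
  (\int[mu]_x ('D_(evec i) psi (x + s *: (evec i : E)) * p x)).
Proof.
have [B [k HB]] := test_supportP (test_derive i tpsi).
(* For parameters within [1] of [s] the translated support stays in [cube K], which yields one
   dominating function. *)
pose K := (k + (Num.truncn (`|s| + 1)).+1)%N.
pose G x := `|B| * `|\1_(cube K) x * p x|.
have Is : `]s - 1, s + 1[%classic s.
  by rewrite /= in_itv/= ltrBlDr ltrDl ltr01.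
have I1 x : `]s - 1, s + 1[%classic x -> mu.-integrable setT (EFin \o f x).
  move=> _; exact: Lfun_integrable_mul (test_Lfun (tshift x)) (LfunP p).
have I2 x y : `]s - 1, s + 1[%classic x -> setT y -> derivable (f ^~ y) x 1.
  by move=> _ _; have [] := df x y.
have G0 y : 0 <= G y by rewrite mulr_ge0.
have GI : mu.-integrable setT (EFin \o G).
  apply: (@integrableZl _ _ _ _ _ measurableT `|B| (fun x => (`|\1_(cube K) x * p x|)%:E)).
  have := integrable_abse (Lfun_integrable_mul (indic_cube_Lfun K) (LfunP p)).
  exact: eq_integrable.
have HG x y : `]s - 1, s + 1[%classic x -> setT y -> `|partial1of2 f x y| <= G y.
  rewrite /= in_itv/= => /andP[x1 x2] _; rewrite partial1of2E.
  have [_ ->] := df x y; rewrite /G !normrM mulrA ler_wpM2r//.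
  apply: le_trans (HB _) _; rewrite (ger0_norm (x := \1_(cube K) y))// !indicE.
  have [yk|yk] := pselect (cube k (y + x *: (evec i : E))); last first.
    by rewrite memNset// mulr0 mulr_ge0.
  rewrite mem_set// mulr1 mem_set ?mulr1 ?ler_norm//.
  move/cubeP : yk => yk; apply/cubeP.
  rewrite -[y](addrK (x *: (evec i : E))); apply: le_trans (ler_normB _ _) _.
  rewrite /K natrD; apply: lerD => //.
  apply: (@le_trans _ _ (`|s| + 1)); last by rewrite ltW// truncnS_gt.
  apply/rV_norm_leP; first by rewrite addr_ge0.
  move=> j; rewrite !mxE eqxx/= normrM.
  apply: (@le_trans _ _ `|x|).
    by rewrite ler_piMr//; case: (_ == _); rewrite /= ?normr1 ?normr0.
  rewrite ler_norml; apply/andP; split.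
    by have := ler_norm (- s); rewrite normrN; lra.
  by have := ler_norm s; lra.
have H1 := derivable_under_integral measurableT Is I1 I2 G0 GI HG.
have H2 := differentiation_under_integral measurableT Is I1 I2 G0 GI HG.
apply: DeriveDef; first exact: H1.
rewrite -derive1E H2; apply: eq_Rintegral => x _.
by rewrite partial1of2E; have [_ ->] := df s x.
Qed.

(** The orbit moves the test function and not [p], so it is differentiable. The weak derivative
    identity turns its derivative into a product with [g], bounded uniformly in [s] because
    translations are isometries. *)
Lemma test_orbit_lipschitz (g : L) t : real_weak_partial i p g ->
  `|F t - F 0| <= `|t| * (seminorm (ip mu) g * seminorm (ip mu) (toL (test_Lfun tpsi))).
Proof.
move=> wpg; set C := seminorm _ g * _.
have dF s : is_derive s (1 : R) F
    (- \int[mu]_x (psi (x + s *: (evec i : E)) * g x)).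
  apply: is_derive_eq (test_orbit_derive s) _.
  have := wpg _ (tshift s) => <-; apply: eq_Rintegral => x _.
  by rewrite derive_shift.
have dFC s : `| - \int[mu]_x (psi (x + s *: (evec i : E)) * g x)| <= C.
  rewrite normrN /C mulrC.
  have := norm_ip_le (shiftL (s *: (evec i : E)) (toL (test_Lfun tpsi))) g.
  by rewrite seminorm_shiftL.
have cF : continuous F by apply: continuous_is_derive => s; exact: dF.
have H a b : a <= b -> `|F b - F a| <= (b - a) * C.
  move=> ab.
  have cab : {within `[a, b], continuous F} by exact: continuous_subspaceT cF.
  have [c _ ->] := MVT_segment ab (fun s _ => dF s) cab.
  by rewrite normrM mulrC (ger0_norm (x := b - a)) ?subr_ge0// ler_wpM2l// subr_ge0.
have [t0|t0] := leP 0 t.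
  by have := H _ _ t0; rewrite subr0 (ger0_norm t0).
by have := H _ _ (ltW t0); rewrite distrC sub0r (ltr0_norm t0).
Qed.

End test_orbit.

(** Pairing the increment of [p] with [psi] gives an increment of the orbit of [psi], and pairings
    with test functions determine the norm. *)
Lemma translation_coord (i : 'I_d) (p g : L) t : real_weak_partial i p g ->
  seminorm (ip mu) (shiftL (t *: (evec i : E)) p - p) <= `|t| * seminorm (ip mu) g.
Proof.
move=> wpg; pose S (f : L) := test_function (f : E -> R).
apply: (@form_dense_bound _ _ (ip mu) S).
- exact: ip_complete.
- apply/test_functionP; split; first by move=> k; exact: Ck_cst.
  by exists 0 => x; rewrite eqxx.
- by move=> a u v Su Sv; exact: testD.
- move=> u uS; rewrite /seminorm.
  suff -> : ip mu u u = 0 by rewrite sqrtr0.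
  have u0 : {ae mu, forall x, u x = (0 : L) x}.
    apply: fundamental_lemma; first exact: LfunP.
    by move=> psi tpsi; have := uS (toL (test_Lfun tpsi)) tpsi; rewrite formC.
  by rewrite (ip_ae _ u0) formC linear0.
- move=> psi tpsi.
  (* Translating [p] by [t] amounts, under the integral, to translating [psi] by [-t]. *)
  have := test_orbit_lipschitz tpsi (- t) wpg.
  rewrite normrN mulrA.
  rewrite (_ : toL _ = psi); last by apply/LfuneqP.
  apply: le_trans; apply: le_trans (ler_norm _).
  rewrite formBl le_eqVlt; apply/orP; left; apply/eqP; congr (_ - _).
    rewrite ipE.
    have I1 : mu.-integrable setT
        (fun x => (psi (x - t *: (evec i : E)) * p x)%:E).
      exact: L2_mul_integrable (shiftL (- (t *: (evec i : E))) psi) p.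
    rewrite [RHS](_ : _ = \int[mu]_x (psi (x - t *: (evec i : E)) * p x)).
      rewrite -(Rintegral_shift (t *: (evec i : E)) I1).
      by apply: eq_Rintegral => x _ /=; rewrite addrK mulrC.
    by apply: eq_Rintegral => x _; rewrite scaleNr.
  rewrite ipE; apply: eq_Rintegral => x _.
  by rewrite scale0r addr0 mulrC.
- by rewrite mulr_ge0 ?seminorm_ge0.
Qed.

Lemma translation_le (p : L) (g : 'I_d -> L) (h : E) :
  (forall i, real_weak_partial i p (g i)) ->
  seminorm (ip mu) (shiftL h p - p) <= `|h| * \sum_i seminorm (ip mu) (g i).
Proof.
move=> wpg.
(* Subadditivity in the shift lets the coordinate directions be treated one at a time. *)
have sD (a b : E) : seminorm (ip mu) (shiftL (a + b) p - p) <=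
    seminorm (ip mu) (shiftL a p - p) + seminorm (ip mu) (shiftL b p - p).
  rewrite (_ : shiftL (a + b) p - p = shiftL b (shiftL a p - p) + (shiftL b p - p)).
    by apply: le_trans (seminormD _ _ _) _; rewrite seminorm_shiftL.
  apply/LfuneqP => x; rewrite -[LHS]/(p (x + (a + b)) - p x).
  rewrite -[RHS]/((p (x + b + a) - p (x + b)) + (p (x + b) - p x)).
  have -> : x + (a + b) = x + b + a by rewrite addrAC addrA.
  ring.
suff : seminorm (ip mu) (shiftL h p - p) <= \sum_i `|h 0 i| * seminorm (ip mu) (g i).
  move=> H; apply: le_trans H _; rewrite mulr_sumr; apply: ler_sum => i _.
  by rewrite ler_wpM2r ?seminorm_ge0// coord_le_norm.
rewrite {1}[h]row_sum_delta.
elim/big_ind2: _ => [|a b c e ab ce|i _].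
- rewrite (_ : shiftL 0 p - p = 0); first by rewrite /seminorm linear0 sqrtr0.
  by apply/LfuneqP => x; rewrite -[LHS]/(p (x + 0) - p x) addr0 subrr.
- by apply: le_trans (sD _ _) _; exact: lerD.
- exact: translation_coord.
Qed.

End translation.

(** * Poincare inequalities on cells *)

Section cells.
Context {R : realType} {d : nat}.
Local Notation E := 'rV[R]_d.
Local Notation mu := (@lebesgue_rV R d).
Local Notation L := (LfunType mu (lee1n 2)).
Local Notation toL := (Lfun_Sub (lee1n 2)).
Variables (c : R) (c0 : 0 < c).

(** Half-open, so that the cells around the lattice points [center] tile the space. *)
Definition cell (y : E) : set E :=
  [set x | forall i, y 0 i - c <= x 0 i < y 0 i + c].

Lemma measurable_cell y : measurable (cell y).
Proof.
rewrite (_ : cell y = \bigcap_(i in [set: 'I_d])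
    ((fun x : E => x 0 i) @^-1` `[y 0 i - c, y 0 i + c[)).
  apply: fin_bigcap_measurable => // i _.
  by rewrite -[X in measurable X]setTI; apply: measurable_coord.
apply/seteqP; split => [x h i _|x h i]; first by rewrite /= in_itv/=.
by have := h i I; rewrite /= in_itv.
Qed.

Lemma lebesgue_cell y : mu (cell y) = mu (cell 0).
Proof.
rewrite -(lebesgue_shift (- y) (measurable_cell 0)); congr (mu _).
apply/seteqP; split => x /= H i; have := H i; rewrite !mxE;
  by rewrite sub0r add0r ltrBlDr lerBrDr [- c + _]addrC [c + _]addrC.
Qed.

Lemma cell_cbox y : cbox (y - const_mx (c / 2)) (y + const_mx (c / 2)) `<=` cell y.
Proof.
move=> x H i; have := H i; rewrite !mxE => /andP[h1 h2].
apply/andP; split; move: c0 h1 h2; lra.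
Qed.

Lemma cell_sub_cbox y : cell y `<=` cbox (y - const_mx c) (y + const_mx c).
Proof.
by move=> x H i; have := H i; rewrite !mxE => /andP[-> /ltW ->].
Qed.

Lemma lebesgue_cell_lty y : (mu (cell y) < +oo)%E.
Proof.
apply: le_lt_trans (lebesgue_cbox_lty (y - const_mx c) (y + const_mx c)).
apply: le_measure; rewrite ?inE; [exact: measurable_cell|exact: measurable_cbox|].
exact: cell_sub_cbox.
Qed.

Definition cell_vol : R := fine (mu (cell 0)).

Lemma cell_volE y : mu (cell y) = cell_vol%:E.
Proof. by rewrite lebesgue_cell /cell_vol fineK// ge0_fin_numE// lebesgue_cell_lty. Qed.

Lemma cell_vol_gt0 : 0 < cell_vol.
Proof.
rewrite -lte_fin -(cell_volE 0).
have H := le_measure mu (mem_set (measurable_cbox _ _)) (mem_set (measurable_cell 0))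
  (@cell_cbox 0).
apply: lt_le_trans H.
rewrite [ltRHS]lebesgue_cbox => [|i]; last by rewrite !mxE; move: c0; lra.
rewrite lte_fin prodr_gt0// => i _; rewrite !mxE; move: c0; lra.
Qed.

Lemma cell_diff (y x h : E) : cell y x -> cell y (h + x) ->
  cbox (const_mx (- (2 * c))) (const_mx (2 * c)) h.
Proof.
move=> H1 H2 i; have := H1 i; have := H2 i; rewrite !mxE => /andP[? ?] /andP[? ?].
apply/andP; split; lra.
Qed.

Section oscillation.
Variable p : L.
Let B : set E := cbox (const_mx (- (2 * c))) (const_mx (2 * c)).

(** Differences of two points of one cell lie in [B], so [osc] dominates the oscillation within the
    cell. Being defined by shifts alone, it has an integral over the whole space that translation
    estimates control. *)
Definition osc (x : E) : \bar R :=
  (\int[mu]_h (\1_B h * (p (h + x) - p x) ^+ 2)%:E)%E.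

Let mB : measurable B. Proof. exact: measurable_cbox. Qed.

Let oscf (z : E * E) : \bar R := (\1_B z.2 * (p (z.2 + z.1) - p z.1) ^+ 2)%:E.

Let oscf_ge0 z : (0 <= oscf z)%E.
Proof. by rewrite lee_fin mulr_ge0 ?sqr_ge0. Qed.

Let measurable_oscf : measurable_fun setT oscf.
Proof.
have m1 : measurable_fun setT (fun z : E * E => p z.1).
  exact: measurableT_comp (L2_measurable p) measurable_fst.
have m2 : measurable_fun setT (fun z : E * E => p (z.2 + z.1)).
  apply: measurableT_comp (L2_measurable p) _; apply: measurable_rV => i.
  under eq_fun do rewrite mxE.
  by apply: measurable_funD; [exact: measurableT_comp (measurable_coord i) measurable_snd|
    exact: measurableT_comp (measurable_coord i) measurable_fst].
apply/measurable_EFinP; apply: measurable_funM.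
  exact: measurableT_comp (measurable_indic mB) measurable_snd.
by apply: measurable_funX; exact: measurable_funB.
Qed.

Lemma measurable_osc : measurable_fun setT osc.
Proof. exact: (measurable_fun_fubini_tonelli_F (m2 := mu) oscf measurable_oscf oscf_ge0). Qed.

Lemma osc_ge0 x : (0 <= osc x)%E.
Proof. by apply: integral_ge0 => h _; rewrite lee_fin mulr_ge0 ?sqr_ge0. Qed.

(** After the integrals are exchanged, [(4 * c) ^+ d] is the volume of [B] and [2 * c] bounds the
    norm of its shifts. *)
Lemma integral_osc (S : R) : 0 <= S ->
  (forall h, seminorm (ip mu) (shiftL h p - p) <= `|h| * S) ->
  (\int[mu]_x osc x <= ((4 * c) ^+ d * (2 * c * S) ^+ 2)%:E)%E.
Proof.
move=> S0 HS.
have -> : (\int[mu]_x osc x = \int[mu]_h \int[mu]_x oscf (x, h))%E.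
  exact: (fubini_tonelli (m1 := mu) (m2 := mu) oscf measurable_oscf oscf_ge0).
apply: (@le_trans _ _ (\int[mu]_h (\1_B h * (2 * c * S) ^+ 2)%:E)%E).
  apply: ge0_le_integral => //.
  - by move=> h _; exact: integral_ge0.
  - exact: (measurable_fun_fubini_tonelli_G (m1 := mu) oscf measurable_oscf oscf_ge0).
  - by apply/measurable_EFinP; apply: measurable_funM => //; exact: measurable_indic.
  move=> h _; rewrite /oscf/=.
  have [Bh|Bh] := pselect (B h); last first.
    rewrite indicE memNset// mul0r; under eq_integral do rewrite mul0r.
    by rewrite integral0.
  rewrite indicE mem_set// mul1r; under eq_integral do rewrite mul1r.
  rewrite (eq_integral (fun x => ((shiftL h p - p : L) x ^+ 2)%:E)); last first.
    by move=> x _; rewrite [h + x]addrC.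
  rewrite -(EFin_ip (shiftL h p - p)) lee_fin -sqr_seminorm.
  rewrite ler_pXn2r ?nnegrE ?seminorm_ge0 ?mulr_ge0 ?(ltW c0)//.
  apply: le_trans (HS h) _; rewrite ler_wpM2r//.
  apply/rV_norm_leP; first by rewrite mulr_ge0 ?(ltW c0).
  by move=> i; have := Bh i; rewrite !mxE -ler_norml.
under eq_integral do rewrite mulrC EFinM.
rewrite ge0_integralZl//; last 2 first.
- by apply/measurable_EFinP; exact: measurable_indic.
- by rewrite lee_fin sqr_ge0.
rewrite integral_indic// setIT.
rewrite [X in (_ * X)%E](_ : _ = ((4 * c) ^+ d)%:E); last first.
  apply: etrans (lebesgue_cbox _) _ => [i|]; first by rewrite !mxE; move: c0; lra.
  under eq_bigr do rewrite !mxE.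
  rewrite prodr_const card_ord; congr (_ ^+ _)%:E; ring.
by rewrite -EFinM lee_fin mulrC.
Qed.

Lemma osc_ge (y x : E) (A : set E) : cell y x -> measurable A -> A `<=` cell y ->
  (\int[mu]_(z in A) ((p z - p x) ^+ 2)%:E <= osc x)%E.
Proof.
move=> yx mA Ay.
have mf : measurable_fun setT (fun z : E => ((\1_A z * (p z - p x) ^+ 2)%:E)).
  apply/measurable_EFinP; apply: measurable_funM; first exact: measurable_indic.
  by apply: measurable_funX; apply: measurable_funB => //; exact: L2_measurable.
have -> : (\int[mu]_(z in A) ((p z - p x) ^+ 2)%:E =
    \int[mu]_z (\1_A z * (p z - p x) ^+ 2)%:E)%E.
  exact: integral_patch_indic.
rewrite -(ge0_integral_shift x mf) => [|z]; last by rewrite lee_fin mulr_ge0 ?sqr_ge0.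
apply: ge0_le_integral => //.
- by move=> h _; rewrite lee_fin mulr_ge0 ?sqr_ge0.
- by have := measurableT_comp mf (measurable_shift x).
- apply/measurable_EFinP; apply: measurable_funM; first exact: measurable_indic.
  apply: measurable_funX; apply: measurable_funB => //.
  exact: measurableT_comp (L2_measurable p) (measurable_shift x).
move=> h _; rewrite lee_fin ler_wpM2r ?sqr_ge0// !indicE.
have [Ah|Ah] := pselect (A (h + x)); last by rewrite memNset.
by rewrite mem_set// mem_set//; exact: cell_diff yx (Ay _ Ah).
Qed.

Hypothesis osc_lty : (\int[mu]_x osc x < +oo)%E.

Lemma integrable_osc : mu.-integrable setT osc.
Proof.
apply/integrableP; split; first exact: measurable_osc.
by under eq_integral do rewrite gee0_abs ?osc_ge0//.
Qed.

Lemma indic_cell_Lfun y : (\1_(cell y) : E -> R) \in Lfun mu 2%:E.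
Proof.
apply/Lfun2P; split; first by apply: measurable_indic; exact: measurable_cell.
apply: (@eq_integrable _ _ _ _ _ measurableT (fun x => (\1_(cell y) x)%:E)).
  by move=> x _; rewrite indicE; case: (_ \in _); rewrite ?expr1n ?expr0n.
apply/integrableP; split.
  by apply/measurable_EFinP; apply: measurable_indic; exact: measurable_cell.
under eq_integral do rewrite gee0_abs ?lee_fin//.
rewrite integral_indic//; last exact: measurable_cell.
by rewrite setIT; exact: lebesgue_cell_lty.
Qed.

Definition cellL y : L := toL (indic_cell_Lfun y).

Lemma integrable_cell y (f : E -> R) :
  mu.-integrable setT (fun x => (\1_(cell y) x * f x)%:E) ->
  mu.-integrable (cell y) (fun x => (f x)%:E).
Proof.
move=> H; apply/(integrable_mkcond _ (measurable_cell y)).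
apply: eq_integrable H => // x _.
by rewrite patchE indicE; case: (x \in _); rewrite ?mul1r ?mul0r.
Qed.

Lemma integrable_cell_L y (f : L) : mu.-integrable (cell y) (fun x => (f x)%:E).
Proof. by apply: integrable_cell; exact: (L2_mul_integrable (cellL y) f). Qed.

Lemma integrable_cell_sqr y (f : L) : mu.-integrable (cell y) (fun x => (f x ^+ 2)%:E).
Proof.
by apply: integrableS (L2_sqr_integrable f) => //; exact: measurable_cell.
Qed.

Lemma integrable_cell_cst y (a : R) : mu.-integrable (cell y) (fun=> a%:E).
Proof.
apply: (@integrable_cell y (fun=> a)).
under eq_fun do rewrite mulrC EFinM.
apply: integrableZl => //.
have := Lfun_integrable_mul (indic_cell_Lfun y) (indic_cell_Lfun y).
apply: eq_integrable => // x _; rewrite indicE.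
by case: (_ \in _); rewrite ?mulr1 ?mulr0.
Qed.

Lemma integral_cell_cst y (a : R) : (\int[mu]_(x in cell y) a%:E = (a * cell_vol)%:E)%E.
Proof.
rewrite integral_cst; last exact: measurable_cell.
by rewrite EFinM; congr (_ * _)%E; exact: cell_volE.
Qed.

Definition mass y := \int[mu]_(x in cell y) (p x ^+ 2).

Lemma massE y : (mass y)%:E = (\int[mu]_(x in cell y) (p x ^+ 2)%:E)%E.
Proof.
rewrite /mass /Rintegral fineK//.
by apply: integrable_fin_num => //; [exact: measurable_cell|exact: integrable_cell_sqr].
Qed.

Lemma integral_cellL y : \int[mu]_(x in cell y) p x = ip mu (cellL y) p.
Proof.
rewrite ipE /Rintegral; congr fine.
exact: integral_patch_indic.
Qed.

Lemma EFin_cellL y : (ip mu (cellL y) p)%:E = (\int[mu]_(x in cell y) (p x)%:E)%E.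
Proof.
rewrite -integral_cellL /Rintegral fineK//.
by apply: integrable_fin_num => //; [exact: measurable_cell|exact: integrable_cell_L].
Qed.

Lemma mass_ge0 y : 0 <= mass y.
Proof. by apply: Rintegral_ge0 => x _; rewrite sqr_ge0. Qed.

(** Both mass estimates come from a pointwise lower bound of [osc] by a quadratic polynomial in
    [p x], integrated here once for both. *)
Lemma osc_quadratic y (a b e : R) :
  (forall x, cell y x -> ((a * p x ^+ 2 + b * p x + e)%:E <= osc x)%E) ->
  ((a * mass y + b * ip mu (cellL y) p + e * cell_vol)%:E <=
   \int[mu]_(x in cell y) osc x)%E.
Proof.
move=> H.
have my := measurable_cell y.
have I1 := integrableZl my a (integrable_cell_sqr y p).
have I2 := integrableZl my b (integrable_cell_L y p).
have I3 := integrable_cell_cst y e.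
have -> : ((a * mass y + b * ip mu (cellL y) p + e * cell_vol)%:E =
    \int[mu]_(x in cell y) (a * p x ^+ 2 + b * p x + e)%:E)%E.
  under eq_integral do rewrite !EFinD !EFinM.
  rewrite integralD//; last exact: integrableD.
  rewrite integralD//.
  rewrite (integralZl my (integrable_cell_sqr y p)) (integralZl my (integrable_cell_L y p)).
  by rewrite integral_cell_cst -massE !EFinD !EFinM -EFin_cellL.
apply: le_integral => //.
- apply: eq_integrable (integrableD my (integrableD my I1 I2) I3) => //.
- exact: integrableS integrable_osc.
- by move=> x; rewrite inE; exact: H.
Qed.

(** The variance identity: the double integral of [(p z - p x) ^+ 2] over a cell is twice
    [cell_vol * mass] minus twice the squared integral of [p]. *)
Lemma mass_near y : ((mass y)%:E <= ((2 * cell_vol)^-1)%:E * \int[mu]_(x in cell y) osc x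
    + (cell_vol^-1 * ip mu (cellL y) p ^+ 2)%:E)%E.
Proof.
have v0 := cell_vol_gt0.
pose I1 := ip mu (cellL y) p.
have : ((cell_vol * mass y + (- (2 * I1)) * I1 + mass y * cell_vol)%:E <=
   \int[mu]_(x in cell y) osc x)%E.
  apply: osc_quadratic => x yx.
  apply: le_trans (osc_ge yx (measurable_cell y) (@subset_refl _ _)).
  have my := measurable_cell y.
  have J1 := integrable_cell_sqr y p.
  have J2 := integrableZl my (- (2 * p x)) (integrable_cell_L y p).
  have J3 := integrable_cell_cst y (p x ^+ 2).
  have -> : (\int[mu]_(z in cell y) ((p z - p x) ^+ 2)%:E =
     \int[mu]_(z in cell y) ((p z ^+ 2)%:E + (- (2 * p x))%:E * (p z)%:E + (p x ^+ 2)%:E))%E.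
    by apply: eq_integral => z _; rewrite -EFinM -!EFinD; congr EFin; ring.
  rewrite integralD//; last exact: integrableD.
  rewrite integralD// (integralZl my (integrable_cell_L y p)).
  rewrite integral_cell_cst -massE.
  rewrite -EFin_cellL -/I1.
  by rewrite -!EFinM -!EFinD lee_fin le_eqVlt; apply/orP; left; apply/eqP; ring.
set O := (\int[mu]_(x in cell y) osc x)%E => H.
have Of : O \is a fin_num.
  apply: integrable_fin_num; first exact: measurable_cell.
  by apply: integrableS integrable_osc => //; exact: measurable_cell.
move: H; rewrite -(fineK Of) -EFinM -EFinD !lee_fin -/I1 => H.
rewrite (_ : cell_vol^-1 * I1 ^+ 2 = (2 * cell_vol)^-1 * (2 * I1 ^+ 2)); last first.
  by field; rewrite gt_eqF.
rewrite -mulrDr mulrC ler_pdivlMr ?mulr_gt0//.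
move: H; rewrite expr2; lra.
Qed.

(* On [F], [p ^ 2] is at most a quarter of its mean over the cell, so that
   [(p(x) - p(z)) ^ 2], averaged over [z] in [F], controls [p(x) ^ 2]. *)
Lemma mass_far y (F : set E) (a k : R) : 0 < k -> measurable F -> F `<=` cell y ->
  (forall x, F x -> p x ^+ 2 <= a) -> a * (4 * cell_vol) = mass y ->
  (k%:E <= mu F)%E ->
  ((mass y)%:E <= (4 / k)%:E * \int[mu]_(x in cell y) osc x)%E.
Proof.
move=> k0 mF Fy Fa am kF; have v0 := cell_vol_gt0.
have a0 : 0 <= a.
  by have := mass_ge0 y; rewrite -am pmulr_lge0// mulr_gt0.
have muF : mu F \is a fin_num.
  rewrite ge0_fin_numE//; apply: le_lt_trans (lebesgue_cell_lty y).
  by apply: le_measure => //; rewrite ?inE//; exact: measurable_cell.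
pose f := fine (mu F).
have kf : k <= f by rewrite -lee_fin fineK.
(* Since [a * cell_vol] is a quarter of the mass, the left-hand side is [f / 4 * mass y]; hence the
   constant [4 / k]. *)
have : ((f / 2 * mass y + 0 * ip mu (cellL y) p + (- (f * a)) * cell_vol)%:E <=
   \int[mu]_(x in cell y) osc x)%E.
  apply: osc_quadratic => x yx.
  have [neg|pos] := ltP (p x ^+ 2 / 2 - a) 0.
    apply: le_trans (osc_ge0 x); rewrite lee_fin.
    have : f * (p x ^+ 2 / 2 - a) <= 0.
      by rewrite pmulr_rle0 ?ltW// (lt_le_trans k0).
    lra.
  apply: le_trans (osc_ge yx mF Fy).
  rewrite (_ : _%:E = \int[mu]_(z in F) (p x ^+ 2 / 2 - a)%:E)%E; last first.
    rewrite integral_cst// [X in (_ * X)%E](_ : _ = f%:E); last by rewrite /f fineK.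
    by rewrite -EFinM; congr EFin; ring.
  apply: ge0_le_integral => //.
    apply/measurable_EFinP; apply: measurable_funX; apply: measurable_funB => //.
    by apply: measurable_funTS; exact: L2_measurable.
  (* [(p z - p x) ^+ 2 >= p x ^+ 2 / 2 - p z ^+ 2], and [p z ^+ 2 <= a] on [F]. *)
  move=> z Fz; rewrite lee_fin; have := Fa z Fz; have := sqr_ge0 (p x - 2 * p z).
  nra.
set O := (\int[mu]_(x in cell y) osc x)%E => H.
have Of : O \is a fin_num.
  apply: integrable_fin_num; first exact: measurable_cell.
  by apply: integrableS integrable_osc => //; exact: measurable_cell.
move: H; rewrite -(fineK Of) -EFinM !lee_fin => H.
rewrite mulrAC ler_pdivlMr//.
apply: (@le_trans _ _ (mass y * f)); first by rewrite ler_wpM2l// mass_ge0.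
move: H; rewrite -am mul0r addr0; lra.
Qed.

End oscillation.
End cells.

(** * The lattice tiling of space by cells *)

Section cell_partition.
Context {R : realType} {d : nat}.
Local Notation E := 'rV[R]_d.
Local Notation mu := (@lebesgue_rV R d).
Local Notation L := (LfunType mu (lee1n 2)).
Variables (c : R) (c0 : 0 < c).

Definition center (k : 'rV[int]_d) : E := \row_i ((k 0 i)%:~R * (2 * c)).

(** Lattice points are listed by their codes, since countable additivity is indexed by [nat]; a
    number that codes no lattice point gets the empty set. *)
Definition cell_seq (n : nat) : set E :=
  if @pickle_inv 'rV[int]_d n is Some k then cell c (center k) else set0.

Lemma cell_center_inj k k' x : cell c (center k) x -> cell c (center k') x -> k = k'.
Proof.
move=> H H'; apply/rowP => i; have := H i; have := H' i; rewrite !mxE.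
have cc : 0 < 2 * c by rewrite mulr_gt0.
have key (a b : int) (z : R) : a%:~R * (2 * c) - c <= z -> z < b%:~R * (2 * c) + c ->
    (a <= b)%R.
  move=> h1 h2; rewrite -ltzD1 -(ltr_int R) intrD mulr1z.
  by rewrite -(ltr_pM2r cc) mulrDl mul1r; lra.
move=> /andP[h1 h2] /andP[h3 h4]; apply/eqP; rewrite eq_le.
by rewrite (key _ _ _ h3 h2) (key _ _ _ h1 h4).
Qed.

Lemma measurable_cell_seq n : measurable (cell_seq n).
Proof.
by rewrite /cell_seq; case: pickle_inv => [k|]; [exact: measurable_cell|exact: measurable0].
Qed.

Lemma trivIset_cell_seq : trivIset setT cell_seq.
Proof.
move=> n n' _ _; rewrite /cell_seq.
have := @pickle_invK 'rV[int]_d n; have := @pickle_invK 'rV[int]_d n'.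
case: pickle_inv => [k'|]; case: pickle_inv => [k|] /=; rewrite ?set0I ?setI0;
  try by move=> _ _ [].
by move=> <- <- [x [kx k'x]]; rewrite (cell_center_inj kx k'x).
Qed.

Lemma bigcup_cell_seq : \bigcup_n cell_seq n = setT.
Proof.
apply/seteqP; split => // x _.
pose k : 'rV[int]_d := \row_i Num.floor ((x 0 i + c) / (2 * c)).
exists (pickle k) => //; rewrite /cell_seq pickleK_inv => i; rewrite !mxE.
have cc : 0 < 2 * c by rewrite mulr_gt0.
have /andP[] := floor_itv ((x 0 i + c) / (2 * c)).
rewrite ler_pdivlMr// ltr_pdivrMr// intrD mulr1z => h1 h2.
apply/andP; split; lra.
Qed.

Lemma near_centers_finite (M : R) : exists K : nat, forall n k,
  @pickle_inv 'rV[int]_d n = Some k -> enorm (center k) <= M -> (n < K)%N.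
Proof.
have cc : 0 < 2 * c by rewrite mulr_gt0.
pose B := (Num.truncn (`|M| / (2 * c))).+1.
pose f (g : {ffun 'I_d -> 'I_(2 * B).+1}) : 'rV[int]_d := \row_i ((g i : nat)%:Z - B%:Z).
have fin : finite_set (range f) by apply: finite_image; exact: finite_finset.
have /finite_seqP[s sE] := fin.
(* The sum exceeds each single code. *)
exists (\sum_(k <- s) (pickle k).+1)%N => n k nk kM.
have : range f k.
  have kB i : `|k 0 i| <= B%:Z.
    have H : `|center k 0 i| <= M.
      apply: le_trans kM; rewrite /enorm -sqrtr_sqr ler_wsqrtr// (bigD1 i)//=.
      by rewrite lerDl sumr_ge0// => j _; rewrite sqr_ge0.
    move: H; rewrite mxE normrM (ger0_norm (ltW cc)) -ler_pdivlMr// => H.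
    rewrite -(ler_int R) intr_norm; apply: le_trans H _.
    apply: (@le_trans _ _ (`|M| / (2 * c))).
      by rewrite ler_wpM2r ?invr_ge0 ?(ltW cc)// ler_norm.
    by rewrite ltW// truncnS_gt.
  exists [ffun i => inord (absz (k 0 i + B%:Z))] => //.
  apply/rowP => i; rewrite mxE ffunE.
  have := kB i; rewrite ler_norml => /andP[h1 h2].
  have p0 : 0 <= k 0 i + B%:Z by lia.
  rewrite inordK; first by rewrite gez0_abs// addrK.
  by rewrite ltnS; lia.
rewrite sE /= => ks.
have := @pickle_invK 'rV[int]_d n; rewrite nk /= => <-.
by rewrite (big_rem k)//= ltn_addr.
Qed.

End cell_partition.

Section poincare.
Context {R : realType} {d : nat}.
Local Notation E := 'rV[R]_d.
Local Notation mu := (@lebesgue_rV R d).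
Local Notation L := (LfunType mu (lee1n 2)).
Variables (V : E -> R).
Hypothesis mV : measurable_fun setT V.
Hypothesis V0 : {ae mu, forall x, 0 <= V x}.
Variables (c : R) (c0 : 0 < c).

Local Notation vol := (@cell_vol R d c).

Lemma measurable_sqrt : measurable_fun setT (@Num.sqrt R).
Proof. by apply: continuous_measurable_fun; exact: sqrt_continuous. Qed.

Definition sqrtV_multiple (p s : E -> R) := {ae mu, forall x, s x = Num.sqrt (V x) * p x}.

Lemma mass_far_potential (p s : L) (y : E) (D : set E) (gam k M : R) :
  (\int[mu]_x osc c p x < +oo)%E ->
  sqrtV_multiple p s -> measurable D -> D `<=` cell c y ->
  0 < k -> (k%:E <= gam%:E * mu D)%E -> 0 < M ->
  (forall F, measurable F -> F `<=` D -> (mu F <= gam%:E * mu D)%E ->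
    (M%:E <= \int[mu]_(x in D `\` F) (V x)%:E)%E) ->
  ((mass c p y)%:E <= (4 / k)%:E * \int[mu]_(x in cell c y) osc c p x +
    (4 * vol / M)%:E * \int[mu]_(x in cell c y) (s x ^+ 2)%:E)%E.
Proof.
move=> oscoo sp mD Dy k0 kD M0 HF.
have v0 : 0 < vol :> R by exact: (@cell_vol_gt0 R d).
pose a := mass c p y / (4 * vol).
have av : a * (4 * vol) = mass c p y by rewrite divfK// gt_eqF// mulr_gt0.
have a0 : 0 <= a by rewrite divr_ge0 ?mass_ge0// ltW// mulr_gt0.
have osc0 : (0 <= (4 / k)%:E * \int[mu]_(x in cell c y) osc c p x)%E.
  rewrite mule_ge0 ?lee_fin ?divr_ge0 ?(ltW k0)//.
  by apply: integral_ge0 => x _; exact: osc_ge0.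
have s0 : (0 <= (4 * vol / M)%:E * \int[mu]_(x in cell c y) (s x ^+ 2)%:E)%E.
  rewrite mule_ge0 ?lee_fin ?divr_ge0 ?(ltW M0) ?mulr_ge0 ?(ltW v0)//.
  by apply: integral_ge0 => x _; rewrite lee_fin sqr_ge0.
pose F := D `&` [set x | p x ^+ 2 <= a].
have mp : measurable_fun setT (p : E -> R) by exact: L2_measurable.
have mF : measurable F.
  apply: measurable_fun_le => //; apply: measurable_funTS.
  exact: measurable_funX.
have FD : F `<=` D by move=> x [].
(* The threshold [k], common to all cells, lies below [gam * mu D]: an [F] smaller than [k] is
   admissible in [HF], and [p ^+ 2] exceeds [a] on the rest of [D]. *)
have [kF|kF] := leP k%:E (mu F).
  apply: (@le_trans _ _ ((4 / k)%:E * \int[mu]_(x in cell c y) osc c p x)%E).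
    apply: (mass_far c0 oscoo k0 mF _ _ av kF); first by move=> x /FD /Dy.
    by move=> x [].
  by rewrite leeDl.
apply: (@le_trans _ _ ((4 * vol / M)%:E * \int[mu]_(x in cell c y) (s x ^+ 2)%:E)%E);
  last by rewrite leeDr.
have MF := HF F mF FD (le_trans (ltW kF) kD).
have mDF : measurable (D `\` F) by exact: measurableD.
have msq (A : set E) : measurable_fun A (fun x => (s x ^+ 2)%:E).
  by apply/measurable_EFinP/measurable_funX/measurable_funTS; exact: L2_measurable.
(* [V] is nonnegative only a.e.; the square of its root is so everywhere and equals [V] a.e. *)
have mW : measurable_fun setT (fun x => Num.sqrt (V x) ^+ 2).
  apply: measurable_funX; exact: measurableT_comp measurable_sqrt mV.
have h1 : ((a * M)%:E <= \int[mu]_(x in cell c y) (s x ^+ 2)%:E)%E.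
  apply: (@le_trans _ _ (a%:E * \int[mu]_(x in D `\` F) (Num.sqrt (V x) ^+ 2)%:E)%E).
    rewrite EFinM lee_wpmul2l// ?lee_fin//; apply: le_trans MF _.
    rewrite le_eqVlt; apply/orP; left; apply/eqP.
    apply: ae_eq_integral => //.
    - by apply/measurable_EFinP; exact: measurable_funTS.
    - by apply/measurable_EFinP; exact: measurable_funTS.
    by apply: filterS V0 => x Vx _; rewrite sqr_sqrtr.
  apply: (@le_trans _ _ (\int[mu]_(x in D `\` F) (s x ^+ 2)%:E)%E).
    have m1 : measurable_fun (D `\` F) (fun x => (Num.sqrt (V x) ^+ 2)%:E).
      by apply/measurable_EFinP; exact: measurable_funTS.
    have n1 x : (D `\` F) x -> (0 <= (Num.sqrt (V x) ^+ 2)%:E)%E.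
      by move=> _; rewrite lee_fin sqr_ge0.
    rewrite -(ge0_integralZl mu mDF m1 n1) ?lee_fin//.
    apply: ae_ge0_le_integral => //.
    - by move=> x _; rewrite -EFinM lee_fin mulr_ge0 ?sqr_ge0.
    - by apply: measurable_funeM; apply/measurable_EFinP; exact: measurable_funTS.
    - by move=> x _; rewrite lee_fin sqr_ge0.
    apply: filterS sp => x -> [Dx nFx]; rewrite -EFinM lee_fin exprMn mulrC.
    rewrite ler_wpM2l ?sqr_ge0//; apply/ltW; rewrite ltNge; apply/negP => pa.
    exact: nFx.
  apply: ge0_subset_integral => //; first exact: measurable_cell.
  - by move=> x _; rewrite lee_fin sqr_ge0.
  - by move=> x [/Dy].
have vM : 0 < 4 * vol / M by rewrite divr_gt0// mulr_gt0.
apply: (@le_trans _ _ ((4 * vol / M)%:E * (a * M)%:E)%E); last first.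
  by rewrite lee_pmul2l// ?lte_fin.
rewrite -EFinM lee_fin -av le_eqVlt; apply/orP; left; apply/eqP.
by field; rewrite gt_eqF.
Qed.
End poincare.

Section sum_over_cells.
Context {R : realType} {d : nat}.
Local Notation E := 'rV[R]_d.
Local Notation mu := (@lebesgue_rV R d).
Local Notation L := (LfunType mu (lee1n 2)).
Variables (c : R) (c0 : 0 < c).
Local Notation vol := (@cell_vol R d c).

(** Normalised so that the squared pairing with [p] is the mean-value term of [mass_near]. *)
Definition cell_test (n : nat) : L :=
  if @pickle_inv 'rV[int]_d n is Some k then
    (Num.sqrt vol)^-1 *: cellL c (center c k) else 0.

Lemma ip_le_cells (p s : L) (k M : R) (K : nat) :
  (\int[mu]_x osc c p x < +oo)%E -> 0 < k -> 0 < M -> k <= vol ->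
  (forall n q, (K <= n)%N -> @pickle_inv 'rV[int]_d n = Some q ->
    ((mass c p (center c q))%:E <=
    (4 / k)%:E * \int[mu]_(x in cell c (center c q)) osc c p x +
    (4 * vol / M)%:E * \int[mu]_(x in cell c (center c q)) (s x ^+ 2)%:E)%E) ->
  ((ip mu p p)%:E <= (4 / k)%:E * \int[mu]_x osc c p x +
     (4 * vol / M)%:E * (ip mu s s)%:E +
     (\sum_(0 <= j < K) ip mu (cell_test j) p ^+ 2)%:E)%E.
Proof.
move=> oscoo k0 M0 kv far.
have v0 : 0 < vol by exact: cell_vol_gt0.
have a0 : 0 <= 4 / k by rewrite divr_ge0// ltW.
have b0 : 0 <= 4 * vol / M by rewrite divr_ge0 ?mulr_ge0 ?(ltW v0) ?(ltW M0).
have mC := @measurable_cell_seq R d c.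
have tC := trivIset_cell_seq c0.
have split_int (f : E -> \bar R) : measurable_fun setT f -> (forall x, (0 <= f x)%E) ->
    (\int[mu]_x f x = \sum_(n <oo) \int[mu]_(x in cell_seq c n) f x)%E.
  move=> mf f0; have := @ge0_integral_bigcup _ _ _ mu (cell_seq c) f mC.
  by rewrite (bigcup_cell_seq c0) => /= H; apply: H.
have msq (f : L) : measurable_fun setT (fun x => (f x ^+ 2)%:E).
  by apply/measurable_EFinP/measurable_funX; exact: L2_measurable.
have sq0 (f : L) x : (0 <= (f x ^+ 2)%:E)%E by rewrite lee_fin sqr_ge0.
have term n : (\int[mu]_(x in cell_seq c n) (p x ^+ 2)%:E <=
    (4 / k)%:E * \int[mu]_(x in cell_seq c n) osc c p x +
    (4 * vol / M)%:E * \int[mu]_(x in cell_seq c n) (s x ^+ 2)%:E +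
    (if (n < K)%N then ip mu (cell_test n) p ^+ 2 else 0)%:E)%E.
  have A0 (A : set E) : (0 <= (4 / k)%:E * \int[mu]_(x in A) osc c p x)%E.
    by rewrite mule_ge0 ?lee_fin//; apply: integral_ge0 => x _; exact: osc_ge0.
  have B0 (A : set E) : (0 <= (4 * vol / M)%:E * \int[mu]_(x in A) (s x ^+ 2)%:E)%E.
    by rewrite mule_ge0 ?lee_fin//; apply: integral_ge0 => x _; rewrite lee_fin sqr_ge0.
  have C0 : (0 <= (if (n < K)%N then ip mu (cell_test n) p ^+ 2 else 0)%:E :> \bar R)%E.
    by rewrite lee_fin; case: ifP; rewrite ?sqr_ge0.
  rewrite /cell_seq; case E : (pickle_inv n) => [q|]; last first.
    by rewrite integral_set0 !adde_ge0.
  rewrite -massE.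
  case: ltnP => nK; last by rewrite adde0; exact: far nK E.
  apply: le_trans (mass_near c0 oscoo (center c q)) _.
  rewrite -addeA; apply: leeD.
    rewrite lee_wpmul2r//; first by apply: integral_ge0 => x _; exact: osc_ge0.
    (* By [k <= vol] the near cells share the factor of the far ones: [(2 * vol)^-1 <= 4 / k]. *)
    rewrite lee_fin invfM; apply: (@le_trans _ _ vol^-1).
      by rewrite ler_piMl ?invr_ge0 ?(ltW v0)// invf_le1// ler1n.
    apply: (@le_trans _ _ k^-1); first by rewrite lef_pV2.
    by rewrite ler_peMl ?invr_ge0 ?(ltW k0)// ler1n.
  apply: le_trans (leeDr _ (B0 _)); rewrite lee_fin /cell_test E formZl exprMn.
  by rewrite exprVn sqr_sqrtr// ltW.
rewrite EFin_ip (split_int _ (msq p) (sq0 p)).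
apply: lime_le.
  by apply: is_cvg_nneseries => n _ _; apply: integral_ge0 => x _; rewrite lee_fin sqr_ge0.
apply: nearW => N.
apply: le_trans (lee_sum _ (fun n _ => term n)) _.
rewrite !big_split/=; apply: leeD; first apply: leeD.
- rewrite -ge0_sume_distrr => [|n _]; last by apply: integral_ge0 => x _; exact: osc_ge0.
  rewrite lee_wpmul2l ?lee_fin// (split_int _ (measurable_osc c p) (osc_ge0 c p)).
  by apply: nneseries_lim_ge => n _ _; apply: integral_ge0 => x _; exact: osc_ge0.
- rewrite -ge0_sume_distrr => [|n _]; last first.
    by apply: integral_ge0 => x _; rewrite lee_fin sqr_ge0.
  rewrite lee_wpmul2l ?lee_fin// EFin_ip (split_int _ (msq s) (sq0 s)).
  apply: nneseries_lim_ge => n _ _; apply: integral_ge0 => x _.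
  by rewrite lee_fin sqr_ge0.
rewrite sumEFin lee_fin.
(* [N + K] is beyond both [N] and [K], whichever is larger. *)
apply: (@le_trans _ _ (\sum_(0 <= n < N + K)
    (if (n < K)%N then ip mu (cell_test n) p ^+ 2 else 0))).
  rewrite [leRHS](@big_cat_nat _ _ _ N)//= ?leq_addr// lerDl.
  by apply: sumr_ge0 => n _; case: ifP; rewrite ?sqr_ge0.
rewrite (@big_cat_nat _ _ _ K)//= ?leq_addl// [X in _ + X]big1_seq ?addr0.
  by rewrite le_eqVlt; apply/orP; left; apply/eqP; apply: eq_big_nat => n /andP[_ ->].
by move=> n /=; rewrite mem_index_iota => /andP[Kn _]; rewrite ltnNge Kn.
Qed.

End sum_over_cells.

(** * The dilated domain and the growth condition on gamma *)

Section domain.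
Context {R : realType} {d : nat}.
Local Notation E := 'rV[R]_d.
Local Notation mu := (@lebesgue_rV R d).
Implicit Types G : set E.

Lemma admissible_bounds G : (0 < d)%N -> admissible_domain G -> exists b l : R,
  [/\ 0 < b, 0 < l, cbox (const_mx (- b)) (const_mx b) `<=` G &
      forall x, G x -> `|x| < l].
Proof.
move=> d0 [_ _ Gb [rho rho0 [rG _]] _].
have [l [lr Hl]] := Gb.
have dR : 1 <= d%:R :> R by rewrite ler1n.
have dp : 0 < d%:R :> R by rewrite (lt_le_trans ltr01).
(* A box of half-side [b] lies in the Euclidean ball as soon as [d * b ^+ 2 < rho ^+ 2]. The [+ 2]
   leaves room for the strict bound on the norm of [x]. *)
exists (rho / (2 * d%:R)), (`|l| + 2); split.
- by rewrite divr_gt0// mulr_gt0.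
- by rewrite ltr_wpDl.
- move=> x H; apply: rG; rewrite /eball/= /enorm.
  set b := rho / _ in H; have b0 : 0 < b by rewrite divr_gt0// mulr_gt0.
  rewrite -[ltRHS](ger0_norm (ltW rho0)) -sqrtr_sqr ltr_sqrt ?exprn_gt0//.
  apply: (@le_lt_trans _ _ (\sum_(i < d) b ^+ 2)).
    apply: ler_sum => i _; rewrite -real_normK ?num_real//.
    rewrite ler_pXn2r ?nnegrE ?(ltW b0)//.
    by have := H i; rewrite !mxE -ler_norml.
  rewrite sumr_const card_ord -mulr_natl.
  have bE : b * (2 * d%:R) = rho by rewrite divfK// gt_eqF// mulr_gt0.
  rewrite -bE; have : 0 < b ^+ 2 * d%:R by rewrite mulr_gt0// exprn_gt0.
  move: dR; nra.
- move=> x Gx; apply: (@le_lt_trans _ _ (`|l| + 1)); last by rewrite ltrD2l ltr1n.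
  by apply: (Hl (`|l| + 1)) => //; rewrite (le_lt_trans (ler_norm _))// ltrDl.
Qed.

Lemma dilateE G r y : 0 < r -> dilate G r y = (fun x => r^-1 *: (x - y)) @^-1` G.
Proof.
move=> r0; apply/seteqP; split => [_ [x Gx <-]|x Gx] /=.
  by rewrite addrK.
by exists (x - y) => //=; rewrite subrK.
Qed.

Lemma open_measurable (U : set E) : open U -> measurable U.
Proof. exact: sub_sigma_algebra. Qed.

Lemma measurable_dilate G r y : open G -> 0 < r -> measurable (dilate G r y).
Proof.
move=> oG r0; rewrite dilateE// -[X in measurable X]setTI.
have mf : measurable_fun setT (fun x : E => r^-1 *: (x - y)).
  apply: measurable_rV => i; under eq_fun do rewrite !mxE.
  by apply: measurable_funM => //; apply: measurable_funB => //; exact: measurable_coord.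
by apply: mf => //; exact: open_measurable.
Qed.

Lemma dilate_sub_cell G (r l : R) y : 0 < r -> 0 < l -> (forall x, G x -> `|x| < l) ->
  dilate G r y `<=` cell (l * r) y.
Proof.
move=> r0 l0 Gl; rewrite dilateE// => x /Gl H i.
have := le_lt_trans (coord_le_norm _ i) H; rewrite !mxE normrM.
rewrite ger0_norm ?invr_ge0 ?(ltW r0)// mulrC ltr_pdivrMr// ltr_norml => /andP[h1 h2].
apply/andP; split; lra.
Qed.

Lemma dilate_volume G (r b : R) y : open G -> 0 < r -> 0 < b ->
  cbox (const_mx (- b)) (const_mx b) `<=` G ->
  (((2 * b * r) ^+ d)%:E <= mu (dilate G r y))%E.
Proof.
move=> oG r0 b0 bG.
have sub : cbox (y - const_mx (b * r)) (y + const_mx (b * r)) `<=` dilate G r y.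
  rewrite dilateE// => x H; apply: bG => i; have := H i; rewrite !mxE => /andP[h1 h2].
  rewrite mulrC ler_pdivlMr// ler_pdivrMr//.
  apply/andP; split; lra.
have := le_measure mu (mem_set (measurable_cbox _ _)) (mem_set (measurable_dilate y oG r0)) sub.
apply: le_trans; rewrite le_eqVlt; apply/orP; left; apply/eqP/esym.
apply: etrans (lebesgue_cbox _) _ => [i|].
  by have := mulr_gt0 b0 r0; rewrite !mxE; lra.
congr EFin; rewrite (eq_bigr (fun=> 2 * b * r)).
  by rewrite prodr_const card_ord.
by move=> i _; rewrite !mxE; ring.
Qed.

Lemma gamma_limsup_pt (gam : R -> R) (r0 : R) : (2 <= d)%N -> 0 < r0 ->
  (forall r, 0 < r < r0 -> 0 < gam r < 1) ->
  limf_esup (fun r : R => (r `^ (- (2 * (d%:R - 2) / d%:R)) * gam r)%:E) 0^'+ = +oo%E ->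
  forall C : R, exists r, [/\ 0 < r, r < r0 & C * r ^+ 2 <= gam r].
Proof.
move=> d2 r00 gam01 lim C; apply: contrapT => /forallNP H.
have dp : 0 < d%:R :> R by rewrite ltr0n (leq_trans _ d2).
have : (limf_esup (fun r : R => (r `^ (- (2 * (d%:R - 2) / d%:R)) * gam r)%:E) 0^'+
    <= C%:E)%E.
  (* Restricting to [r < 1] reverses the order of the exponents: the power in the limsup is then at
     most [r ^- 2]. *)
  apply: ge_ereal_inf; exists (ereal_sup ((fun r : R => (r `^ (- (2 * (d%:R - 2) / d%:R)) * gam r)%:E) @`
      [set r | 0 < r < Num.min r0 1])); last first.
    apply: ge_ereal_sup => _ [r /andP[rp rm] <-].
    move: rm; rewrite lt_min => /andP[rr0 r1].
    rewrite lee_fin leNgt; apply/negP => Cr; apply: (H r); split => //.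
    have /andP[g0 _] : 0 < gam r < 1 by apply: gam01; rewrite rp.
    rewrite -ler_pdivlMr ?exprn_gt0//; apply/ltW; apply: lt_le_trans Cr _.
    rewrite mulrC ler_wpM2l ?(ltW g0)//.
    have -> : (r ^+ 2)^-1 = r `^ (- 2) by rewrite powRN powR_mulrn// ltW.
    apply: ger_powR; first by rewrite rp ltW.
    rewrite lerN2 ler_pdivrMr//; lra.
  exists [set r | 0 < r < Num.min r0 1] => //.
  near=> r; apply/andP; split; near: r; first exact: nbhs_right_gt.
  by apply: nbhs_right_lt; rewrite lt_min r00 ltr01.
by rewrite lim.
Unshelve. all: by end_near. Qed.

End domain.

(** The crude factor is harmless: in [energy_compactness] it becomes part of the constant [C]. *)
Lemma sqr_sum_le (R : realDomainType) (I : Type) (s : seq I) (a : I -> R) :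
  (\sum_(i <- s) a i) ^+ 2 <= 2 ^+ size s * \sum_(i <- s) a i ^+ 2.
Proof.
elim: s => [|i s IH]; first by rewrite !big_nil expr0n mulr0.
rewrite !big_cons /= (exprS 2); set T := \sum_(j <- s) a j in IH *.
set Q := \sum_(j <- s) _ in IH *.
have q1 : 0 <= (2 ^+ size s - 1) * a i ^+ 2.
  by rewrite mulr_ge0 ?sqr_ge0// subr_ge0 exprn_ege1// ler1n.
have := sqr_ge0 (a i - T); move: IH q1; lra.
Qed.

(** * The compactness estimate for the energy *)

Section energy_compactness.
Context {R : realType} {d : nat}.
Local Notation E := 'rV[R]_d.
Local Notation mu := (@lebesgue_rV R d).
Local Notation L := (LfunType mu (lee1n 2)).
Variables (V : E -> R) (G : set E) (r0 : R) (gam : R -> R).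
Hypotheses (d_ge3 : (3 <= d)%N) (mV : measurable_fun setT V)
  (V0 : {ae mu, forall x, 0 <= V x}) (G_adm : admissible_domain G)
  (r0_gt0 : 0 < r0) (gam01 : forall r, 0 < r < r0 -> 0 < gam r < 1)
  (gam_limsup : limf_esup
    (fun r : R => (r `^ (- (2 * (d%:R - 2) / d%:R)) * gam r)%:E) 0^'+ = +oo%E)
  (V_inf : forall r, 0 < r < r0 ->
    ereal_inf [set (\int[mu]_(x in dilate G r y `\` F)
                       (V x)%:E)%E | F in small_subsets G (gam r) y r]
        @[y --> at_infinity] --> +oo%E).

Lemma energy_compactness (e : R) : 0 < e -> exists n (w : 'I_n -> L),
  forall (p s : L) (g : 'I_d -> L),
    sqrtV_multiple V p s -> (forall i, real_weak_partial i p (g i)) ->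
    ip mu p p <= e * (\sum_i ip mu (g i) (g i) + ip mu s s) +
      \sum_j ip mu (w j) p ^+ 2.
Proof.
move=> e0.
have d0 : (0 < d)%N by apply: leq_trans d_ge3.
have [oG _ _ _ _] := G_adm.
have [b [l [b0 l0 bG Gl]]] := admissible_bounds d0 G_adm.
(* With [c = l * r], [k = gam r * (2 * b * r) ^+ d] and the factor [2 ^+ d] of [sqr_sum_le], the
   oscillation term is at most [C * r ^+ 2 / gam r] times the gradient energy; [r] is taken so that
   this factor is at most [e]. *)
pose C := 16 * l ^+ 2 * (2 * l / b) ^+ d * 2 ^+ d.
have [r [rp rr0 Cr]] := gamma_limsup_pt (ltnW d_ge3) r0_gt0 gam01 gam_limsup (C / e).
have r01 : 0 < r < r0 by rewrite rp.
have /andP[g0 g1] := gam01 r01.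
pose c := l * r; have c0 : 0 < c by rewrite mulr_gt0.
pose vol := @cell_vol R d c; have v0 : 0 < vol by exact: cell_vol_gt0.
pose k := gam r * (2 * b * r) ^+ d.
have br0 : 0 < (2 * b * r) ^+ d by rewrite exprn_gt0// !mulr_gt0.
have k0 : 0 < k by rewrite mulr_gt0.
pose D y := dilate G r y.
have mD y : measurable (D y) by exact: measurable_dilate.
have Dc y : D y `<=` cell c y by exact: dilate_sub_cell.
have vD y : (((2 * b * r) ^+ d)%:E <= mu (D y))%E by exact: dilate_volume.
have Dv y : (mu (D y) <= vol%:E)%E.
  rewrite -(cell_volE c y); apply: le_measure; rewrite ?inE//.
  exact: measurable_cell.
have kv : k <= vol.
  apply: (@le_trans _ _ ((2 * b * r) ^+ d)).
    by rewrite ler_piMl ?(ltW br0)// ltW.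
  by rewrite -lee_fin; apply: le_trans (vD 0) (Dv 0).
have kD y : (k%:E <= (gam r)%:E * mu (D y))%E.
  by rewrite EFinM lee_wpmul2l// ?lee_fin ltW.
(* Makes the coefficient [4 * vol / M] of the potential term equal to [e]. *)
pose M := 4 * vol / e; have M0 : 0 < M by rewrite divr_gt0// mulr_gt0.
have [M1 HM1] : exists M1 : R, forall y : E, M1 < enorm y -> (M%:E <= ereal_inf
    [set (\int[mu]_(x in dilate G r y `\` F) (V x)%:E)%E
      | F in small_subsets G (gam r) y r])%E.
  by have /cvgeyPge/(_ M) := V_inf r01.
have [K HK] := near_centers_finite (d := d) c0 M1.
exists K, (fun j => cell_test c j) => p s g sp wpg.
pose S := \sum_i seminorm (ip mu) (g i).
have S0 : 0 <= S by apply: sumr_ge0 => i _; exact: seminorm_ge0.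
have tr h : seminorm (ip mu) (shiftL h p - p) <= `|h| * S by exact: translation_le.
have oscI := integral_osc c0 S0 tr.
have oscoo : (\int[mu]_x osc c p x < +oo)%E by apply: le_lt_trans oscI (ltry _).
rewrite -lee_fin.
apply: le_trans (@ip_le_cells _ _ _ c0 p s k M K oscoo k0 M0 kv _) _.
  move=> n q Kn nq; apply: (@mass_far_potential _ _ V mV V0 c c0 p s _ (D (center c q)) (gam r)) => //.
  move=> F mF FD Fs; apply: (@le_trans _ _ (ereal_inf
    [set (\int[mu]_(x in dilate G r (center c q) `\` F) (V x)%:E)%E
      | F in small_subsets G (gam r) (center c q) r])).
    apply: HM1; rewrite ltNge; apply/negP => qM.
    by have := HK _ _ nq qM; rewrite ltnNge Kn.
  by apply: ereal_inf_lbound; exists F.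
rewrite [leRHS]EFinD; apply: leeD; last by rewrite lee_fin big_mkord.
rewrite mulrDr [leRHS]EFinD; apply: leeD; last first.
  rewrite -EFinM lee_fin ler_wpM2r ?form_ge0// /M -/vol.
  by rewrite invf_div mulrC divfK// gt_eqF// mulr_gt0.
apply: (@le_trans _ _ ((4 / k)%:E * ((4 * c) ^+ d * (2 * c * S) ^+ 2)%:E)%E).
  by rewrite lee_wpmul2l// lee_fin divr_ge0// ltW.
rewrite -EFinM lee_fin.
have S2 : S ^+ 2 <= 2 ^+ d * \sum_i ip mu (g i) (g i).
  have := sqr_sum_le (index_enum 'I_d) (fun i => seminorm (ip mu) (g i)).
  rewrite -/S; under [in leRHS]eq_bigr do rewrite sqr_seminorm.
  by rewrite /index_enum -enumT size_enum_ord.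
set T := \sum_i _ in S2 *.
have T0 : 0 <= T by apply: sumr_ge0 => i _; exact: form_ge0.
have E1 : 4 / k * ((4 * c) ^+ d * (2 * c * S) ^+ 2) =
    16 * l ^+ 2 * (2 * l / b) ^+ d * (r ^+ 2 / gam r) * S ^+ 2.
  rewrite /k /c (_ : 4 * (l * r) = (2 * l / b) * (2 * b * r)); last first.
    by field; rewrite gt_eqF.
  rewrite (exprMn d (2 * l / b)); field.
  by rewrite !gt_eqF.
rewrite E1.
apply: (@le_trans _ _ (16 * l ^+ 2 * (2 * l / b) ^+ d * (r ^+ 2 / gam r) * (2 ^+ d * T))).
  apply: ler_wpM2l => //; apply: mulr_ge0; last by rewrite divr_ge0 ?sqr_ge0 ?(ltW g0).
  apply: mulr_ge0; first by rewrite mulr_ge0 ?sqr_ge0.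
  by rewrite exprn_ge0// divr_ge0 ?mulr_ge0 ?(ltW l0) ?(ltW b0).
rewrite mulrA ler_wpM2r//.
move: Cr; rewrite mulrAC ler_pdivrMr// => Cr.
rewrite -[_ * (r ^+ 2 / _)]mulrA (_ : _ * _ = C * r ^+ 2 / gam r); last first.
  by rewrite /C; ring.
by rewrite ler_pdivrMr// [leRHS]mulrC.
Qed.

End energy_compactness.

(** * The energy space *)

Lemma cvg_bigsum (R : realType) (I : Type) (r : seq I) (F : I -> nat -> R) (l : I -> R) :
  (forall i, F i n @[n --> \oo] --> l i) ->
  \sum_(i <- r) F i n @[n --> \oo] --> \sum_(i <- r) l i.
Proof.
move=> H; elim: r => [|i r IH].
  by rewrite big_nil; under eq_fun do rewrite big_nil; exact: cvg_cst.
by rewrite big_cons; under eq_fun do rewrite big_cons; exact: cvgD.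
Qed.

Section energy_space.
Context {R : realType} {d : nat}.
Local Notation E := 'rV[R]_d.
Local Notation mu := (@lebesgue_rV R d).
Local Notation L := (LfunType mu (lee1n 2)).
Local Notation K := (bool * option (option 'I_d))%type.
Variable V : E -> R.

(* The element [z] encodes [u] in the form domain: [false] and [true] select its
   real and imaginary part, [None] the part [p] itself, [Some None] the function
   [sqrt V * p], and [Some (Some i)] the weak derivative of [p] along the [i]-th
   axis.  The graph norm is then a plain sum of squares. *)
Definition energy_pred : {pred {ffun K -> L}} := [pred z : {ffun K -> L} | `[< forall b : bool,
  sqrtV_multiple V (z (b, None)) (z (b, Some None)) /\
  forall i, real_weak_partial i (z (b, None)) (z (b, Some (Some i))) >]].

Lemma real_weak_partial_lin i (a : R) (p g p' g' : L) :
  real_weak_partial i p g -> real_weak_partial i p' g' ->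
  real_weak_partial i (a *: p + p' : L) (a *: g + g' : L).
Proof.
move=> H H' phi tphi; have tD := test_derive i tphi.
pose D := Lfun_Sub (lee1n 2) (test_Lfun tD); pose F := Lfun_Sub (lee1n 2) (test_Lfun tphi).
have h := H _ tphi; have h' := H' _ tphi.
have : ip mu D (a *: p + p') = - ip mu F (a *: g + g').
  by rewrite !formDr !formZr -[ip mu D p]/(\int[mu]_x _) h -[ip mu D p']/(\int[mu]_x _) h'
    mulrN opprD.
by [].
Qed.

Lemma energy_submod_closed : submod_closed energy_pred.
Proof.
split.
  apply/asboolP => b; rewrite !ffunE; split; first by apply: aeW => x /=; rewrite mulr0.
  move=> i phi tphi; rewrite ffunE.
  have -> : \int[mu]_x ('D_(evec i) phi x * (0 : L) x) = 0.
    rewrite (_ : \int[mu]_x _ = \int[mu]_(x in setT) (cst 0 x)).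
      by rewrite Rintegral_cst ?mul0r.
    by apply: eq_Rintegral => x _; rewrite mulr0.
  rewrite (_ : \int[mu]_x _ = \int[mu]_(x in setT) (cst 0 x)).
    by rewrite Rintegral_cst ?mul0r ?oppr0.
  by apply: eq_Rintegral => x _; rewrite mulr0.
move=> a u v /asboolP Hu /asboolP Hv; apply/asboolP => b.
have [su wu] := Hu b; have [sv wv] := Hv b; rewrite !ffunE; split.
  near=> x; rewrite -[LHS]/(a * u (b, Some None) x + v (b, Some None) x).
  rewrite -[X in _ = _ * X]/(a * u (b, None) x + v (b, None) x).
  have -> : u (b, Some None) x = Num.sqrt (V x) * u (b, None) x by near: x.
  have -> : v (b, Some None) x = Num.sqrt (V x) * v (b, None) x by near: x.
  ring.
by move=> i; rewrite !ffunE; exact: real_weak_partial_lin.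
Unshelve. all: by end_near. Qed.

HB.instance Definition _ := GRing.isSubmodClosed.Build R {ffun K -> L} energy_pred
  energy_submod_closed.

Record energy_space := EnergySpace {
  energy_val :> {ffun K -> L};
  _ : energy_val \in energy_pred }.

HB.instance Definition _ := [isSub for energy_val].
HB.instance Definition _ := [Choice of energy_space by <:].
HB.instance Definition _ := [SubChoice_isSubLmodule of energy_space by <:].

Local Notation X := energy_space.

Lemma energyP (u : X) b : sqrtV_multiple V (u (b, None)) (u (b, Some None)) /\
  forall i, real_weak_partial i (u (b, None)) (u (b, Some (Some i))).
Proof. by case: u => u /= /asboolP. Qed.

Lemma energyDZ (a : R) (u v : X) k : (a *: u + v) k = a *: u k + v k.
Proof. by rewrite -[LHS]/((a *: (u : {ffun K -> L}) + v) k) !ffunE. Qed.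

Lemma energyB (u v : X) k : (u - v) k = u k - v k.
Proof. by rewrite addrC -scaleN1r energyDZ scaleN1r addrC. Qed.

(** The predicate selects components: all of them give the graph norm, those marked [None] alone
    give the [L_2] product. *)
Definition energy_form_def (P : pred K) (u v : X) := \sum_(k | P k) ip mu (u k) (v k).

Fact energy_form_scalar P u : scalar (energy_form_def P u).
Proof.
move=> a v w; rewrite /energy_form_def mulr_sumr -big_split/=.
by apply: eq_bigr => k _; rewrite energyDZ; exact: ip_scalar.
Qed.

Fact energy_formC P u v : energy_form_def P u v = energy_form_def P v u.
Proof. by apply: eq_bigr => k _; rewrite formC. Qed.

Fact energy_form_ge0 P u : 0 <= energy_form_def P u u.
Proof. by apply: sumr_ge0 => k _; exact: form_ge0. Qed.

Definition energy_form P : psdForm X :=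
  PsdForm (energy_form_scalar P) (energy_formC P) (energy_form_ge0 P).

Lemma energy_formE P u v : energy_form P u v = \sum_(k | P k) ip mu (u k) (v k).
Proof. by []. Qed.

Definition form_H1V := energy_form xpredT.
Definition form_L2 := energy_form (fun k => k.2 == None).

Lemma form_L2E u v : form_L2 u v =
  ip mu (u (false, None)) (v (false, None)) + ip mu (u (true, None)) (v (true, None)).
Proof.
rewrite -[LHS]/(\sum_(k : K | true && (k.2 == None)) ip mu (u k) (v k)).
rewrite (eq_bigr (fun k => ip mu (u (k.1, k.2)) (v (k.1, k.2)))); last by case.
rewrite -(pair_big xpredT (pred1 None) (fun b o => ip mu (u (b, o)) (v (b, o)))).
by rewrite big_bool !big_pred1_eq addrC.
Qed.

Lemma form_L2_le u : form_L2 u u <= form_H1V u u.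
Proof.
rewrite !energy_formE [leRHS](bigID (fun k : K => k.2 == None)) lerDl.
by apply: sumr_ge0 => k _; exact: form_ge0.
Qed.

Lemma ip_comp_le (u : X) k : ip mu (u k) (u k) <= form_H1V u u.
Proof.
rewrite energy_formE (bigD1 k)// lerDl.
by apply: sumr_ge0 => j _; exact: form_ge0.
Qed.

(** Weak derivatives pass to the limit by [L_2] convergence against test functions, the relation
    with [sqrt V] by convergence a.e. *)
Lemma energy_complete : complete_form form_H1V.
Proof.
move=> u C uC.
have /choice[z zP] : forall k, exists z : L,
    ip mu (u n k - z) (u n k - z) @[n --> \oo] --> (0 : R) /\
    {ae mu, forall x, u n k x @[n --> \oo] --> z x}.
  move=> k; apply: (@L2_fast_cauchy _ _ _ mu (fun n => u n k) C) => n.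
  by rewrite -energyB; exact: le_trans (ip_comp_le _ _) (uC n).
have zE : finfun z \in energy_pred.
  apply/asboolP => b; rewrite !ffunE; split.
    have H1 := (zP (b, None)).2; have H2 := (zP (b, Some None)).2.
    have H3 : {ae mu, forall x, forall n,
        u n (b, Some None) x = Num.sqrt (V x) * u n (b, None) x}.
      by apply: ae_foralln => n; have [] := energyP (u n) b.
    near=> x.
    have h1 : u n (b, None) x @[n --> \oo] --> z (b, None) x by near: x.
    have h2 : u n (b, Some None) x @[n --> \oo] --> z (b, Some None) x by near: x.
    have h3 : forall n, u n (b, Some None) x = Num.sqrt (V x) * u n (b, None) x by near: x.
    have h4 : u n (b, Some None) x @[n --> \oo] --> Num.sqrt (V x) * z (b, None) x.
      by under eq_fun do rewrite h3; exact: cvgMr.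
    by move/(@cvg_unique _ (@norm_hausdorff _ _)) : h2 => /(_ _ h4).
  move=> i phi tphi; rewrite ffunE.
  have tD := test_derive i tphi.
  pose D := Lfun_Sub (lee1n 2) (test_Lfun tD); pose F := Lfun_Sub (lee1n 2) (test_Lfun tphi).
  have c1 := form_cvg0 (w := D) (zP (b, None)).1.
  have c2 := form_cvg0 (w := F) (zP (b, Some (Some i))).1.
  have c3 : ip mu (u n (b, None)) D @[n --> \oo] --> - ip mu (z (b, Some (Some i))) F.
    rewrite (_ : (fun n => ip mu (u n (b, None)) D) =
        (fun n => - ip mu (u n (b, Some (Some i))) F)); first exact: cvgN.
    apply/funext => n; rewrite formC (formC _ _ F).
    by have [_ /(_ i _ tphi)] := energyP (u n) b.
  have : ip mu (z (b, None)) D = - ip mu (z (b, Some (Some i))) F.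
    by move/(@cvg_unique _ (@norm_hausdorff _ _)) : c1 => /(_ _ c3).
  by rewrite formC (formC _ _ F).
exists (EnergySpace zE).
rewrite (_ : (fun n => _) = fun n => \sum_k ip mu (u n k - z k) (u n k - z k)); last first.
  by apply/funext => n; apply: eq_bigr => k _; rewrite energyB/= ffunE.
rewrite [X in _ --> X](_ : 0 = \sum_(k : K) 0); last by rewrite big1.
apply: cvg_bigsum => k; exact: (zP k).1.
Unshelve. all: by end_near. Qed.

(* Multiplication by the complex number [a + i b]. *)
Definition rotate_fun (a b : R) (u : X) : {ffun K -> L} :=
  [ffun k => if k.1 then a *: u (true, k.2) + b *: u (false, k.2)
             else a *: u (false, k.2) - b *: u (true, k.2)].

Fact rotate_fun_energy a b u : rotate_fun a b u \in energy_pred.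
Proof.
apply/asboolP => c.
(* Each part of the product is a real combination of the two parts of [u], with coefficients that do
   not depend on [k], so the linear constraints survive. *)
suff [a' [c' [b' H]]] : exists a' (c' : bool) (b' : R), forall k,
    rotate_fun a b u (c, k) = a' *: u (c, k) + b' *: u (~~ c, k).
  have /asboolP := valP (a' *: u + b' *: u).
  have [s1 w1] := energyP u c; have [s2 w2] := energyP u (~~ c).
  move=> _; rewrite !H; split.
    near=> x.
    rewrite -[LHS]/(a' * u (c, Some None) x + b' * u (~~ c, Some None) x).
    rewrite -[X in _ = _ * X]/(a' * u (c, None) x + b' * u (~~ c, None) x).
    have -> : u (c, Some None) x = Num.sqrt (V x) * u (c, None) x by near: x.
    have -> : u (~~ c, Some None) x = Num.sqrt (V x) * u (~~ c, None) x by near: x.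
    ring.
  move=> i; rewrite H; apply: real_weak_partial_lin => //.
  rewrite -[b' *: u (~~ c, None)]addr0 -[b' *: u (~~ c, Some _)]addr0.
  apply: real_weak_partial_lin => //.
  have /asboolP/(_ false)[_ /(_ i)] := valP (0 : X).
  by rewrite !ffunE.
exists a, true, (if c then b else - b) => k; rewrite ffunE /=.
by case: c => //=; rewrite scaleNr.
Unshelve. all: by end_near. Qed.

Definition rotate a b u : X := EnergySpace (rotate_fun_energy a b u).

Lemma rotateE a b u c k : rotate a b u (c, k) =
  if c then a *: u (true, k) + b *: u (false, k)
  else a *: u (false, k) - b *: u (true, k).
Proof. by rewrite /= ffunE. Qed.

Lemma rotate_im a b u k :
  rotate a b u (true, k) = a *: u (true, k) + b *: u (false, k).
Proof. exact: rotateE. Qed.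

Lemma rotate_re a b u k :
  rotate a b u (false, k) = a *: u (false, k) - b *: u (true, k).
Proof. exact: rotateE. Qed.

Fact rotate_linear a b : linear (rotate a b).
Proof.
move=> t u v; apply/val_inj/ffunP => -[c k].
rewrite -[LHS]/(rotate a b (t *: u + v) (c, k)) -[RHS]/((t *: rotate a b u + rotate a b v) (c, k)).
rewrite energyDZ !rotateE !energyDZ.
case: c; apply/LfuneqP => x.
  rewrite -[LHS]/(a * (t * u (true, k) x + v (true, k) x) + b * (t * u (false, k) x + v (false, k) x)).
  rewrite -[RHS]/(t * (a * u (true, k) x + b * u (false, k) x) + (a * v (true, k) x + b * v (false, k) x)).
  ring.
rewrite -[LHS]/(a * (t * u (false, k) x + v (false, k) x) - b * (t * u (true, k) x + v (true, k) x)).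
rewrite -[RHS]/(t * (a * u (false, k) x - b * u (true, k) x) + (a * v (false, k) x - b * v (true, k) x)).
ring.
Qed.

HB.instance Definition _ a b := GRing.isLinear.Build R X X *:%R (rotate a b)
  (rotate_linear a b).

Lemma form_L2_rotate a b u :
  form_L2 (rotate a b u) (rotate a b u) = (a ^+ 2 + b ^+ 2) * form_L2 u u.
Proof.
rewrite !form_L2E !(rotate_im, rotate_re) !formE (formC _ (u (true, None)) (u (false, None))).
ring.
Qed.

Lemma seminorm_rotate a b u : seminorm form_L2 (rotate a b u) =
  Num.sqrt (a ^+ 2 + b ^+ 2) * seminorm form_L2 u.
Proof. by rewrite /seminorm form_L2_rotate sqrtrM// addr_ge0 ?sqr_ge0. Qed.

(** The real part of [- i h(u, u)] is zero. Together with the same fact for [form_L2] this forces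
    eigenvalues to be real. *)
Lemma form_H1V_rotate01 u : form_H1V u (rotate 0 1 u) = 0.
Proof.
rewrite energy_formE.
have -> : \sum_(k : K) ip mu (u k) (rotate 0 1 u k) =
    \sum_(b : bool) \sum_(k : option (option 'I_d)) ip mu (u (b, k)) (rotate 0 1 u (b, k)).
  by rewrite pair_bigA; apply: eq_bigr => -[b k].
rewrite big_bool -big_split; apply: big1 => k _.
by rewrite -[LHS]/(_ + _) !(rotate_im, rotate_re) !scale0r !scale1r !add0r
  (linearN (ip mu _)) formC addrN.
Qed.

Lemma form_L2_rotate01 u : form_L2 u (rotate 0 1 u) = 0.
Proof.
rewrite form_L2E !(rotate_im, rotate_re) !scale0r !scale1r !add0r (linearN (ip mu _)).
by rewrite (formC _ (u (true, None))) addNr.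
Qed.

End energy_space.

Section energy_finite_compactness.
Context {R : realType} {d : nat}.
Local Notation E := 'rV[R]_d.
Local Notation mu := (@lebesgue_rV R d).
Local Notation L := (LfunType mu (lee1n 2)).
Local Notation K := (bool * option (option 'I_d))%type.
Variable V : E -> R.
Local Notation X := (energy_space V).

Lemma form_H1VE (u v : X) : form_H1V V u v =
  \sum_(b : bool) (ip mu (u (b, None)) (v (b, None)) +
    ip mu (u (b, Some None)) (v (b, Some None)) +
    \sum_i ip mu (u (b, Some (Some i))) (v (b, Some (Some i)))).
Proof.
have big_option (T : finType) (F : option T -> R) :
    \sum_(o : option T) F o = F None + \sum_(t : T) F (Some t).
  rewrite (bigD1 None)//=; congr (_ + _).
  rewrite (reindex_omap Some id)/=; last by case.
  by apply: eq_bigl => t; rewrite eqxx.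
rewrite -[LHS]/(\sum_(k : K) ip mu (u k) (v k)).
rewrite (eq_bigr (fun k => ip mu (u (k.1, k.2)) (v (k.1, k.2)))); last by case.
rewrite -(pair_bigA _ (fun b k => ip mu (u (b, k)) (v (b, k))))/=.
by apply: eq_bigr => b _; rewrite !big_option addrA.
Qed.

Definition comp_functional (w : L) b (u : X) := ip mu w (u (b, None)).

Fact comp_functional_scalar w b : scalar (comp_functional w b).
Proof. by move=> a u v; rewrite /comp_functional energyDZ formDr formZr. Qed.

HB.instance Definition _ w b := GRing.isLinear.Build R X R *%R
  (comp_functional w b) (comp_functional_scalar w b).

Lemma energy_finite_compactness :
  (forall e : R, 0 < e -> exists n (w : 'I_n -> L),
    forall (p s : L) (g : 'I_d -> L),
    sqrtV_multiple V p s -> (forall i, real_weak_partial i p (g i)) ->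
    ip mu p p <= e * (\sum_i ip mu (g i) (g i) + ip mu s s) +
      \sum_j ip mu (w j) p ^+ 2) ->
  finite_compactness (form_H1V V) (form_L2 V).
Proof.
move=> H e e0; have [n [w Hw]] := H _ e0.
(* Real and imaginary parts each get their own copy of the [n] functionals. *)
pose F (j : 'I_(n + n)) : {scalar X} := match fintype.split j with
  | inl i => comp_functional (w i) false | inr i => comp_functional (w i) true end.
exists (n + n)%N, F; split.
  have bd v b : form_bounded (form_L2 V) (comp_functional v b).
    exists (seminorm (ip mu) v) => u; rewrite /comp_functional/=.
    apply: le_trans (norm_ip_le _ _) _; rewrite ler_wpM2l ?seminorm_ge0//.
    rewrite ler_wsqrtr// form_L2E; case: b; rewrite ?lerDl ?lerDr ?form_ge0//.
  by move=> j; rewrite /F; case: fintype.split => i; exact: bd.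
move=> u; rewrite form_L2E form_H1VE big_split_ord.
have -> : \sum_(i < n) F (lshift n i) u ^+ 2 = \sum_(i < n) ip mu (w i) (u (false, None)) ^+ 2.
  by apply: eq_bigr => i _; rewrite /F (unsplitK (inl i : 'I_n + 'I_n)).
have -> : \sum_(i < n) F (rshift n i) u ^+ 2 = \sum_(i < n) ip mu (w i) (u (true, None)) ^+ 2.
  by apply: eq_bigr => i _; rewrite /F (unsplitK (inr i : 'I_n + 'I_n)).
have key b : ip mu (u (b, None)) (u (b, None)) <=
   e * (ip mu (u (b, None)) (u (b, None)) + ip mu (u (b, Some None)) (u (b, Some None)) +
    \sum_i ip mu (u (b, Some (Some i))) (u (b, Some (Some i)))) +
   \sum_(i < n) ip mu (w i) (u (b, None)) ^+ 2.
  have [su wu] := energyP u b.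
  apply: le_trans (Hw _ _ _ su wu) _; rewrite lerD2r ler_wpM2l ?(ltW e0)//.
  have := form_ge0 (ip mu) (u (b, None)); lra.
rewrite big_bool.
have := key true; have := key false; rewrite /=; lra.
Qed.

End energy_finite_compactness.

(** * The spectrum of the Schrödinger operator *)

Section complex_functions.
Import ComplexField.Normc.
Local Open Scope complex_scope.
Context {R : realType} {d : nat}.
Local Notation E := 'rV[R]_d.
Local Notation mu := (@lebesgue_rV R d).
Local Notation L := (LfunType mu (lee1n 2)).
Local Notation toL := (Lfun_Sub (lee1n 2)).
Implicit Types (u v : E -> R[i]).

Definition cplx (a b : E -> R) : E -> R[i] := fun x => a x +i* b x.

Lemma complex_sum (I : Type) (r : seq I) (F G : I -> R) :
  \sum_(i <- r) (F i +i* G i) = (\sum_(i <- r) F i) +i* (\sum_(i <- r) G i).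
Proof. by elim/big_rec3: _ => // i x y z _ ->. Qed.

Lemma L2_cplx u : L2 u -> exists a b : L, u = cplx a b.
Proof.
move=> [h1 h2]; exists (toL h1), (toL h2); apply/funext => x.
by rewrite /cplx /=; case: (u x).
Qed.

Lemma cplx_L2 (a b : L) : L2 (cplx a b).
Proof. by split; [exact: LfunP a|exact: LfunP b]. Qed.

Lemma inner_cplx (a b a' b' : L) : inner (cplx a b) (cplx a' b') =
  (ip mu a a' + ip mu b b') +i* (ip mu b a' - ip mu a b').
Proof.
have i1 := L2_mul_integrable a a'; have i2 := L2_mul_integrable b b'.
have i3 := L2_mul_integrable a b'; have i4 := L2_mul_integrable b a'.
rewrite /inner /cintegral; congr (_ +i* _).
  rewrite !ipE -RintegralD//.
  by apply: eq_Rintegral => x _ /=; rewrite mulrN opprK.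
rewrite !ipE -RintegralB//.
by apply: eq_Rintegral => x _ /=; rewrite mulrN addrC.
Qed.

Lemma L2norm_cplx (a b : L) : L2norm (cplx a b) =
  (Num.sqrt (ip mu a a + ip mu b b))%:E.
Proof.
rewrite /L2norm unlock /Lnorm.
have -> : (\int[mu]_x ((`|(normc (cplx a b x))%:E| `^ 2)%E) = (ip mu a a + ip mu b b)%:E)%E.
  rewrite [RHS]EFinD !EFin_ip -integralD//; [|exact: L2_sqr_integrable|exact: L2_sqr_integrable].
  apply: eq_integral => x _; rewrite /= powR_mulrn// -EFinD.
  by rewrite -normrX ger0_norm ?sqr_ge0// sqr_sqrtr// addr_ge0 ?sqr_ge0.
by rewrite poweR_EFin powR12_sqrt// addr_ge0 ?form_ge0.
Qed.

Lemma cintegral_real (f p q : E -> R) :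
  cintegral (fun x => (f x)%:C * cplx p q x) =
  (\int[mu]_x (f x * p x)) +i* (\int[mu]_x (f x * q x)).
Proof.
rewrite /cintegral; congr (_ +i* _); apply: eq_Rintegral => x _ /=.
  by rewrite mul0r subr0.
by rewrite mul0r addr0.
Qed.

Lemma weak_partial_cplx i (p q g h : E -> R) : weak_partial i (cplx p q) (cplx g h) <->
  real_weak_partial i p g /\ real_weak_partial i q h.
Proof.
split=> [H|[H1 H2] phi tphi].
  by split=> phi tphi; have := H phi tphi; rewrite !cintegral_real => -[].
by rewrite !cintegral_real H1// H2.
Qed.

Lemma real_weak_partial_unique i (p : E -> R) (g h : L) :
  real_weak_partial i p g -> real_weak_partial i p h -> {ae mu, forall x, g x = h x}.
Proof.
move=> Hg Hh; have : {ae mu, forall x, (g - h : L) x = 0}.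
  apply: fundamental_lemma; first exact: LfunP.
  move=> psi tpsi; pose F := toL (test_Lfun tpsi).
  rewrite -[LHS]/(ip mu F (g - h)) formBr.
  apply/eqP; rewrite subr_eq0 -eqr_opp; apply/eqP.
  by rewrite -[LHS](Hg _ tpsi) -[RHS](Hh _ tpsi).
by apply: filterS => x /eqP; rewrite -[_ x]/(g x - h x) subr_eq0 => /eqP.
Qed.

Lemma ae_eq_Rintegral (f g : E -> R) : measurable_fun setT f -> measurable_fun setT g ->
  {ae mu, forall x, f x = g x} -> \int[mu]_x f x = \int[mu]_x g x.
Proof.
move=> mf mg fg; rewrite /Rintegral; congr fine.
apply: ae_eq_integral => //; try exact/measurable_EFinP.
by apply: filterS fg => x ->.
Qed.

Section with_potential.
Variable V : E -> R.
Hypotheses (mV : measurable_fun setT V) (V0 : {ae mu, forall x, 0 <= V x}).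
Local Notation X := (energy_space V).

Definition energy_fun (z : X) : E -> R[i] := cplx (z (false, None)) (z (true, None)).

Lemma sqrt_potential_Lfun (p q : L) :
  mu.-integrable setT (fun x => (V x * normc (cplx p q x) ^+ 2)%:E) ->
  (fun x => Num.sqrt (V x) * p x) \in Lfun mu 2%:E /\
  (fun x => Num.sqrt (V x) * q x) \in Lfun mu 2%:E.
Proof.
move=> I; have ms : measurable_fun setT (fun x => Num.sqrt (V x)).
  exact: measurableT_comp (@measurable_sqrt R) mV.
(* [Num.sqrt] vanishes on negative numbers, which makes this bound hold at every point. *)
have W x : Num.sqrt (V x) ^+ 2 <= `|V x|.
  have [/ltW v0|v0] := ltP (V x) 0; first by rewrite (ler0_sqrtr v0) expr0n; exact: normr_ge0.
  by rewrite sqr_sqrtr// ler_norm.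
have N x : normc (cplx p q x) ^+ 2 = p x ^+ 2 + q x ^+ 2.
  by rewrite /= sqr_sqrtr// addr_ge0 ?sqr_ge0.
have key (f : L) : (forall x, f x ^+ 2 <= p x ^+ 2 + q x ^+ 2) ->
    (fun x => Num.sqrt (V x) * f x) \in Lfun mu 2%:E.
  move=> fN; have mf : measurable_fun setT (fun x => Num.sqrt (V x) * f x).
    by apply: measurable_funM => //; exact: L2_measurable.
  apply/Lfun2P; split => //; apply: le_integrable I => //.
    by apply/measurable_EFinP; exact: measurable_funX.
  have pq0 x : 0 <= p x ^+ 2 + q x ^+ 2 by rewrite addr_ge0 ?sqr_ge0.
  move=> x _; rewrite lee_fin N exprMn.
  rewrite (ger0_norm (mulr_ge0 (sqr_ge0 _) (sqr_ge0 _))) normrM (ger0_norm (pq0 x)).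
  by apply: ler_pM; rewrite ?sqr_ge0.
by split; apply: key => x; rewrite ?lerDl ?lerDr sqr_ge0.
Qed.

Lemma form_domain_energy u : form_domain V u -> exists z : X, u = energy_fun z.
Proof.
move=> [[uL [Du HD]] Vu].
have [p [q uE]] := L2_cplx uL; subst u.
have [sp sq] := sqrt_potential_Lfun Vu.
have /choice[g gP] : forall i, exists g : L * L, Du i = cplx g.1 g.2.
  by move=> i; have [/L2_cplx[a [b ->]] _] := HD i; exists (a, b).
have gw i : real_weak_partial i p (g i).1 /\ real_weak_partial i q (g i).2.
  by apply/weak_partial_cplx; rewrite -gP; have [] := HD i.
pose z : {ffun bool * option (option 'I_d) -> L} := [ffun k =>
  match k with
  | (false, None) => p | (true, None) => q
  | (false, Some None) => toL sp | (true, Some None) => toL sq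
  | (false, Some (Some i)) => (g i).1 | (true, Some (Some i)) => (g i).2
  end].
have zE : z \in energy_pred V.
  apply/asboolP => -[]; rewrite !ffunE; split; try exact: aeW;
    by move=> i; rewrite !ffunE; have [] := gw i.
by exists (EnergySpace zE); rewrite /energy_fun /= !ffunE.
Qed.

Lemma energy_weak_gradient (z : X) : weak_gradient (energy_fun z)
  (fun i => cplx (z (false, Some (Some i))) (z (true, Some (Some i)))).
Proof.
move=> i; split; first exact: cplx_L2.
by apply/weak_partial_cplx; split; [have [] := energyP z false|have [] := energyP z true].
Qed.

Lemma energy_form_domain (z : X) : form_domain V (energy_fun z).
Proof.
split.
  split; first exact: cplx_L2.
  exists (fun i => cplx (z (false, Some (Some i))) (z (true, Some (Some i)))).
  exact: energy_weak_gradient.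
have mp b k : measurable_fun setT (z (b, k) : E -> R) by exact: L2_measurable.
have N x : normc (energy_fun z x) ^+ 2 = z (false, None) x ^+ 2 + z (true, None) x ^+ 2.
  by rewrite /= sqr_sqrtr// addr_ge0 ?sqr_ge0.
under eq_fun do rewrite N.
have mf : measurable_fun setT
    (fun x => (V x * (z (false, None) x ^+ 2 + z (true, None) x ^+ 2))%:E).
  apply/measurable_EFinP; apply: measurable_funM => //.
  by apply: measurable_funD; exact: measurable_funX.
have I := integrableD measurableT (L2_sqr_integrable (z (false, Some None)))
  (L2_sqr_integrable (z (true, Some None))).
apply/integrableP; split => //.
have /integrableP[mI] := I; apply: le_lt_trans.
rewrite le_eqVlt; apply/orP; left; apply/eqP; apply: ae_eq_integral => //.
- exact: measurableT_comp.
- exact: measurableT_comp.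
have [s1 _] := energyP z false; have [s2 _] := energyP z true.
near=> x => _ /=; congr (`|_|%:E).
have -> : z (false, Some None) x = Num.sqrt (V x) * z (false, None) x by near: x.
have -> : z (true, Some None) x = Num.sqrt (V x) * z (true, None) x by near: x.
have v0 : 0 <= V x by near: x.
by rewrite !exprMn sqr_sqrtr// mulrDr.
Unshelve. all: by end_near. Qed.

(** [grad] is picked by choice, so it agrees with the stored components only a.e. *)
Lemma grad_energy (z : X) i : exists a b : L, [/\ grad (energy_fun z) i = cplx a b,
  {ae mu, forall x, a x = z (false, Some (Some i)) x} &
  {ae mu, forall x, b x = z (true, Some (Some i)) x}].
Proof.
have wz := energy_weak_gradient z.
have : weak_gradient (energy_fun z) (grad (energy_fun z)).
  by apply: (@xgetPex _ _ (weak_gradient (energy_fun z))); eexists; exact: wz.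
move=> /(_ i)[/L2_cplx[a [b gE]]]; rewrite gE => /weak_partial_cplx[wa wb].
exists a, b; split => //.
  by apply: real_weak_partial_unique wa _; have [] := energyP z false.
by apply: real_weak_partial_unique wb _; have [] := energyP z true.
Qed.

(** The real part of [schrodinger_form], obtained by removing the [L_2] product that [form_H1V]
    contains. *)
Definition dirichlet (z z' : X) := form_H1V V z z' - form_L2 V z z'.

Lemma dirichletE z z' : dirichlet z z' = \sum_(b : bool)
  (ip mu (z (b, Some None)) (z' (b, Some None)) +
    \sum_i ip mu (z (b, Some (Some i))) (z' (b, Some (Some i)))).
Proof.
rewrite /dirichlet form_H1VE form_L2E !big_bool.
set f0 := ip _ _ _; rewrite /=; ring.
Qed.

(** The form is conjugate linear in its second argument: at [i z'] it takes [-i] times its value at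
    [z'], so the real part there is the imaginary part sought. *)
Lemma schrodinger_form_energy z z' : schrodinger_form V (energy_fun z) (energy_fun z') =
  dirichlet z z' +i* dirichlet z (rotate 0 1 z').
Proof.
have innerE i : inner (grad (energy_fun z) i) (grad (energy_fun z') i) =
   inner (cplx (z (false, Some (Some i))) (z (true, Some (Some i))))
     (cplx (z' (false, Some (Some i))) (z' (true, Some (Some i)))).
  have [a [b [-> ae be]]] := grad_energy z i.
  have [a' [b' [-> ae' be']]] := grad_energy z' i.
  rewrite !inner_cplx !(ip_ae _ ae) !(ip_ae _ be).
  by rewrite ![ip mu _ a']formC ![ip mu _ b']formC !(ip_ae _ ae') !(ip_ae _ be')
    ![ip mu (z' _) _]formC.
(* One factor [sqrt V] goes to each argument, and the potential term becomes an inner product of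
   stored components. *)
have potE : cintegral (fun x => (V x)%:C * energy_fun z x * (energy_fun z' x)^*) =
   inner (cplx (z (false, Some None)) (z (true, Some None)))
     (cplx (z' (false, Some None)) (z' (true, Some None))).
  have mp (w : X) b k : measurable_fun setT (w (b, k) : E -> R) by exact: L2_measurable.
  have [s1 _] := energyP z false; have [s2 _] := energyP z true.
  have [s3 _] := energyP z' false; have [s4 _] := energyP z' true.
  rewrite /inner /cintegral; congr (_ +i* _); apply: ae_eq_Rintegral => /=.
  - under eq_fun do rewrite !mul0r !subr0 addr0 mulrN opprK.
    apply: measurable_funD; apply: measurable_funM => //; exact: measurable_funM.
  - under eq_fun do rewrite mulrN opprK.
    by apply: measurable_funD; apply: measurable_funM.
  - near=> x.
    have -> : z (false, Some None) x = Num.sqrt (V x) * z (false, None) x by near: x.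
    have -> : z (true, Some None) x = Num.sqrt (V x) * z (true, None) x by near: x.
    have -> : z' (false, Some None) x = Num.sqrt (V x) * z' (false, None) x by near: x.
    have -> : z' (true, Some None) x = Num.sqrt (V x) * z' (true, None) x by near: x.
    have v0 : 0 <= V x by near: x.
    have := esym (sqr_sqrtr v0); move: (Num.sqrt (V x)) => r ->; ring.
  - under eq_fun do rewrite !mul0r !subr0 addr0 mulrN.
    apply: measurable_funD; last by apply: measurable_funM => //; exact: measurable_funM.
    by apply: measurable_funN; apply: measurable_funM => //; exact: measurable_funM.
  - under eq_fun do rewrite mulrN.
    by apply: measurable_funD; [apply: measurable_funN|]; apply: measurable_funM.
  - near=> x.
    have -> : z (false, Some None) x = Num.sqrt (V x) * z (false, None) x by near: x.
    have -> : z (true, Some None) x = Num.sqrt (V x) * z (true, None) x by near: x.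
    have -> : z' (false, Some None) x = Num.sqrt (V x) * z' (false, None) x by near: x.
    have -> : z' (true, Some None) x = Num.sqrt (V x) * z' (true, None) x by near: x.
    have v0 : 0 <= V x by near: x.
    have := esym (sqr_sqrtr v0); move: (Num.sqrt (V x)) => r ->; ring.
rewrite /schrodinger_form potE (eq_bigr _ (fun i _ => innerE i)).
under eq_bigr do rewrite inner_cplx.
rewrite complex_sum inner_cplx !dirichletE !big_bool.
congr (_ +i* _).
  rewrite big_split /=; ring.
have -> : \sum_i ip mu (z (true, Some (Some i))) (rotate 0 1 z' (true, Some (Some i))) =
    \sum_i ip mu (z (true, Some (Some i))) (z' (false, Some (Some i))).
  by apply: eq_bigr => i _; rewrite rotate_im scale0r scale1r add0r.
have -> : \sum_i ip mu (z (false, Some (Some i))) (rotate 0 1 z' (false, Some (Some i))) =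
    - \sum_i ip mu (z (false, Some (Some i))) (z' (true, Some (Some i))).
  rewrite -sumrN; apply: eq_bigr => i _.
  by rewrite rotate_re scale0r scale1r add0r (linearN (ip mu _)).
rewrite rotate_im rotate_re !scale0r !scale1r !add0r (linearN (ip mu _)).
rewrite big_split sumrN /=; ring.
Unshelve. all: by end_near. Qed.

End with_potential.
End complex_functions.

Lemma cauchy_schwarz2 (R : realFieldType) (A B P Q s t : R) :
  0 <= A -> 0 <= B -> 0 <= P -> 0 <= Q -> s ^+ 2 <= A * P -> t ^+ 2 <= B * Q ->
  (s + t) ^+ 2 <= (A + B) * (P + Q).
Proof.
move=> A0 B0 P0 Q0 s2 t2.
have st : 2 * s * t <= A * Q + B * P.
  have [st0|st0] := leP (2 * s * t) 0.
    by apply: le_trans st0 _; rewrite addr_ge0 ?mulr_ge0.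
  rewrite -(@ler_pXn2r _ 2) ?nnegrE ?(ltW st0) ?addr_ge0 ?(mulr_ge0 A0) ?(mulr_ge0 B0)//.
  have : s ^+ 2 * t ^+ 2 <= (A * P) * (B * Q) by apply: ler_pM; rewrite ?sqr_ge0.
  have := sqr_ge0 (A * Q - B * P); nra.
rewrite sqrrD mulrDl !mulrDr -mulr_natl; move: s2 t2 st; lra.
Qed.

(** * Reduction of the operator to real forms, and its spectrum *)

Section spectral_theory.
Import ComplexField.Normc.
Local Open Scope complex_scope.
Context {R : realType} {d : nat}.
Local Notation E := 'rV[R]_d.
Local Notation mu := (@lebesgue_rV R d).
Local Notation L := (LfunType mu (lee1n 2)).
Variable V : E -> R.
Hypotheses (mV : measurable_fun setT V) (V0 : {ae mu, forall x, 0 <= V x}).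
Local Notation X := (energy_space V).
Local Notation H := (schrodinger V).
Local Notation h := (form_H1V V).
Local Notation m := (form_L2 V).

(** The real part of the [L_2] inner product of [a + i b] with the function encoded by [z]. *)
Definition pairing (a b : L) (z : X) : R :=
  ip mu a (z (false, None)) + ip mu b (z (true, None)).

Fact pairing_scalar a b : scalar (pairing a b).
Proof.
move=> t u v; rewrite /pairing !energyDZ !formDr !formZr; ring.
Qed.

HB.instance Definition _ a b := GRing.isLinear.Build R X R *%R
  (pairing a b) (pairing_scalar a b).

Lemma pairing_le a b z : `|pairing a b z| <=
  Num.sqrt (ip mu a a + ip mu b b) * seminorm m z.
Proof.
rewrite -sqrtrM ?addr_ge0 ?form_ge0// -sqrtr_sqr ler_wsqrtr// form_L2E /pairing.
have := form_CS (ip mu) a (z (false, None)); have := form_CS (ip mu) b (z (true, None)).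
have := form_ge0 (ip mu) a; have := form_ge0 (ip mu) b.
have := form_ge0 (ip mu) (z (false, None)); have := form_ge0 (ip mu) (z (true, None)).
set A := ip mu a a; set B := ip mu b b; set P := ip mu (z (false, None)) (z (false, None)).
set Q := ip mu (z (true, None)) (z (true, None)); set s := ip mu a _; set t := ip mu b _.
move=> Q0 P0 B0 A0 t2 s2.
by apply: cauchy_schwarz2.
Qed.

Lemma inner_energy (a b : L) (z : X) : inner (cplx a b) (energy_fun z) =
  pairing a b z +i* pairing a b (rotate 0 1 z).
Proof.
rewrite inner_cplx /pairing rotate_re rotate_im !scale0r !scale1r !add0r.
by rewrite (linearN (ip mu a)); congr (_ +i* _); rewrite addrC.
Qed.

(** One real identity for all [z'] contains the complex one, because [rotate 0 1 z'] is a test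
    vector as well. *)
Lemma schrodinger_energy (z : X) (a b : L) : H (energy_fun z) (cplx a b) <->
  forall z', dirichlet z z' = pairing a b z'.
Proof.
split=> [[_ _ Hz] z'|Hz].
  by have := Hz _ (energy_form_domain mV V0 z'); rewrite schrodinger_form_energy//
    inner_energy => -[].
split; [exact: energy_form_domain|exact: cplx_L2|].
move=> v /(form_domain_energy mV)[z' ->].
by rewrite schrodinger_form_energy// inner_energy !Hz.
Qed.

Lemma energy_shift (z : X) (a b : L) (x y : R) :
  (fun w => cplx a b w + (x +i* y) * energy_fun z w) =
  cplx (a + rotate x y z (false, None) : L) (b + rotate x y z (true, None) : L).
Proof.
apply/funext => w; rewrite rotate_re rotate_im /energy_fun /cplx.
by apply/eqP; rewrite eq_complex; apply/andP; split.
Qed.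

(** Adding [m z z'] to both sides turns [dirichlet] into [h], hence the shift to [x + 1]. *)
Lemma shifted_energy (z : X) (a b : L) (x y : R) :
  shifted H (x +i* y) (energy_fun z) (cplx a b) <->
  forall z', h z z' = m (rotate (x + 1) y z) z' + pairing a b z'.
Proof.
rewrite /shifted energy_shift schrodinger_energy.
have E1 z' : pairing (a + rotate x y z (false, None)) (b + rotate x y z (true, None)) z' =
    pairing a b z' + m (rotate (x + 1) y z) z' - m z z'.
  rewrite /pairing !form_L2E !rotate_re !rotate_im !formE; ring.
rewrite /dirichlet; split=> Hz z'; have := Hz z'; rewrite ?E1 => Hz'.
  by apply/eqP; rewrite -subr_eq0; apply/eqP; move: Hz'; lra.
by rewrite Hz'; ring.
Qed.

Lemma cplx0 : (fun=> 0) = cplx (0 : L) (0 : L).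
Proof. by apply/funext. Qed.

Lemma shifted0_energy (z : X) (x y : R) :
  shifted H (x +i* y) (energy_fun z) (fun=> 0) <->
  forall z', h z z' = m (rotate (x + 1) y z) z'.
Proof.
rewrite cplx0 shifted_energy; split=> Hz z'; have := Hz z';
  rewrite /pairing !(formC (ip mu) 0) !linear0 !addr0 //.
Qed.

Lemma eigenspace_shifted0 u (w : R[i]) : Defs.eigenspace H w u <-> shifted H w u (fun=> 0).
Proof.
rewrite /Defs.eigenspace /shifted /=.
by rewrite (_ : (fun x => 0 + w * u x) = (fun x => w * u x))//;
  apply/funext => x; rewrite add0r.
Qed.

Lemma shifted_form_domain u f (w : R[i]) : shifted H w u f -> form_domain V u.
Proof. by case. Qed.

Lemma energy_fun_eq0 (z : X) : seminorm m z = 0 <-> eq_ae (energy_fun z) (fun=> 0).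
Proof.
split=> [z0|z0].
  have : m z z = 0 by rewrite -sqr_seminorm z0 expr0n.
  rewrite form_L2E => /eqP; rewrite paddr_eq0 ?form_ge0// => /andP[/eqP p0 /eqP q0].
  have := ip_eq0 q0; apply: filterS2 (ip_eq0 p0) => x px qx.
  by rewrite /energy_fun /cplx px qx.
have ae0 b : {ae mu, forall x, z (b, None) x = (0 : L) x}.
  by apply: filterS z0 => x; rewrite /energy_fun /cplx; case: b => -[].
rewrite /seminorm form_L2E !(ip_ae _ (ae0 _)) !(formC (ip mu) 0) !linear0.
by rewrite addr0 sqrtr0.
Qed.

Lemma L2norm_energy (z : X) : L2norm (energy_fun z) = (seminorm m z)%:E.
Proof. by rewrite L2norm_cplx /seminorm form_L2E. Qed.

Hypothesis cpt : finite_compactness h m.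

Lemma resolvent_or_eigenvalue (w : R[i]) :
  ~ is_eigenvalue H w -> resolvent_set H w.
Proof.
case: w => x y Hw.
have uniq (z : X) : (forall v, h z v = m (rotate (x + 1) y z) v) -> seminorm m z = 0.
  move=> /shifted0_energy/eigenspace_shifted0 ez; apply/energy_fun_eq0.
  by apply: contrapT => nz; apply: Hw; exists (energy_fun z).
have rk z : seminorm m (rotate (x + 1) y z) <= Num.sqrt ((x + 1) ^+ 2 + y ^+ 2) * seminorm m z.
  by rewrite seminorm_rotate.
have [M M0 HM] := fredholm (Z := rotate (x + 1) y) (@energy_complete R d V)
  (@form_L2_le R d V) cpt (sqrtr_ge0 _) rk uniq.
have solve (a b : L) : exists2 z : X, shifted H (x +i* y) (energy_fun z) (cplx a b) &
    (L2norm (energy_fun z) <= M%:E * L2norm (cplx a b))%E.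
  have [z [zP zM]] := HM (pairing a b) _ (sqrtr_ge0 _) (pairing_le a b).
  exists z; first exact/shifted_energy.
  by rewrite L2norm_energy L2norm_cplx -EFinM lee_fin.
split.
- by move=> f /L2_cplx[a [b ->]]; have [z Hz _] := solve a b; exists (energy_fun z).
- move=> u Hu; have [z uE] := form_domain_energy mV (shifted_form_domain Hu); subst u.
  by apply/energy_fun_eq0/uniq/shifted0_energy.
exists M => u f Hu; have [z uE] := form_domain_energy mV (shifted_form_domain Hu); subst u.
(* [shifted] places in [L_2] only the sum of [f] and a multiple of [u]; subtracting that multiple
   gives [f]. *)
have [a [b fE]] : exists a b : L, f = cplx a b.
  have [_ /L2_cplx[a' [b' fE]] _] := Hu.
  exists (a' - rotate x y z (false, None)), (b' - rotate x y z (true, None)).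
  have := energy_shift z (a' - rotate x y z (false, None)) (b' - rotate x y z (true, None)) x y.
  rewrite !subrK -fE => Ef; apply/funext => t.
  by have := congr1 (fun g => g t) Ef => /addIr.
(* The bound is known for the solution that [solve] constructs; uniqueness carries it to every
   solution. *)
subst f; have [z' Hz' Hn] := solve a b.
move: Hu => /shifted_energy Hu; move: Hz' => /shifted_energy Hz'.
have zz' : seminorm m (z - z') = 0.
  apply: uniq => v; rewrite formBl Hu Hz' (linearB (rotate (x + 1) y)) formBl; ring.
apply: le_trans Hn; rewrite !L2norm_energy lee_fin.
rewrite -[z in leLHS](subrK z'); apply: le_trans (seminormD _ _ _) _.
by rewrite zz' add0r.
Qed.

Lemma eigenvalue_energy (w : R[i]) : is_eigenvalue H w -> exists x (z : X),
  [/\ w = x%:C, 0 < m z z & forall v, h z v = (x + 1) * m z v].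
Proof.
case: w => x y [u ue nu].
have [z uE] := form_domain_energy mV (shifted_form_domain ((eigenspace_shifted0 _ _).1 ue)).
subst u.
move: ue => /eigenspace_shifted0/shifted0_energy Hz.
have mz : 0 < m z z.
  rewrite lt_neqAle form_ge0 andbT eq_sym; apply/eqP => z0; apply: nu.
  by apply/energy_fun_eq0; rewrite /seminorm z0 sqrtr0.
have E1 v : m (rotate (x + 1) y z) v = (x + 1) * m z v + y * m (rotate 0 1 z) v.
  rewrite !form_L2E !rotate_re !rotate_im !formE; ring.
(* Testing with [i z] leaves [y * m z z = 0]. *)
have y0 : y = 0.
  have := Hz (rotate 0 1 z).
  rewrite form_H1V_rotate01 E1 form_L2_rotate01 mulr0 add0r form_L2_rotate.
  rewrite expr0n expr1n add0r mul1r => /esym/eqP.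
  by rewrite mulf_eq0 (gt_eqF mz) orbF => /eqP.
exists x, z; split => // [|v]; first by rewrite y0.
by rewrite Hz E1 y0 mul0r addr0.
Qed.

Lemma schrodinger_discrete : discrete_spectrum H.
Proof.
have spec_eig w : spectrum H w -> is_eigenvalue H w.
  by move=> sw; apply: contrapT => /resolvent_or_eigenvalue.
move=> w sw; have ew := spec_eig w sw; split => //.
- have [x [z [wE _ _]]] := eigenvalue_energy ew.
  (* An eigenvalue within distance [1] of [w] is at most [|x| + 1], and the equation for [h] shifts
     it by [1]. *)
  have [n Hn] := finite_compactness_eigen (`|x| + 2) cpt.
  apply: contrapT => niso.
  (* Without isolation there is a point of the spectrum strictly nearer to [w] than [t], yet
     different from [w]; [0] is a dummy value when [t] is [w]. *)
  have next (t : R[i]) : exists t', 0 < normc (t - w) ->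
      spectrum H t' /\ 0 < normc (t' - w) < normc (t - w).
    have [t0|t0] := ltP 0 (normc (t - w)); last by exists 0.
    apply: contrapT => /forallNP Ht; apply: niso; exists (normc (t - w)) => // t' st' t't.
    apply: contrapT => tw; apply: (Ht t') => _; split => //; rewrite t't andbT.
    have n0 : 0 <= normc (t' - w) by case: (t' - w) => ? ?; exact: sqrtr_ge0.
    rewrite lt_neqAle n0 andbT eq_sym; apply/eqP => /eq0_normc/eqP.
    by rewrite subr_eq0 => /eqP.
  have /choice[nx nxP] := next.
  (* The point [w + 1] only sets the initial distance to [1] and may lie outside the spectrum, so
     the sequence begins after one step. Its distances to [w] decrease strictly, which makes the
     eigenvalues distinct. *)
  pose t k := iter k.+1 nx (w + 1).
  have t0 : normc (w + 1 - w) = 1 by rewrite addrAC subrr add0r normc1.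
  have tP k : spectrum H (t k) /\ 0 < normc (t k - w) < 1.
    elim: k => [|k [_ /andP[IH1 IH2]]].
      have := nxP (w + 1); rewrite t0 => /(_ ltr01)[s1 s2]; split => //.
    have [s1 /andP[s2 s3]] := nxP (t k) IH1; split => //.
    by apply/andP; split => //; exact: lt_trans IH2.
  have tdec k l : (k < l)%N -> normc (t l - w) < normc (t k - w).
    elim: l => // l IH; rewrite ltnS leq_eqVlt => kl.
    have [_ /andP[tl0 _]] := tP l; have [_ /andP[_ H1]] := nxP (t l) tl0.
    move: kl => /predU1P[->//|/IH]; exact: lt_trans.
  have /choice[e eP] : forall k, exists e : R * X, [/\ t k = e.1%:C, 0 < m e.2 e.2 &
      forall v, h e.2 v = (e.1 + 1) * m e.2 v].
    by move=> k; have [x' [z' H']] := eigenvalue_energy (spec_eig _ (tP k).1); exists (x', z').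
  have [|||i i0] := Hn (fun i => (e i).2) (fun i => (e i).1 + 1).
  + by move=> i v; have [_ _] := eP i.
  + move=> i; have [te _ _] := eP i; have [_ /andP[_]] := tP i.
    rewrite te wE /= subr0 expr0n addr0 sqrtr_sqr => H1.
    have := ler_norm x; have := ler_norm ((e i).1 - x); move: H1; lra.
  + move=> i j /addIr ij; apply/val_inj.
    have [ti _ _] := eP i; have [tj _ _] := eP j.
    case: (ltngtP i j) => // /tdec; by rewrite ti tj ij ltxx.
  by have [_ + _] := eP i; rewrite i0 ltxx.
have [x [_ [wE _ _]]] := eigenvalue_energy ew.
pose S (z : X) := Defs.eigenspace H w (energy_fun z).
have SE z : S z <-> forall v, h z v = (x + 1) * m z v.
  rewrite /S wE eigenspace_shifted0 shifted0_energy.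
  have E1 v : m (rotate (x + 1) 0 z) v = (x + 1) * m z v.
    rewrite !form_L2E !rotate_re !rotate_im !formE; ring.
  by split=> Hz v; rewrite Hz E1.
have [|c u v /SE Su /SE Sv|u /SE ->|n [b [Sb Hb]]] :=
    finite_compactness_dim (S := S) (a := x + 1) cpt.
- by apply/SE => v; rewrite !(formC _ 0) !linear0 mulr0.
- by apply/SE => t; rewrite !formDl !formZl Su Sv; ring.
- by [].
exists n, (fun i => energy_fun (b i)); split => // u ue.
have [z uE] := form_domain_energy mV (shifted_form_domain ((eigenspace_shifted0 _ _).1 ue)).
subst u; have [c cP] := Hb z ue.
(* Finitely many vectors span the eigenspace already over the reals, so real coefficients do. *)
exists (fun i => (c i)%:C).
have : seminorm m (z - \sum_i c i *: b i) = 0 by rewrite /seminorm cP sqrtr0.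
move/energy_fun_eq0; apply: filterS => t.
have sumE k : (\sum_i c i *: b i : X) k t = \sum_i c i * b i k t.
  elim/big_rec2: _ => [|i r s _ <-]; last by rewrite energyDZ.
  by rewrite -[0 in LHS](subrr (0 : X)) energyB subrr.
have -> : \sum_(i < n) (c i)%:C * energy_fun (b i) t =
    \sum_(i < n) ((c i * b i (false, None) t) +i* (c i * b i (true, None) t)).
  by apply: eq_bigr => i _; rewrite /energy_fun /cplx; apply/eqP;
    rewrite eq_complex /= !mul0r subr0 addr0 !eqxx.
rewrite complex_sum -!sumE {1}/energy_fun /cplx !energyB => -[h1 h2].
rewrite /energy_fun /cplx; congr (_ +i* _); apply/eqP; rewrite -subr_eq0; exact/eqP.
Qed.

End spectral_theory.

Theorem theorem3p1 (R : realType) (d : nat) (d_ge3 : (3 <= d)%N)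
    (V : 'rV[R]_d -> R) (V_loc : loc_integrable V)
    (V_ge0 : {ae @lebesgue_rV R d, forall x, 0 <= V x})
    (G : set 'rV[R]_d) (G_adm : admissible_domain G)
    (r0 : R) (r0_gt0 : 0 < r0) (gamma : R -> R)
    (gamma01 : forall r, 0 < r < r0 -> 0 < gamma r < 1)
    (gamma_limsup :
      limf_esup
        (fun r : R => (r `^ (- (2 * (d%:R - 2) / d%:R)) * gamma r)%:E) 0^'+
      = +oo%E)
    (V_inf : forall r, 0 < r < r0 ->
      ereal_inf [set (\int[@lebesgue_rV R d]_(x in dilate G r y `\` F)
                       (V x)%:E)%E | F in small_subsets G (gamma r) y r]
        @[y --> at_infinity] --> +oo%E) :
  discrete_spectrum (schrodinger V).
Proof.
have [mV _] := V_loc.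
apply: (schrodinger_discrete mV V_ge0).
apply: energy_finite_compactness => e e0.
exact: (energy_compactness d_ge3 mV V_ge0 G_adm r0_gt0 gamma01 gamma_limsup V_inf e0).
Qed.
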